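(* Let $\mathcal{H}$ be a separable real Hilbert space and let $T\colon \mathcal{H}\to\mathcal{H}$ be a positive self-adjoint compact operator whose eigenvalues $\{\lambda_n\}_{n\in\mathbb{N}^*}$, listed in non-increasing order, are positive and satisfy \[ \lambda_n = \frac{c_1}{n^{\alpha_1}} + \frac{c_2}{n^{\alpha_2}} + o_{n\to\infty}\!\left(\frac{1}{n^{\alpha_2}}\right), \] where $c_1>0$, $c_2\in\mathbb{R}$, $\alpha_1,\alpha_2>0$ are such that either $\alpha_1<\alpha_2<\alpha_1+1/2$, or $\alpha_1=\alpha_2$ and $c_2=0$. Then \[ H(\varepsilon;T) = \frac{\alpha_1 c_1^{1/\alpha_1}}{\ln 2}\,\varepsilon^{-1/\alpha_1} + \frac{c_2\, c_1^{(1-\alpha_2)/\alpha_1}}{\ln(2)(\alpha_1-\alpha_2+1)}\,\varepsilon^{-\frac{\alpha_1-\alpha_2+1}{\alpha_1}} + o_{\varepsilon\to 0}\!\left(\varepsilon^{-\frac{\alpha_1-\alpha_2+1}{\alpha_1}}\right), \] and equivalently \[ \varepsilon_m(T) = c_1\left(\frac{\alpha_1}{\ln 2}\right)^{\alpha_1} m^{-\alpha_1} + \frac{c_2}{\alpha_1-\alpha_2+1}\left(\frac{\alpha_1}{\ln 2}\right)^{\alpha_2} m^{-\alpha_2} + o_{m\to\infty}\!\left(m^{-\alpha_2}\right). \]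
   Context: $\mathbb{N}^*$ denotes the positive integers; $\log$ is base $2$, $\ln$ is the natural logarithm. For a compact set $K$ in a metric space $(X,d)$, $N(\varepsilon;K,d)$ is the minimal cardinality of a set $\{x_1,\dots,x_N\}\subseteq X$ such that every $x\in K$ has $d(x,x_i)\le\varepsilon$ for some $i$, and the metric entropy is $H(\varepsilon;K,d)=\log N(\varepsilon;K,d)$. For a compact linear operator $T$ on a Hilbert space $\mathcal{H}$ with closed unit ball $\mathcal{B}$, the entropy of $T$ is $H(\varepsilon;T)=H(\varepsilon;\overline{T(\mathcal{B})},\|\cdot\|_{\mathcal{H}})$ and, for $m\in\mathbb{N}^*$, the $m$-th entropy number is $\varepsilon_m(T)=\inf\{\varepsilon>0: H(\varepsilon;T)\le m\}$. $f=o_{x\to\ell}(g)$ means $f(x)/g(x)\to 0$. *)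

(* Defs.v *)
From HB Require Import structures.
From mathcomp Require Import all_boot all_order all_algebra.
From mathcomp Require Import all_classical all_reals all_analysis.
Set Implicit Arguments. Unset Strict Implicit. Unset Printing Implicit Defensive.
Import Order.TTheory GRing.Theory Num.Theory.
Import numFieldNormedType.Exports.
Local Open Scope classical_set_scope.
Local Open Scope ring_scope.

Section Defs.
Variables (R : realType) (V : normedModType R).

Definition is_inner_product (ip : V -> V -> R) : Prop :=
  [/\ (forall x y, ip x y = ip y x),
      (forall a x y z, ip (a *: x + y) z = a * ip x z + ip y z) &
      (forall x, ip x x = `|x| ^+ 2)].

Definition separable_space : Prop :=
  exists D : set V, countable D /\ closure D = setT.

Definition unit_cball : set V := [set x | `|x| <= 1].

Definition self_adjoint (ip : V -> V -> R) (T : V -> V) : Prop :=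
  forall x y, ip (T x) y = ip x (T y).

Definition positive_op (ip : V -> V -> R) (T : V -> V) : Prop :=
  forall x, 0 <= ip (T x) x.

Definition compact_op (T : V -> V) : Prop :=
  compact (closure (T @` unit_cball)).

(* (lam n)_{n >= 1} is the non-increasing enumeration, counted with
   multiplicity, of the nonzero eigenvalues of the compact self-adjoint T:
   there is an orthonormal family (e n)_{n>=1} of eigenvectors, T e_n = lam_n e_n,
   and T vanishes on the orthogonal complement of this family (so the lam_n
   exhaust the nonzero eigenvalues, each with its full multiplicity). *)
Definition eigenvalue_enum (ip : V -> V -> R) (T : V -> V) (lam : nat -> R) : Prop :=
  (forall n m, (0 < n)%N -> (n <= m)%N -> lam m <= lam n) /\
  exists e : nat -> V,
    [/\ (forall n m, (0 < n)%N -> (0 < m)%N -> ip (e n) (e m) = (n == m)%:R),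
        (forall n, (0 < n)%N -> T (e n) = lam n *: e n) &
        (forall x, (forall n, (0 < n)%N -> ip x (e n) = 0) -> T x = 0)].

Definition covers (eps : R) (K : set V) (s : seq V) : Prop :=
  forall x, K x -> exists2 y, y \in s & `|x - y| <= eps.

Definition covering_number (eps : R) (K : set V) : R :=
  inf [set (size s)%:R | s in [set s : seq V | covers eps K s]].

Definition metric_entropy (eps : R) (K : set V) : R :=
  ln (covering_number eps K) / ln 2.

Definition op_entropy (T : V -> V) (eps : R) : R :=
  metric_entropy eps (closure (T @` unit_cball)).

Definition entropy_number (T : V -> V) (m : nat) : R :=
  inf [set eps : R | 0 < eps /\ op_entropy T eps <= m%:R].

End Defs.

(* Main.v *)
(* Both expansions follow from a two-sided bound on the logarithm of the number
   N(eps) of balls of radius eps needed to cover T(B), namely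
     G(eps) <= ln N(eps) <= G(eps) + O(sqrt x * ln x),
   where G(eps) is the sum of ln(lambda_n / eps) over lambda_n > eps and x is
   defined by eps = c1 x^(-a1). With c = c2 / c1 and s = a1 - a2 + 1, an
   elementary summation gives G(eps) = a1 x + (c / s) x^s + o(x^s), and the
   error term is o(x^s) because s > 1/2.

   Lower bound. A cover of T(B) by N balls of radius eps yields one of T^p(B) by
   N^p balls of radius eps^p. A grid in the span of the first d eigenvectors
   shows N^p >= C_d (prod_{n <= d} lambda_n / eps)^p, and p tends to infinity.

   Upper bound. The eigenvectors are grouped into blocks of about sqrt x
   consecutive indices. If q_j is the share of the squared norm of u carried by
   block j, the corresponding component of T u lies in a ball of radius
   mu_j sqrt(q_j), mu_j being the largest eigenvalue of the block; rounding the
   q_j and covering this ball with radius eps sqrt(q_j), the squared errors of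
   the blocks and of the tail add up to about eps^2. This requires covering the
   unit ball of R^k by balls of radius r with only (1/r)^k poly(k, 1/r) of them.

   Covering a ball. A greedy algorithm reduces this to finding, for any finite
   set X of unit vectors of R^(2m), a point y within distance r of a fraction
   r^(2m) / poly(m) of X. The point y is drawn from a Gaussian law. The moments
   of exp(-rho |x - y|^2) for |x| = 1 are those of a Poisson mixture of Gamma
   laws, so polynomials in this quantity can be averaged in dimension one; a
   polynomial proxy for an indicator function gives the required probability. *)
Require Import Defs.
From HB Require Import structures.
From mathcomp Require Import all_boot all_order all_algebra.
From mathcomp Require Import all_classical all_reals all_analysis.
From mathcomp Require Import ring lra.
Set Implicit Arguments. Unset Strict Implicit. Unset Printing Implicit Defensive.
Import Order.TTheory GRing.Theory Num.Theory.
Import numFieldNormedType.Exports.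
Local Open Scope classical_set_scope.
Local Open Scope ring_scope.

(** * Gaussian averages and their radial law *)

(** What shapes the proof is the price of covering one block. The blocks together have dimension of
    order x, so a classical cover of a ball by [(3 / r)^k] balls would already spoil the term
    [a1 x]; only a loss polynomial in the dimension is affordable. Blocks of length [k] then lose
    about [(x / k) ln x] through these polynomial factors and [k ln x] by replacing eigenvalues by
    the largest of their block; [k] near sqrt x balances the two. The small inflation of the radius
    is absorbed by building the cover at x + 1 instead of x, at bounded cost.

    No volume in high dimension is computed. In the lower bound, the constant of a crude grid count
    does not depend on p, so it disappears in the limit. In the upper bound, the Gaussian law is a
    product, so its average is taken one coordinate at a time with integrals over the line. The
    dimension is even so that the Gamma laws have integer shape: their averages are then iterates of
    one elementary operation on polynomials. *)

Lemma normal_pdf_tilt (R : realType) (rho x y : R) (n : nat) : 0 < rho ->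
  expR (- (n%:R * rho * (x - y) ^+ 2)) * normal_pdf 0 (Num.sqrt (2 * rho))^-1 y =
  (Num.sqrt n.+1%:R)^-1 * expR (- (rho * x ^+ 2 * (n%:R / n.+1%:R))) *
  normal_pdf (n%:R * x / n.+1%:R) (Num.sqrt (2 * rho * n.+1%:R))^-1 y.
Proof.
move=> r0.
have n0 : 0 < n.+1%:R :> R by rewrite ltr0n.
have r1 : 0 < 2 * rho by rewrite mulr_gt0.
have r2 : 0 < 2 * rho * n.+1%:R by rewrite mulr_gt0.
rewrite !normal_pdfE ?invr_neq0 ?gt_eqF ?sqrtr_gt0//.
rewrite /normal_peak /normal_fun.
have E1 : (Num.sqrt (2 * rho))^-1 ^+ 2 = (2 * rho)^-1.
  by rewrite exprVn sqr_sqrtr// ltW.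
have E2 : (Num.sqrt (2 * rho * n.+1%:R))^-1 ^+ 2 = (2 * rho * n.+1%:R)^-1.
  by rewrite exprVn sqr_sqrtr// ltW.
rewrite E1 E2.
have -> : (Num.sqrt ((2 * rho * n.+1%:R)^-1 * pi *+ 2))^-1 =
   Num.sqrt n.+1%:R * (Num.sqrt ((2 * rho)^-1 * pi *+ 2))^-1.
  apply: (@mulIf _ (Num.sqrt ((2 * rho * n.+1%:R)^-1 * pi *+ 2))).
    by rewrite gt_eqF// sqrtr_gt0 mulrn_wgt0// mulr_gt0 ?pi_gt0// invr_gt0.
  rewrite mulVf; last first.
    by rewrite gt_eqF// sqrtr_gt0 mulrn_wgt0// mulr_gt0 ?pi_gt0// invr_gt0.
  rewrite mulrAC -sqrtrM ?ler0n//.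
  have -> : n.+1%:R * ((2 * rho * n.+1%:R)^-1 * pi *+ 2) = (2 * rho)^-1 * pi *+ 2 :> R.
    by field; rewrite !gt_eqF.
  by rewrite mulfV// gt_eqF// sqrtr_gt0 mulrn_wgt0// mulr_gt0 ?pi_gt0// invr_gt0.
set P := (Num.sqrt ((2 * rho)^-1 * pi *+ 2))^-1.
rewrite [LHS]mulrCA -expRD.
(* Completing the square: the Gaussian law has density proportional to [expR (- rho y^2)], so the
   weights [n rho] and [rho] add up to [(n + 1) rho]. *)
have -> : - (n%:R * rho * (x - y) ^+ 2) + - (y - 0) ^+ 2 / ((2 * rho)^-1 *+ 2) =
  - (rho * x ^+ 2 * (n%:R / n.+1%:R)) +
  - (y - n%:R * x / n.+1%:R) ^+ 2 / ((2 * rho * n.+1%:R)^-1 *+ 2).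
  rewrite -natr1; field.
  by rewrite (gt_eqF r0) /= addrC natr1 gt_eqF.
rewrite expRD.
set s := Num.sqrt _.
by field; rewrite gt_eqF// sqrtr_gt0.
Qed.

(** If the bound failed at every [y], multiplying by the Gaussian density and integrating would
    contradict the hypothesis. The weights [a] may be negative, as they will be coefficients of a
    polynomial. *)
Lemma gauss_average1 (R : realType) (I : Type) (s : seq I) (rho A : R)
    (a : I -> R) (n : I -> nat) (x : I -> R) : 0 < rho ->
  A < \sum_(t <- s) a t * ((Num.sqrt (n t).+1%:R)^-1 *
        expR (- (rho * x t ^+ 2 * ((n t)%:R / (n t).+1%:R)))) ->
  exists y, A < \sum_(t <- s) a t * expR (- ((n t)%:R * rho * (x t - y) ^+ 2)).
Proof.
move=> r0 hA; apply/not_existsP => hy.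
pose pdf t := normal_pdf ((n t)%:R * x t / (n t).+1%:R) (Num.sqrt (2 * rho * (n t).+1%:R))^-1.
pose pdf0 := normal_pdf 0 (Num.sqrt (2 * rho))^-1.
pose b t := a t * ((Num.sqrt (n t).+1%:R)^-1 *
        expR (- (rho * x t ^+ 2 * ((n t)%:R / (n t).+1%:R)))).
have hle y : \sum_(t <- s) b t * pdf t y <= A * pdf0 y.
  have -> : \sum_(t <- s) b t * pdf t y =
    (\sum_(t <- s) a t * expR (- ((n t)%:R * rho * (x t - y) ^+ 2))) * pdf0 y.
    rewrite mulr_suml; apply: eq_bigr => t _.
    by rewrite /b -mulrA -normal_pdf_tilt// mulrA.
  apply: ler_wpM2r; first exact: normal_pdf_ge0.
  by rewrite leNgt; apply/negP/hy.
have ib t : (@lebesgue_measure R).-integrable setT (fun y => (b t)%:E * (pdf t y)%:E)%E.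
  by apply: integrableZl => //; exact: integrable_normal_pdf.
have iA : (@lebesgue_measure R).-integrable setT (fun y => (A)%:E * (pdf0 y)%:E)%E.
  by apply: integrableZl => //; exact: integrable_normal_pdf.
have : (\int[@lebesgue_measure R]_y (\sum_(t <- s) (b t)%:E * (pdf t y)%:E) <=
       \int[@lebesgue_measure R]_y (A%:E * (pdf0 y)%:E))%E.
  apply: le_integral => //.
    by apply: integrable_sum => // t _; exact: ib.
  move=> y _; rewrite -EFinM.
  by under eq_bigr do rewrite -EFinM; rewrite sumEFin lee_fin.
rewrite integral_sum//.
rewrite integralZl//; last exact: integrable_normal_pdf.
rewrite integral_normal_pdf mule1.
under eq_bigr => t _.
  rewrite integralZl//; last exact: integrable_normal_pdf.
  rewrite integral_normal_pdf mule1; over.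
by rewrite sumEFin lee_fin leNgt hA.
Qed.

(** The coordinates of [y] are fixed one at a time, from the last to the first: those still free
    enter the weights through their Gaussian average, those already fixed through their exponential
    factor. *)
Lemma gauss_average (R : realType) (I : Type) (s : seq I) (rho A : R) (k : nat)
    (a : I -> R) (n : I -> nat) (x : I -> nat -> R) : 0 < rho ->
  A < \sum_(t <- s) a t * ((Num.sqrt (n t).+1%:R)^-1 ^+ k *
        expR (- (rho * (\sum_(i < k) x t i ^+ 2) * ((n t)%:R / (n t).+1%:R)))) ->
  exists y : nat -> R, A < \sum_(t <- s) a t *
    expR (- ((n t)%:R * rho * \sum_(i < k) (x t i - y i) ^+ 2)).
Proof.
move=> r0; elim: k a => [|k IH] a hA.
  exists (fun=> 0); apply: (lt_le_trans hA); apply: ler_sum => t _.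
  by rewrite !big_ord0 expr0 mul1r !mulr0 mul0r.
pose b t := a t * ((Num.sqrt (n t).+1%:R)^-1 ^+ k *
  expR (- (rho * (\sum_(i < k) x t i ^+ 2) * ((n t)%:R / (n t).+1%:R)))).
have [yk hk] : exists y, A < \sum_(t <- s) b t *
    expR (- ((n t)%:R * rho * (x t k - y) ^+ 2)).
  apply: gauss_average1 => //; apply: (lt_le_trans hA); apply: ler_sum => t _.
  rewrite /b big_ord_recr /= mulrDr mulrDl opprD expRD exprS.
  by rewrite le_eqVlt; apply/orP; left; apply/eqP; ring.
have [y hy] : exists y : nat -> R, A < \sum_(t <- s)
    (a t * expR (- ((n t)%:R * rho * (x t k - yk) ^+ 2))) *
    expR (- ((n t)%:R * rho * \sum_(i < k) (x t i - y i) ^+ 2)).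
  apply: IH; apply: (lt_le_trans hk); apply: ler_sum => t _.
  by rewrite /b; rewrite le_eqVlt; apply/orP; left; apply/eqP; ring.
exists (fun i => if i == k then yk else y i).
apply: (lt_le_trans hy); apply: ler_sum => t _.
rewrite big_ord_recr /= eqxx mulrDr opprD expRD.
under [in leRHS]eq_bigr => i _ do rewrite (ltn_eqF (ltn_ord i)).
by rewrite le_eqVlt; apply/orP; left; apply/eqP; ring.
Qed.

Lemma bernoulli_ineq (R : realDomainType) (x : R) (n : nat) : -1 <= x ->
  1 + n%:R * x <= (1 + x) ^+ n.
Proof.
move=> x1; elim: n => [|n IH]; first by rewrite mul0r addr0 expr0.
rewrite exprS; apply: (@le_trans _ _ ((1 + x) * (1 + n%:R * x))); last first.
  by apply: ler_wpM2l => //; lra.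
have : 0 <= n%:R * x ^+ 2 by rewrite mulr_ge0// sqr_ge0.
rewrite -natr1; nra.
Qed.

Lemma is_derive_ge0_le (R : realType) (f df : R -> R) (a b : R) : a <= b ->
  (forall x, a <= x <= b -> is_derive x 1 f (df x)) ->
  (forall x, a <= x <= b -> 0 <= df x) -> f a <= f b.
Proof.
move=> ab hf hd; rewrite -subr_ge0.
have [|||c] := @MVT_segment R f df a b => //.
- by move=> x; rewrite in_itv/= => /andP[/ltW ax /ltW xb]; apply: hf; rewrite ax.
- apply: derivable_within_continuous => x; rewrite in_itv/= => xab.
  by apply: ex_derive; exact: hf.
- by rewrite in_itv/= => cab ->; rewrite mulr_ge0 ?hd// subr_ge0.
Qed.

(** With [t = tau / 2], the polynomial [1 - (1 - X^a)^b - t] works once [b v1^a <= t] and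
    [b v0^a >= 1 / t]: Bernoulli gives [(1 - v^a)^b >= 1 - t] below [v1], and
    [(1 - v^a)^b <= (1 + v^a)^-b <= t] above [v0]. A large [a] separates [v0^a] from [v1^a] enough
    for such a [b] to exist. *)
Lemma threshold_poly (R : realType) (v1 v0 tau : R) :
  0 < v1 -> v1 < v0 -> v0 <= 1 -> 0 < tau ->
  exists p : {poly R}, forall v, 0 <= v <= 1 ->
    [/\ - tau <= p.[v], p.[v] <= 1, v <= v1 -> p.[v] <= 0 & v0 <= v -> 1 - tau <= p.[v]].
Proof.
move=> v1p v10 v01 tp.
pose t := tau / 2; have t0 : 0 < t by rewrite divr_gt0.
have [a ha] : exists a : nat, (t^-1 + 1) / t <= (v0 / v1) ^+ a.
  have r1 : 0 < v0 / v1 - 1 by rewrite subr_gt0 ltr_pdivlMr// mul1r.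
  pose C := (t^-1 + 1) / t / (v0 / v1 - 1).
  exists (Num.truncn C).+1.
  have := @bernoulli_ineq R (v0 / v1 - 1) (Num.truncn C).+1.
  rewrite subrKC => h; apply: le_trans (h _); last by lra.
  have := truncnS_gt C; rewrite {1}/C ltr_pdivrMr//.
  by move=> /ltW {}h; rewrite (le_trans h)// lerDr.
have v1a : 0 < v1 ^+ a by rewrite exprn_gt0.
pose b := Num.truncn (t / v1 ^+ a).
have b1 : b%:R * v1 ^+ a <= t.
  by rewrite -ler_pdivlMr// truncn_le divr_ge0// ltW.
(* Truncation costs [b] at most one unit, which the summand 1 in the choice of [a] pays for. *)
have b2 : t^-1 <= b%:R * v0 ^+ a.
  have h : t / v1 ^+ a - 1 <= b%:R.
    by have := truncnS_gt (t / v1 ^+ a); rewrite -/b -natr1; lra.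
  apply: (@le_trans _ _ ((t / v1 ^+ a - 1) * v0 ^+ a)); last first.
    by apply: ler_wpM2r => //; rewrite exprn_ge0//; lra.
  rewrite mulrBl mul1r mulrAC -mulrA -expr_div_n.
  have h1 : v0 ^+ a <= 1 by rewrite exprn_ile1//; lra.
  have : t^-1 + 1 <= t * (v0 / v1) ^+ a by rewrite mulrC -ler_pdivrMr.
  by lra.
exists (1 - (1 - 'X^a) ^+ b - t%:P) => v /andP[v0' v1'].
rewrite !(hornerE, horner_exp).
have w0 : 0 <= v ^+ a by rewrite exprn_ge0.
have w1 : v ^+ a <= 1 by rewrite exprn_ile1.
have u0 : 0 <= (1 - v ^+ a) ^+ b by rewrite exprn_ge0// subr_ge0.
have u1 : (1 - v ^+ a) ^+ b <= 1 by rewrite exprn_ile1// ?subr_ge0// gerBl.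
split.
- by rewrite /t; lra.
- by lra.
- move=> vv1.
  have := @bernoulli_ineq R (- v ^+ a) b; rewrite lerN2 => /(_ w1) h.
  have : b%:R * v ^+ a <= b%:R * v1 ^+ a by rewrite ler_wpM2l// lerXn2r// nnegrE ltW.
  by lra.
- move=> vv0.
  have h0 : t^-1 <= b%:R * v ^+ a.
    by rewrite (le_trans b2)// ler_wpM2l// lerXn2r// nnegrE; lra.
  have h1 : b%:R * v ^+ a <= (1 + v ^+ a) ^+ b.
    have := @bernoulli_ineq R (v ^+ a) b; have : -1 <= v ^+ a by lra.
    by move=> /[swap]/[apply]; lra.
  have h2 : (1 - v ^+ a) ^+ b * (1 + v ^+ a) ^+ b <= 1.
    rewrite -exprMn exprn_ile1//; first by rewrite mulr_ge0//; lra.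
    by have := sqr_ge0 (v ^+ a); nra.
  have h3 : (1 - v ^+ a) ^+ b <= t.
    have : (1 - v ^+ a) ^+ b * t^-1 <= 1.
      by apply: le_trans h2; apply: ler_wpM2l => //; exact: le_trans h0 h1.
    by rewrite ler_pdivrMr// mul1r.
  by rewrite /t in h3 *; lra.
Qed.

(* [(havg p).[v]] is the mean of [p.[v U]] for [U] uniform on [0, 1]. As [- ln U]
   is exponential, [(iter M havg p).[v]] is the mean of [p.[v * expR (- G)]] for
   [G] of law Gamma(M). *)
Definition havg {R : realType} (p : {poly R}) : {poly R} :=
  \poly_(i < size p) (p`_i / i.+1%:R).

Lemma coef_havg (R : realType) (p : {poly R}) i : (havg p)`_i = p`_i / i.+1%:R.
Proof.
rewrite coef_poly; case: ltnP => // h.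
by rewrite nth_default// mul0r.
Qed.

(** The factor [(i + 1)^-M] is the moment of order [i] of [expR (- G)] for [G] of law Gamma(M). It
    is also what a Gaussian average leaves in dimension [2 M]; this match ties the two computations
    together. *)
Lemma coef_iter_havg (R : realType) (p : {poly R}) M i :
  (iter M havg p)`_i = p`_i / i.+1%:R ^+ M.
Proof.
elim: M => [|M IH]; first by rewrite expr0 divr1.
by rewrite iterS coef_havg IH exprSr invfM mulrA.
Qed.

Lemma size_iter_havg (R : realType) (p : {poly R}) M :
  (size (iter M havg p) <= size p)%N.
Proof.
elim: M => [|M IH] //; rewrite iterS.
exact: leq_trans (size_poly _ _) IH.
Qed.

Lemma deriv_mulX_havg (R : realType) (p : {poly R}) : ('X * havg p)^`() = p.
Proof.
apply/polyP => i; rewrite coef_deriv coefXM /= coef_havg.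
have n0 : i.+1%:R != 0 :> R by rewrite pnatr_eq0.
by rewrite -[RHS](divfK n0) mulr_natr.
Qed.

(** [v (havg p)(v)] is the primitive of [p] vanishing at 0; with [tau v] added it is nondecreasing,
    hence nonnegative. *)
Lemma havg_ge (R : realType) (p : {poly R}) (tau : R) :
  (forall v, 0 <= v <= 1 -> - tau <= p.[v]) ->
  forall v, 0 <= v <= 1 -> - tau <= (havg p).[v].
Proof.
move=> hp v /andP[v0 v1].
move: v0; rewrite le_eqVlt => /predU1P[<-|v0].
  rewrite horner_coef0 coef_havg divr1 -horner_coef0; apply: hp.
  by rewrite lexx ler01.
have := @is_derive_ge0_le R (horner ('X * havg p + tau *: 'X))
  (horner ('X * havg p + tau *: 'X)^`()) 0 v (ltW v0).
rewrite derivD deriv_mulX_havg derivZ derivX !hornerE => h.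
have : 0 <= v * (havg p).[v] + tau * v.
  apply: h.
    move=> x _; have := is_derive_poly ('X * havg p + tau *: 'X) x.
    by rewrite derivD deriv_mulX_havg derivZ derivX !hornerE.
  move=> x /andP[x0 xv]; rewrite !hornerE -lerBlDr sub0r.
  by apply: hp; rewrite x0 (le_trans xv).
by rewrite mulrC -mulrDl pmulr_lge0// -lerBlDr sub0r.
Qed.

(* The right-hand side is a lower bound for the probability that a Gamma(M)
   variable is at most [ln (v / v0)]. *)
Lemma iter_havg_ge (R : realType) (p : {poly R}) (tau v0 : R) M :
  0 < v0 ->
  (forall v, 0 <= v <= 1 -> - tau <= p.[v]) ->
  (forall v, v0 <= v <= 1 -> 1 - tau <= p.[v]) ->
  forall v, v0 <= v <= 1 ->
  v0 / v * (ln (v / v0) ^+ M / M`!%:R) - tau <= (iter M havg p).[v].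
Proof.
move=> v0p hp hp1; elim: M => [|M IH] v /andP[v0v v1].
  rewrite expr0 divr1 mulr1 /=; apply: le_trans (hp1 v _); last by rewrite v0v.
  by rewrite lerD2r ler_pdivrMr ?mul1r// (lt_le_trans v0p).
have vp : 0 < v by rewrite (lt_le_trans v0p).
have hpM : forall v, 0 <= v <= 1 -> - tau <= (iter M havg p).[v].
  by elim: M {IH} => [//|M IH] w hw; rewrite iterS; exact: havg_ge.
rewrite iterS; set q := iter M havg p in IH hpM *.
(* [F v] is [v] times the difference of the two sides. Its derivative [dF] is nonnegative by the
   induction hypothesis, and at [v0] the logarithm vanishes, which leaves [havg_ge]. *)
pose F w := ('X * havg q + tau *: 'X).[w] - v0 / M.+1`!%:R * ln (w * v0^-1) ^+ M.+1.
pose dF w := (q + tau%:P).[w] - v0 / w * (ln (w / v0) ^+ M / M`!%:R).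
have dlin (w : R) : is_derive w 1 (fun w : R => w * v0^-1) v0^-1.
  have := @is_deriveM _ _ (fun w : R => w) (fun=> v0^-1) w 1 _ _
    (is_derive_id w 1) (is_derive_cst v0^-1 w 1).
  by rewrite /= scaler0 add0r /GRing.scale/= mulr1.
have := @is_derive_ge0_le R F dF v0 v v0v.
have -> : F v0 = v0 * ((havg q).[v0] + tau).
  by rewrite /F divff ?gt_eqF// ln1 expr0n mulr0 subr0 !hornerE; ring.
move=> h.
have : 0 <= F v.
  apply: (@le_trans _ _ (v0 * ((havg q).[v0] + tau))).
    apply: mulr_ge0; first exact: ltW.
    rewrite -lerBlDr sub0r; apply: havg_ge => //.
    by rewrite ltW//= (le_trans v0v).
  apply: h; last first.
    move=> w /andP[w1 w2]; rewrite /dF hornerD hornerC subr_ge0 -lerBlDr.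
    by apply: IH; rewrite w1 (le_trans w2).
  move=> w /andP[w1 w2].
  have wp : 0 < w by rewrite (lt_le_trans v0p).
  have dl : is_derive w 1 (fun w => ln (w * v0^-1)) (w^-1).
    have := @is_derive1_comp R (@ln R) (fun w : R => w * v0^-1) w _ _
       (is_derive1_ln (divr_gt0 wp v0p)) (dlin w).
    have -> : (w * v0^-1)^-1 * v0^-1 = w^-1 by field; rewrite !gt_eqF.
    by [].
  have dP := is_derive_poly ('X * havg q + tau *: 'X) w.
  have dX := is_deriveZ (v0 / M.+1`!%:R) (is_deriveX M.+1 dl).
  have -> : F = horner ('X * havg q + tau *: 'X) -
      (v0 / M.+1`!%:R \*: ((fun w => ln (w * v0^-1)) ^+ M.+1)).
    by apply/funext => z; rewrite /F fctE/= exprfctE.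
  have dPX := is_deriveB dP dX.
  have -> : dF w = ('X * havg q + tau *: 'X)^`().[w] - (v0 / M.+1`!%:R) *:
      ((M.+1%:R * ln (w * v0^-1) ^+ M.+1.-1) *: w^-1); last exact: dPX.
  rewrite derivD deriv_mulX_havg derivZ derivX /dF !hornerE /=.
  congr (_ - _); rewrite /GRing.scale /= factS natrM.
  by field; rewrite !gt_eqF// ?ltr0n ?fact_gt0// nat1r.
move=> hF0; have {hF0}hF : 0 <= v * (havg q).[v] + tau * v -
    v0 / (M.+1%:R * M`!%:R) * ln (v / v0) ^+ M.+1.
  by move: hF0; rewrite /F !hornerE factS natrM.
rewrite factS natrM.
rewrite -(ler_pM2l vp).
have -> : v * (v0 / v * (ln (v / v0) ^+ M.+1 / (M.+1%:R * M`!%:R)) - tau)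
  = v0 / (M.+1%:R * M`!%:R) * ln (v / v0) ^+ M.+1 - tau * v.
  by field; rewrite !gt_eqF// ?ltr0n ?fact_gt0// nat1r.
rewrite lerBlDr -subr_ge0; apply: le_trans hF _.
by rewrite le_eqVlt; apply/orP; left; apply/eqP; ring.
Qed.

Lemma horner1_iter_havg (R : realType) (p : {poly R}) M :
  (iter M havg p).[1] = \sum_(i < size p) p`_i / i.+1%:R ^+ M.
Proof.
rewrite (horner_coef_wide _ (size_iter_havg p M)).
by apply: eq_bigr => i _; rewrite expr1n mulr1 coef_iter_havg.
Qed.

(* Expanding [expR (rho / (i + 1))] turns the left-hand side into a Poisson
   mixture of the positive functionals [fun p => (iter (m + l) havg p).[1]];
   only the term [l = j] is kept. *)
Lemma poisson_gamma_mixture_ge (R : realType) (p : {poly R}) (tau v0 rho : R) m j :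
  0 < v0 <= 1 -> 0 <= tau -> 0 <= rho ->
  (forall v, 0 <= v <= 1 -> - tau <= p.[v]) ->
  (forall v, v0 <= v <= 1 -> 1 - tau <= p.[v]) ->
  expR (- rho) * (rho ^+ j / j`!%:R) * (v0 * (ln v0^-1 ^+ (m + j) / (m + j)`!%:R)) - tau
  <= \sum_(i < size p) p`_i * (i.+1%:R^-1 ^+ m * expR (- (rho * (i%:R / i.+1%:R)))).
Proof.
move=> /andP[v00 v01] t0 r0 hp hp1.
set B := v0 * (ln v0^-1 ^+ (m + j) / (m + j)`!%:R).
have hpM M : - tau <= (iter M havg p).[1].
  suff : forall v, 0 <= v <= 1 -> - tau <= (iter M havg p).[v] by apply; rewrite ler01 lexx.
  by elim: M => [//|M IH] w hw; rewrite iterS; exact: havg_ge.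
have hj : B - tau <= (iter (m + j) havg p).[1].
  have := @iter_havg_ge R p tau v0 (m + j) v00 hp hp1 1.
  by rewrite lexx v01 divr1 div1r => /(_ isT).
pose S I := \sum_(0 <= l < I) rho ^+ l / l`!%:R * (iter (m + l) havg p).[1].
pose G := \sum_(i < size p) p`_i / i.+1%:R ^+ m * expR (rho / i.+1%:R).
have Slim : S n @[n --> \oo] --> G.
  have -> : S = (fun I => \sum_(i < size p) p`_i / i.+1%:R ^+ m *
                series (exp_coeff (rho / i.+1%:R)) I).
    apply/funext => I; rewrite /S /series /=.
    under eq_bigr do rewrite horner1_iter_havg mulr_sumr.
    rewrite exchange_big /=; apply: eq_bigr => i _.
    rewrite mulr_sumr; apply: eq_bigr => l _.
    rewrite /exp_coeff /= exprD expr_div_n invfM; ring.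
  apply: cvg_big => [|i _]; first exact: add_continuous.
  apply: cvgM; first exact: cvg_cst.
  exact: is_cvg_series_exp_coeff.
(* Each term loses at most [tau] times its weight, and the weights add up to at most [expR rho];
   after multiplication by [expR (- rho)] the total loss is [tau]. *)
have Sge I : (j < I)%N -> rho ^+ j / j`!%:R * B - tau * expR rho <= S I.
  move=> jI.
  have hexp : \sum_(0 <= l < I) rho ^+ l / l`!%:R <= expR rho.
    have := @nondecreasing_cvgn_le R (series (exp_coeff rho)).
    move=> /(_ _ (is_cvg_series_exp_coeff rho) I); apply.
    apply/nondecreasing_seqP => n; rewrite /series /= big_nat_recr //= lerDl.
    exact: exp_coeff_ge0.
  have : tau * \sum_(0 <= l < I) rho ^+ l / l`!%:R <= tau * expR rho by rewrite ler_wpM2l.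
  suff : rho ^+ j / j`!%:R * B - tau * \sum_(0 <= l < I) rho ^+ l / l`!%:R <= S I by lra.
  rewrite /S !big_mkord (bigD1 (Ordinal jI))//= [leRHS](bigD1 (Ordinal jI))//=.
  have c0 l : 0 <= rho ^+ l / l`!%:R by rewrite divr_ge0 ?exprn_ge0.
  have h1 := ler_wpM2l (c0 j) hj.
  have h2 : - tau * \sum_(i < I | i != Ordinal jI) rho ^+ i / i`!%:R <=
     \sum_(i < I | i != Ordinal jI) rho ^+ i / i`!%:R * (iter (m + i) havg p).[1].
    rewrite mulr_sumr; apply: ler_sum => i _.
    by rewrite mulrC; apply: ler_wpM2l.
  move: h1 h2; rewrite mulrBr.
  set X := rho ^+ j / j`!%:R; set Y := \sum_(i < I | _) _; set Z := \sum_(i < I | _) _.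
  set W := X * B; set W' := X * _; move=> h1 h2.
  rewrite mulrDr; lra.
have hG : rho ^+ j / j`!%:R * B - tau * expR rho <= G.
  apply: (cvgr_to_ge Slim); exists j.+1 => // I /= jI; exact: Sge.
have -> : \sum_(i < size p) p`_i * (i.+1%:R^-1 ^+ m * expR (- (rho * (i%:R / i.+1%:R)))) =
   expR (- rho) * G.
  rewrite /G mulr_sumr; apply: eq_bigr => i _.
  have -> : - (rho * (i%:R / i.+1%:R)) = - rho + rho / i.+1%:R.
    rewrite -natr1; field; by rewrite lt0r_neq0 ?ltr_wpDl ?ler0n.
  rewrite expRD exprVn; ring.
have := ler_wpM2l (expR_ge0 (- rho)) hG.
have e1 : expR (- rho) * expR rho = 1 by rewrite -expRD addNr expR0.
rewrite mulrBr => h.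
apply: le_trans h; rewrite le_eqVlt; apply/orP; left; apply/eqP.
have -> : expR (- rho) * (tau * expR rho) = tau by rewrite mulrCA e1 mulr1.
by ring.
Qed.

(** * Covering a Euclidean ball *)

(** In terms of [v = expR (- rho |x - y|^2)], a distance above [eta] means [v <= v1], where the
    proxy is nonpositive; elsewhere it is at most 1, so its sum over [X] is at most the count. [p0]
    is the Poisson(rho) mass at [j] times the Poisson(rho eta'^2) mass at [m + j]. The gap
    [eta' < eta] leaves room for the proxy to climb. *)
Lemma exists_center_poisson (R : realType) (rho eta' eta p0 : R) (m j : nat)
    (X : seq (nat -> R)) : 0 < rho -> 0 < eta' -> eta' < eta ->
  p0 = expR (- rho) * (rho ^+ j / j`!%:R) *
    (expR (- (rho * eta' ^+ 2)) * ((rho * eta' ^+ 2) ^+ (m + j) / (m + j)`!%:R)) ->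
  X != [::] -> (forall x : nat -> R, x \in X -> \sum_(i < 2 * m) x i ^+ 2 = 1) ->
  exists y : nat -> R, p0 / 2 * (size X)%:R <
    (count (fun x : nat -> R => \sum_(i < 2 * m) (x i - y i) ^+ 2 <= eta ^+ 2) X)%:R.
Proof.
move=> r0 e0 ee p0E X0 hX.
have e1 : 0 < eta by exact: lt_trans ee.
have u0 : 0 < rho * eta' ^+ 2 by rewrite mulr_gt0// exprn_gt0.
have p0p : 0 < p0.
  by rewrite p0E !(mulr_gt0, divr_gt0) ?expR_gt0 ?exprn_gt0 ?ltr0n ?fact_gt0.
set v0 := expR (- (rho * eta' ^+ 2)).
pose v1 := expR (- (rho * eta ^+ 2)).
have v10 : v1 < v0 by rewrite ltr_expR ltrN2 ltr_pM2l// ltr_pXn2r// nnegrE ltW.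
have v01 : v0 <= 1 by rewrite expR_le1 lerNl oppr0 ltW.
have p4 : 0 < p0 / 4 by rewrite divr_gt0.
(* A tolerance [p0 / 4] leaves a mean of at least [3 / 4 p0] per point, strictly above [p0 / 2]. *)
have [p hp] := @threshold_poly R v1 v0 (p0 / 4) (expR_gt0 _) v10 v01 p4.
have hp1 v : 0 <= v <= 1 -> - (p0 / 4) <= p.[v] by move=> /hp[].
have hp2 v : v0 <= v <= 1 -> 1 - p0 / 4 <= p.[v].
  by move=> /andP[h1 h2]; case: (hp v); rewrite ?h2 ?(le_trans _ h1) ?expR_ge0// => _ _ _; apply.
have hmix := @poisson_gamma_mixture_ge R p (p0 / 4) v0 rho m j.
have {}hmix : 3 / 4 * p0 <= \sum_(i < size p) p`_i *
    (i.+1%:R^-1 ^+ m * expR (- (rho * (i%:R / i.+1%:R)))).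
  have v0p : 0 < v0 <= 1 by rewrite expR_gt0.
  apply: le_trans (hmix v0p (ltW p4) (ltW r0) hp1 hp2).
  by rewrite -expRN opprK expRK -p0E; lra.
pose s := [seq (x, i) | x <- X, i <- iota 0 (size p)].
have Xs : 0 < (size X)%:R :> R by rewrite ltr0n lt0n size_eq0.
have [|y hy] := @gauss_average R _ s rho (p0 / 2 * (size X)%:R) (2 * m)
    (fun t => p`_t.2) snd fst r0.
  rewrite /s big_allpairs /=.
  apply: (@lt_le_trans _ _ (\sum_(x <- X) 3 / 4 * p0)).
    rewrite big_const_seq count_predT iter_addr_0 -[ltRHS]mulr_natr ltr_pM2r//; lra.
  rewrite big_seq [leRHS]big_seq; apply: ler_sum => x xX.
  apply: (le_trans hmix); rewrite -[X in iota 0 X]subn0 big_mkord.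
  apply: ler_sum => i _; rewrite hX//= mulr1.
  suff -> : (Num.sqrt i.+1%:R)^-1 ^+ (2 * m) = i.+1%:R^-1 ^+ m :> R by [].
  by rewrite exprM [_ ^+ 2]exprVn sqr_sqrtr ?ler0n.
exists y; apply: (lt_le_trans hy).
rewrite /s big_allpairs /= -sum1_count natr_sum [leRHS]big_mkcond /=.
apply: ler_sum => x _; set D := \sum_(i < 2 * m) (x i - y i) ^+ 2.
have D0 : 0 <= D by apply: sumr_ge0 => i _; exact: sqr_ge0.
have -> : \sum_(i <- iota 0 (size p)) p`_i * expR (- (i%:R * rho * D)) =
    p.[expR (- (rho * D))].
  rewrite -[X in iota 0 X]subn0 big_mkord horner_coef; apply: eq_bigr => i _.
  by rewrite -expRM_natl mulrN mulrA.
have vD : 0 <= expR (- (rho * D)) <= 1.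
  by rewrite expR_ge0 expR_le1 lerNl oppr0 mulr_ge0// ltW.
have [_ h1 h2 _] := hp _ vD.
case: ifP => // /negbT; rewrite -ltNge => De; apply: h2.
by rewrite ler_expR lerN2 ler_pM2l// ltW.
Qed.

(** Stirling up to a factor polynomial in [n]: the induction step is [e k^(k+1) <= (k+1)^(k+1)],
    which follows from [1 - 1/(k+1) <= expR (- 1/(k+1))]. *)
Lemma fact_expR_le (R : realType) (n : nat) : (0 < n)%N ->
  n`!%:R * expR n%:R <= expR 1 * n%:R * n%:R ^+ n :> R.
Proof.
elim: n => // -[|n] IH _; first by rewrite factS fact0 muln1 mul1r expr1 !mulr1.
have := IH isT; set k := n.+1 => {}IH.
have k0 : 0 < k%:R :> R by rewrite ltr0n.
have k1 : 0 < k.+1%:R :> R by rewrite ltr0n.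
have h : expR 1 * k%:R ^+ k.+1 <= k.+1%:R ^+ k.+1 :> R.
  have h1 : k%:R / k.+1%:R <= expR (- (k.+1%:R)^-1) :> R.
    apply: le_trans (expR_ge1Dx _); rewrite -natr1 le_eqVlt; apply/orP; left; apply/eqP.
    by field; rewrite lt0r_neq0// ltr_wpDl.
  have h2 : k%:R <= k.+1%:R * expR (- (k.+1%:R)^-1) :> R by rewrite mulrC -ler_pdivrMr.
  have := lerXn2r k.+1 (ltW k0) _ h2; rewrite nnegrE mulr_ge0 ?expR_ge0// => /(_ isT).
  rewrite exprMn -expRM_natl mulrN mulfV ?gt_eqF// expRN => h3.
  by rewrite mulrC -ler_pdivlMr ?expR_gt0.
rewrite factS natrM -nat1r expRD nat1r.
have h3 := ler_wpM2l (ltW (mulr_gt0 k1 (expR_gt0 1))) IH.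
have h4 := ler_wpM2l (ltW (mulr_gt0 k1 (expR_gt0 1))) h.
apply: (@le_trans _ _ (k.+1%:R * expR 1 * (k`!%:R * expR k%:R))).
  by rewrite le_eqVlt; apply/orP; left; apply/eqP; ring.
apply: (le_trans h3).
apply: (@le_trans _ _ (k.+1%:R * expR 1 * (expR 1 * k%:R ^+ k.+1))).
  by rewrite exprS le_eqVlt; apply/orP; left; apply/eqP; ring.
by apply: (le_trans h4); rewrite le_eqVlt; apply/orP; left; apply/eqP; ring.
Qed.

Lemma fact_expR_ge (R : realType) (n : nat) : n%:R ^+ n <= n`!%:R * expR n%:R :> R.
Proof.
case: n => [|n]; first by rewrite expr0 fact0 expR0 mulr1.
have := @expR_ge1Dxn R n.+1%:R n (ler0n _ _) => h.
have f0 : 0 < n.+1`!%:R :> R by rewrite ltr0n fact_gt0.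
by rewrite mulrC -ler_pdivrMr//; apply: le_trans h; rewrite lerDr.
Qed.

(** The [n + 1] masses add up to 1, so the largest is at least [1 / (n + 1)]; the ratios of
    consecutive masses show that it is attained at [j]. *)
Lemma binomial_mode_ge (R : realType) (q : R) (n j : nat) : 0 < q < 1 ->
  (j <= n)%N -> n.+1%:R * q - 1 <= j%:R <= n.+1%:R * q ->
  1 <= n.+1%:R * ('C(n, j)%:R * q ^+ j * (1 - q) ^+ (n - j)).
Proof.
move=> /andP[q0 q1] jn /andP[hj1 hj2].
pose b i : R := 'C(n, i)%:R * q ^+ i * (1 - q) ^+ (n - i).
have q1' : 0 < 1 - q by rewrite subr_gt0.
have b0 i : 0 <= b i by rewrite /b !mulr_ge0 ?exprn_ge0// ltW.
have step i : (i < n)%N -> b i.+1 * (i.+1%:R * (1 - q)) = b i * ((n - i)%:R * q).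
  move=> ilt; have := mul_bin_left n i => /(congr1 (fun k => k%:R : R)).
  rewrite !natrM => hb.
  rewrite /b (_ : (n - i = (n - i.+1).+1)%N); last by rewrite subnSK.
  rewrite !exprS; rewrite subnSK//.
  transitivity ((i.+1%:R * 'C(n, i.+1)%:R) * (q * q ^+ i * (1 - q) ^+ (n - i.+1) * (1 - q))).
    by ring.
  by rewrite hb; ring.
have up i : (i < j)%N -> b i <= b i.+1.
  move=> ij; have ilt := leq_trans ij jn.
  have c0 : 0 < i.+1%:R * (1 - q) by rewrite mulr_gt0.
  rewrite -(ler_pM2r c0) step//; apply: ler_wpM2l => //.
  have : i.+1%:R <= j%:R :> R by rewrite ler_nat.
  rewrite natrB 1?ltnW// -natr1; move: hj2; rewrite -natr1; lra.
have dn i : (j <= i)%N -> (i < n)%N -> b i.+1 <= b i.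
  move=> ij ilt.
  have c0 : 0 < i.+1%:R * (1 - q) by rewrite mulr_gt0.
  rewrite -(ler_pM2r c0) step//; apply: ler_wpM2l => //.
  have : j%:R <= i%:R :> R by rewrite ler_nat.
  rewrite natrB 1?ltnW// -natr1; move: hj1; rewrite -natr1; lra.
have bmax i : (i <= n)%N -> b i <= b j.
  move=> ilen; case: (leqP i j) => [ij|/ltnW ij].
    have : forall k, (k <= j)%N -> b (j - k)%N <= b j.
      elim=> [|k IH] kj; first by rewrite subn0.
      apply: le_trans (IH (ltnW kj)); rewrite -(subnSK kj).
      by apply: up; rewrite ltn_subrL (leq_trans _ kj).
    by move/(_ (j - i)%N (leq_subr _ _)); rewrite subKn.
  have : forall k, (j + k <= n)%N -> b (j + k)%N <= b j.
    elim=> [|k IH] kj; first by rewrite addn0.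
    rewrite addnS in kj *; apply: le_trans (IH (ltnW kj)).
    by apply: dn => //; exact: leq_addr.
  by move/(_ (i - j)%N); rewrite subnKC//; apply.
have sum1 : \sum_(i < n.+1) b i = 1.
  have := exprDn (1 - q) q n; rewrite subrK expr1n => ->.
  by apply: eq_bigr => i _; rewrite /b -mulr_natl; ring.
rewrite -[leLHS]sum1 -/(b j).
have -> : n.+1%:R * b j = \sum_(i < n.+1) b j by rewrite sumr_const card_ord mulr_natl.
by apply: ler_sum => i _; apply: bmax; rewrite -ltnS.
Qed.

(* With [q = eta'^2 / (1 + eta'^2)], [n = m + 2 j] and [rho = n / (1 + eta'^2)],
   the constant of [exists_center_poisson] is [eta'^(2 m)] times the product of
   the Binomial(n, q) mass at [j] and the Poisson(n) mass at [n]; both are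
   polynomially large when [j] is taken at the mode. *)
Lemma exists_center (R : realType) (eta' eta : R) (m : nat)
    (X : seq (nat -> R)) : (0 < m)%N -> 0 < eta' -> eta' <= m%:R / m.+1%:R ->
  eta' < eta -> X != [::] ->
  (forall x : nat -> R, x \in X -> \sum_(i < 2 * m) x i ^+ 2 = 1) ->
  exists y : nat -> R, eta' ^+ (2 * m) / (18 * expR 1 * m.+1%:R ^+ 4) * (size X)%:R <
    (count (fun x : nat -> R => \sum_(i < 2 * m) (x i - y i) ^+ 2 <= eta ^+ 2) X)%:R.
Proof.
move=> m0 e0 em ee X0 hX.
have mp : 0 < m.+1%:R :> R by rewrite ltr0n.
have em' : eta' <= 1 - m.+1%:R^-1.
  apply: le_trans em _; rewrite -natr1 le_eqVlt; apply/orP; left; apply/eqP.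
  by field; rewrite lt0r_neq0// ltr_wpDl.
set w := eta' ^+ 2.
have w0 : 0 < w by rewrite exprn_gt0.
have mi : 0 < m.+1%:R^-1 :> R by rewrite invr_gt0.
pose ti : R := m.+1%:R^-1; rewrite -/ti in em' mi.
have w1 : w <= 1 - ti.
  by rewrite /w expr2; apply: (le_trans _ em'); rewrite ger_pMr//; lra.
pose q := w / (1 + w).
have w1p : 0 < 1 + w by lra.
have q0 : 0 < q by rewrite divr_gt0.
have q12 : 1 - 2 * q = (1 - w) / (1 + w) by rewrite /q; field; rewrite gt_eqF.
have q12p : 0 < 1 - 2 * q by rewrite q12 divr_gt0//; lra.
(* As [n] depends on [j], the mode condition [(n + 1) q - 1 <= j <= (n + 1) q] is solved for [j]
   with [n + 1 = m + 1 + 2 j]. This needs [2 q < 1], that is [eta' < 1]. *)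
pose j := Num.truncn (m.+1%:R * q / (1 - 2 * q)).
have j1 : j%:R * (1 - 2 * q) <= m.+1%:R * q.
  by rewrite -ler_pdivlMr// truncn_le !(divr_ge0, mulr_ge0)// ltW.
have j2 : m.+1%:R * q < j.+1%:R * (1 - 2 * q) by rewrite -ltr_pdivrMr// truncnS_gt.
pose n := (m + 2 * j)%N.
have n0 : (0 < n)%N by rewrite addn_gt0 m0.
have np : 0 < n%:R :> R by rewrite ltr0n.
have nE : n.+1%:R = m.+1%:R + 2 * j%:R :> R by rewrite -natrM -natrD.
pose rho := n%:R / (1 + w).
have r0 : 0 < rho by rewrite divr_gt0.
have [y hy] := @exists_center_poisson R rho eta' eta _ m j X r0 e0 ee erefl X0 hX.
exists y; apply: le_lt_trans hy; apply: ler_wpM2r; first exact: ler0n.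
have hbin : 1 <= n.+1%:R * ('C(n, j)%:R * q ^+ j * (1 - q) ^+ (n - j)).
  apply: binomial_mode_ge; first by rewrite q0; lra.
    by rewrite /n mul2n -addnn addnA leq_addl.
  rewrite nE; move: j2; rewrite -natr1 => j2; lra.
have hpois : 1 <= expR 1 * n%:R * (n%:R ^+ n / n`!%:R / expR n%:R) :> R.
  have f0 : 0 < n`!%:R :> R by rewrite ltr0n fact_gt0.
  have -> : expR 1 * n%:R * (n%:R ^+ n / n`!%:R / expR n%:R) =
      expR 1 * n%:R * n%:R ^+ n / (n`!%:R * expR n%:R) :> R.
    by rewrite invfM; ring.
  by rewrite ler_pdivlMr ?mulr_gt0 ?expR_gt0// mul1r; exact: fact_expR_le.
have nj : (n - j = m + j)%N by rewrite /n mul2n -addnn addnA addnK.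
set B := 'C(n, j)%:R * q ^+ j * (1 - q) ^+ (n - j) in hbin.
set P := n%:R ^+ n / n`!%:R / expR n%:R in hpois.
(* Two independent Poisson variables of means [rho] and [rho w] have a sum of mean [n]; given that
   the sum is [n], the first is binomial with parameter [1 - q]. Replacing this parameter by [q],
   for which [j] is the mode, releases the factor [w^m = eta'^(2 m)]. *)
have -> : expR (- rho) * (rho ^+ j / j`!%:R) *
    (expR (- (rho * w)) * ((rho * w) ^+ (m + j) / (m + j)`!%:R)) =
    eta' ^+ (2 * m) * (B * P).
  have hf : n`!%:R = 'C(n, j)%:R * (j`!%:R * (m + j)`!%:R) :> R.
    by rewrite -!natrM -nj bin_fact// /n mul2n -addnn addnA leq_addl.
  have he : expR (- rho) * expR (- (rho * w)) = (expR n%:R)^-1.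
    by rewrite -expRD -expRN; congr expR; rewrite /rho; field; rewrite gt_eqF.
  have q1E : 1 - q = (1 + w)^-1 by rewrite /q; field; rewrite gt_eqF.
  have f1 : j`!%:R != 0 :> R by rewrite pnatr_eq0 -lt0n fact_gt0.
  have f2 : (m + j)`!%:R != 0 :> R by rewrite pnatr_eq0 -lt0n fact_gt0.
  have f3 : 'C(n, j)%:R != 0 :> R.
    by rewrite pnatr_eq0 -lt0n bin_gt0 /n mul2n -addnn addnA leq_addl.
  have f4 := gt_eqF (expR_gt0 (n%:R : R)).
  rewrite /B /P q1E nj exprM -/w hf /rho /q.
  transitivity ((expR (- rho) * expR (- (rho * w))) *
    ((n%:R / (1 + w)) ^+ j / j`!%:R * ((n%:R / (1 + w) * w) ^+ (m + j) / (m + j)`!%:R))).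
    by rewrite /rho; ring.
  rewrite he.
  have -> : n%:R ^+ n = n%:R ^+ j * n%:R ^+ (m + j) :> R.
    by rewrite -exprD /n mul2n -addnn addnCA.
  clearbody w; rewrite !exprMn !exprVn (exprD w).
  have g1 : (1 + w) ^+ j != 0 by rewrite expf_neq0// gt_eqF.
  have g2 : (1 + w) ^+ (m + j) != 0 by rewrite expf_neq0// gt_eqF.
  move: g1 g2 f4; set a1 := (1 + w) ^+ j; set a2 := (1 + w) ^+ (m + j).
  set a3 := n%:R ^+ j; set a4 := n%:R ^+ (m + j).
  set a5 := w ^+ m; set a6 := w ^+ j; set a7 := expR n%:R => g1 g2 f4.
  by field; rewrite f1 f2 f3 g1 g2 f4.
(* The hypothesis [eta' <= m / (m + 1)] keeps [1 - w] at least [1 / (m + 1)], so that [j], hence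
   [n], is polynomial in [m]. *)
have hj : j%:R <= m.+1%:R ^+ 2 :> R.
  have h : j%:R * (1 - w) <= m.+1%:R * w.
    move: j1; rewrite q12 /q.
    have -> : j%:R * ((1 - w) / (1 + w)) = (j%:R * (1 - w)) / (1 + w) by ring.
    have -> : m.+1%:R * (w / (1 + w)) = (m.+1%:R * w) / (1 + w) by ring.
    by rewrite ler_pM2r// invr_gt0.
  have h2 : j%:R * ti <= m.+1%:R :> R.
    apply: (@le_trans _ _ (j%:R * (1 - w))).
      by apply: ler_wpM2l; rewrite ?ler0n//; lra.
    apply: (le_trans h); rewrite ger_pMr//; lra.
  by move: h2; rewrite /ti ler_pdivrMr// expr2.
have m1 : 1 <= m.+1%:R :> R by rewrite ler1n.
have hn1 : n.+1%:R <= 3 * m.+1%:R ^+ 2 :> R.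
  have : m.+1%:R <= m.+1%:R ^+ 2 :> R by rewrite expr2 ler_peMr.
  by rewrite nE; lra.
have hnn : n%:R * n.+1%:R <= 9 * m.+1%:R ^+ 4 :> R.
  have : n%:R <= n.+1%:R :> R by rewrite ler_nat.
  have -> : 9 * m.+1%:R ^+ 4 = (3 * m.+1%:R ^+ 2) * (3 * m.+1%:R ^+ 2) :> R by ring.
  move=> h; apply: ler_pM => //; exact: le_trans hn1.
have B0 : 0 < B by rewrite -(pmulr_rgt0 _ (ltr0Sn R n)); exact: lt_le_trans hbin.
have P0 : 0 < P.
  rewrite -(pmulr_rgt0 _ (mulr_gt0 (expR_gt0 1) np)); exact: lt_le_trans hpois.
have hBP : 1 <= (9 * expR 1 * m.+1%:R ^+ 4) * (B * P).
  apply: (@le_trans _ _ ((n.+1%:R * B) * (expR 1 * n%:R * P))).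
    by rewrite -[leLHS]mulr1; apply: ler_pM.
  have -> : n.+1%:R * B * (expR 1 * n%:R * P) = (n%:R * n.+1%:R) * (expR 1 * B * P) by ring.
  have -> : 9 * expR 1 * m.+1%:R ^+ 4 * (B * P) = (9 * m.+1%:R ^+ 4) * (expR 1 * B * P) by ring.
  by apply: ler_wpM2r => //; exact: mulr_ge0 (mulr_ge0 (expR_ge0 1) (ltW B0)) (ltW P0).
rewrite -[leRHS]mulrA; apply: ler_wpM2l; first by rewrite exprn_ge0// ltW.
have D0 : 0 < 9 * expR 1 * m.+1%:R ^+ 4 :> R by rewrite !mulr_gt0 ?expR_gt0 ?exprn_gt0.
have -> : 18 * expR 1 * m.+1%:R ^+ 4 = (9 * expR 1 * m.+1%:R ^+ 4) * 2 :> R by ring.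
by rewrite invfM ler_pM2r ?invr_gt0// -div1r ler_pdivrMr// mulrC.
Qed.

(** Each center removes more than a fraction [p] of the points still uncovered, so the logarithm of
    their number drops by at least [p]; the summand 1 pays for the last center. *)
Lemma greedy_cover (R : realType) (T : eqType) (U : Type) (near : U -> pred T)
    (p : R) (X : seq T) : 0 < p ->
  (forall X' : seq T, {subset X' <= X} -> X' != [::] ->
     exists y, p * (size X')%:R < (count (near y) X')%:R) ->
  X != [::] ->
  exists ys : seq U, (size ys)%:R <= 1 + ln (size X)%:R / p /\
    forall x, x \in X -> has (near^~ x) ys.
Proof.
move=> p0; have [n] := ubnP (size X); elim: n X => // n IH X sX hX X0.
have [y hy] := hX X (fun _ => id) X0.
pose X' := [seq x <- X | ~~ near y x].
have sX0 : 0 < (size X)%:R :> R by rewrite ltr0n lt0n size_eq0.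
have cX' : (size X = count (near y) X + size X')%N.
  by rewrite size_filter -(count_predC (near y)).
have hX' : (size X')%:R < (1 - p) * (size X)%:R.
  by move: hy; rewrite {2}cX' !natrD cX' natrD; lra.
have s' : (size X' < n)%N.
  rewrite -(ltr_nat R); apply: (lt_le_trans hX').
  have : (size X)%:R <= n%:R :> R by rewrite ler_nat.
  have := mulr_gt0 p0 sX0; lra.
have [X'0|X'0] := eqVneq X' [::].
  exists [:: y]; split.
    by rewrite lerDl divr_ge0 ?(ltW p0)// ln_ge0// ler1n -(ltr_nat R).
  move=> x xX /=; rewrite orbF; apply/negPn/negP => nx.
  by have : x \in X' by [rewrite mem_filter nx]; rewrite X'0.
have [X'' sub X''0|ys [sys hys]] := IH X' s' _ X'0.
  by apply: hX => // x /sub; rewrite mem_filter => /andP[].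
exists (y :: ys); split; last first.
  move=> x xX /=; have [//|nx] := boolP (near y x).
  by apply: hys; rewrite mem_filter nx.
have sX'0 : 0 < (size X')%:R :> R by rewrite ltr0n lt0n size_eq0.
have p1 : p < 1.
  by rewrite -subr_gt0 -(pmulr_lgt0 _ sX0); exact: lt_trans hX'.
rewrite /= -nat1r lerD2l; apply: (le_trans sys).
have : ln (size X')%:R <= ln (size X)%:R - p.
  apply: (@le_trans _ _ (ln ((1 - p) * (size X)%:R))).
    by rewrite ler_ln ?posrE// ?ltW// mulr_gt0// subr_gt0.
  rewrite lnM ?posrE ?subr_gt0// addrC lerD2l.
  by apply: le_ln1Dx; rewrite ltrN2.
move=> h; have : ln (size X')%:R / p <= (ln (size X)%:R - p) / p by rewrite ler_pM2r ?invr_gt0.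
by rewrite mulrBl divff ?gt_eqF//; lra.
Qed.

(** One representative is kept per occupied cell of side [h], instead of a grid point, so that the
    net consists of unit vectors, as [exists_center] requires. *)
Lemma sphere_net (R : realType) (k : nat) (h : R) : 0 < h ->
  exists X : seq (nat -> R),
  [/\ (size X <= (Num.truncn (2 / h)).+1 ^ k)%N,
      forall x : nat -> R, x \in X -> \sum_(i < k) x i ^+ 2 = 1 &
      forall x : nat -> R, \sum_(i < k) x i ^+ 2 = 1 ->
        exists2 z, z \in X & forall i, (i < k)%N -> `|x i - z i| <= h].
Proof.
move=> h0; set B := Num.truncn (2 / h).
pose cell (x : nat -> R) : {ffun 'I_k -> 'I_B.+1} :=
  [ffun i : 'I_k => inord (Num.truncn ((x i + 1) / h))].
pose P (x : nat -> R) := \sum_(i < k) x i ^+ 2 = 1.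
pose rep c := if pselect (exists x, P x /\ cell x = c) is left e
  then Some (projT1 (cid e)) else None.
exists (pmap rep (enum {ffun 'I_k -> 'I_B.+1})); split.
- rewrite size_pmap (leq_trans (count_size _ _))//.
  by rewrite -cardE card_ffun !card_ord.
- move=> x; rewrite mem_pmap => /mapP[c _]; rewrite /rep.
  by case: pselect => // e [->]; case: (projT2 (cid e)).
move=> x Px.
have : exists x', P x' /\ cell x' = cell x by exists x.
move=> ex; have [z hz] : exists z, rep (cell x) = Some z.
  by rewrite /rep; case: pselect => // e; eexists.
exists z.
  by rewrite mem_pmap; apply/mapP; exists (cell x); rewrite ?mem_enum.
have [Pz cz] : P z /\ cell z = cell x.
  by move: hz; rewrite /rep; case: pselect => // e [<-]; exact: (projT2 (cid e)).
have bnd (w : nat -> R) i : P w -> (i < k)%N -> `|w i| <= 1.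
  move=> Pw ik; rewrite -(ler_pXn2r (ltn0Sn 1)) ?nnegrE// expr1n real_normK ?num_real//.
  rewrite -Pw (bigD1 (Ordinal ik))//= lerDl.
  by apply: sumr_ge0 => j _; exact: sqr_ge0.
move=> i ik; move/ffunP: cz => /(_ (Ordinal ik)); rewrite !ffunE /= => /(congr1 val) /=.
have pos (w : nat -> R) : P w -> 0 <= (w i + 1) / h.
  move=> Pw; rewrite divr_ge0 ?(ltW h0)//.
  by have := bnd w i Pw ik; rewrite ler_norml => /andP[]; lra.
have lt (w : nat -> R) : P w -> (Num.truncn ((w i + 1) / h) < B.+1)%N.
  move=> Pw; rewrite ltnS; apply: le_truncn; rewrite ler_pM2r ?invr_gt0//.
  by have := bnd w i Pw ik; rewrite ler_norml => /andP[]; lra.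
rewrite !inordK ?lt// => tE.
have := truncn_itv (pos z Pz); have := truncn_itv (pos x Px).
rewrite tE; set t := Num.truncn _; rewrite -natr1 => /andP[a1 a2] /andP[b1 b2].
move: a1 a2 b1 b2; rewrite !ler_pdivlMr// !ltr_pdivrMr// => a1 a2 b1 b2.
rewrite ler_norml; apply/andP; split; lra.
Qed.

(** Minkowski's inequality through [(u + v)^2 <= (1 + b / a) u^2 + (1 + a / b) v^2], whose weights
    make the final bound exactly [(a + b)^2]. *)
Lemma sum_sqr_trans (R : realType) (k : nat) (x y z : nat -> R) (a b : R) :
  0 < a -> 0 < b ->
  \sum_(i < k) (x i - z i) ^+ 2 <= a ^+ 2 ->
  \sum_(i < k) (z i - y i) ^+ 2 <= b ^+ 2 ->
  \sum_(i < k) (x i - y i) ^+ 2 <= (a + b) ^+ 2.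
Proof.
move=> a0 b0 ha hb.
apply: (@le_trans _ _ ((1 + b / a) * \sum_(i < k) (x i - z i) ^+ 2 +
                       (1 + a / b) * \sum_(i < k) (z i - y i) ^+ 2)).
  rewrite !mulr_sumr -big_split /=; apply: ler_sum => i _.
  set u := x i - z i; set v := z i - y i.
  have -> : x i - y i = u + v by rewrite /u /v; ring.
  rewrite -subr_ge0.
  have -> : (1 + b / a) * u ^+ 2 + (1 + a / b) * v ^+ 2 - (u + v) ^+ 2 =
    (b * u - a * v) ^+ 2 / (a * b) by field; rewrite !gt_eqF.
  by rewrite divr_ge0 ?sqr_ge0// mulr_ge0// ltW.
have -> : (a + b) ^+ 2 = (1 + b / a) * a ^+ 2 + (1 + a / b) * b ^+ 2.
  by field; rewrite !gt_eqF.
have p1 : 0 <= 1 + b / a by rewrite addr_ge0// divr_ge0// ltW.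
have p2 : 0 <= 1 + a / b by rewrite addr_ge0// divr_ge0// ltW.
by apply: lerD; apply: ler_wpM2l.
Qed.

(** A net at distance [dl] is covered at radius [e2 = r - dl], using [exists_center] with
    [e1 = r - 2 dl]. As [e1 = r m / (m + 1)], its power [2 m] loses only a factor [expR 2], whence
    [expR 3]. The additional power of [r] absorbs the [1 / r] in the logarithm of the size of the
    net, and 289 is 1 + 16 x 18. *)
Lemma sphere_cover (R : realType) (m : nat) (r : R) : (0 < m)%N -> 0 < r <= 1 ->
  exists ys : seq (nat -> R),
    (size ys)%:R * r ^+ (2 * m).+1 <= 289 * expR 3 * m.+1%:R ^+ 7 /\
    forall x : nat -> R, \sum_(i < 2 * m) x i ^+ 2 = 1 ->
      has (fun y : nat -> R => \sum_(i < 2 * m) (x i - y i) ^+ 2 <= r ^+ 2) ys.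
Proof.
move=> m0 /andP[r0 r1].
have mp : 0 < m%:R :> R by rewrite ltr0n.
have m1p : 0 < m.+1%:R :> R by rewrite ltr0n.
pose e1 := r * (m%:R / m.+1%:R).
pose dl := r / (2 * m.+1%:R).
pose e2 := r - dl.
have e1p : 0 < e1 by rewrite mulr_gt0// divr_gt0.
have dlp : 0 < dl by rewrite divr_gt0// mulr_gt0.
have e1E : e1 = r - 2 * dl.
  rewrite /e1 /dl -natr1; field.
  by rewrite lt0r_neq0// ltr_wpDl// ler0n.
have e12 : e1 < e2 by rewrite e1E /e2; lra.
have e2p : 0 < e2 by exact: lt_trans e12.
pose h := dl / (2 * m%:R).
have hp : 0 < h by rewrite divr_gt0// mulr_gt0.
have [X [sX X1 Xnet]] := @sphere_net R (2 * m) h hp.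
pose p := e1 ^+ (2 * m) / (18 * expR 1 * m.+1%:R ^+ 4).
have C0 : 0 < 18 * expR 1 * m.+1%:R ^+ 4 :> R by rewrite !mulr_gt0 ?expR_gt0 ?exprn_gt0.
have pp : 0 < p by rewrite divr_gt0// exprn_gt0.
have Xne : X != [::].
  have [|z zX _] := Xnet (fun i => (i == 0)%:R).
    rewrite -(prednK m0) mulnS big_ord_recl /= expr1n big1 ?addr0// => i _.
    by rewrite expr0n.
  by apply/eqP => X0; rewrite X0 in zX.
have [|ys [sys hys]] := @greedy_cover R _ (nat -> R)
  (fun (y x : nat -> R) => \sum_(i < 2 * m) (x i - y i) ^+ 2 <= e2 ^+ 2) p X pp _ Xne.
  move=> X' sub X'0; apply: exists_center => //.
    by rewrite /e1 ger_pMl// divr_gt0.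
  by move=> x /sub; exact: X1.
exists ys; split; last first.
  move=> x x1; have [z zX hz] := Xnet x x1.
  have /hasP[y yys hy] := hys z zX; apply/hasP; exists y => //.
  have -> : r = dl + e2 by rewrite /e2; ring.
  apply: sum_sqr_trans hy => //.
  apply: (@le_trans _ _ (\sum_(i < 2 * m) h ^+ 2)).
    apply: ler_sum => i _.
    by rewrite -real_normK ?num_real// lerXn2r ?nnegrE ?(ltW hp)// hz.
  rewrite sumr_const card_ord -mulr_natl natrM.
  have -> : 2 * m%:R * h ^+ 2 = dl ^+ 2 / (2 * m%:R).
    by rewrite /h; field; rewrite gt_eqF.
  rewrite ler_pdivrMr ?mulr_gt0// ler_peMr ?sqr_ge0//.
  have : 1 <= m%:R :> R by rewrite ler1n.
  by lra.
have lnX : ln (size X)%:R <= 16 * m.+1%:R ^+ 3 / r.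
  pose B := Num.truncn (2 / h).
  have sX0 : 0 < (size X)%:R :> R by rewrite ltr0n lt0n size_eq0.
  have B0 : 0 < B.+1%:R :> R by rewrite ltr0n.
  apply: (@le_trans _ _ (ln (B.+1%:R ^+ (2 * m)))).
    by rewrite ler_ln ?posrE ?exprn_gt0// -natrX ler_nat.
  rewrite lnXn// -[ln _ *+ _]mulr_natl.
  have lnB : ln B.+1%:R <= 2 / h.
    rewrite -nat1r; apply: (@le_trans _ _ B%:R).
      by apply: le_ln1Dx; rewrite (lt_le_trans (ltrN10 _)).
    by rewrite truncn_le divr_ge0// ltW.
  apply: (@le_trans _ _ ((2 * m)%:R * (2 / h))); first exact: ler_wpM2l.
  have -> : (2 * m)%:R * (2 / h) = 16 * (m%:R ^+ 2 * m.+1%:R) / r.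
    by rewrite natrM /h /dl; field; rewrite !gt_eqF.
  rewrite ler_pM2r ?invr_gt0// ler_pM2l// [leRHS]exprSr ler_pM2r// lerXn2r ?nnegrE ?ltW//.
  by rewrite ltr_nat.
have pE : p^-1 * r ^+ (2 * m) <= 18 * expR 3 * m.+1%:R ^+ 4.
  have q2 : expR (-2) <= (m%:R / m.+1%:R) ^+ (2 * m) :> R.
    have h1 : m.+1%:R / m%:R <= expR (m%:R^-1) :> R.
      apply: le_trans (expR_ge1Dx _); rewrite -natr1 mulrDl divff ?gt_eqF//.
      by rewrite mul1r.
    have h2 : (m.+1%:R / m%:R) ^+ (2 * m) <= expR 2 :> R.
      apply: (@le_trans _ _ (expR (m%:R^-1) ^+ (2 * m))).
        by rewrite lerXn2r ?nnegrE ?expR_ge0// divr_ge0// ltW.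
      by rewrite -expRM_natl natrM -mulrA mulfV ?gt_eqF// mulr1.
    rewrite expRN -[leRHS]invrK -exprVn invf_div lef_pV2 ?posrE ?expR_gt0//.
    by rewrite exprn_gt0// divr_gt0.
  set Q := (m%:R / m.+1%:R) ^+ (2 * m) in q2 *.
  have Q0 : 0 < Q by rewrite exprn_gt0// divr_gt0.
  have rm : 0 < r ^+ (2 * m) by rewrite exprn_gt0.
  have -> : p^-1 * r ^+ (2 * m) = 18 * expR 1 * m.+1%:R ^+ 4 / Q.
    rewrite /p /e1 exprMn -/Q; set c := 18 * expR 1 * m.+1%:R ^+ 4 in C0 *.
    by field; rewrite !gt_eqF.
  rewrite ler_pdivrMr//.
  apply: (@le_trans _ _ (18 * expR 3 * m.+1%:R ^+ 4 * expR (-2))).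
    have -> : 18 * expR 3 * m.+1%:R ^+ 4 * expR (-2) = 18 * (expR 3 * expR (-2)) * m.+1%:R ^+ 4 :> R by ring.
    rewrite -expRD; have -> : 3 + -2 = 1 :> R by ring.
    by [].
  by rewrite ler_pM2l// !mulr_gt0 ?expR_gt0 ?exprn_gt0.
have rk : 0 < r ^+ (2 * m).+1 by rewrite exprn_gt0.
apply: (le_trans (ler_wpM2r (ltW rk) sys)).
rewrite mulrDl mul1r.
have m1 : 1 <= m.+1%:R :> R by rewrite ler1n.
have e3 : 1 <= expR 3 :> R by rewrite -[leLHS]expR0 ler_expR.
have t1 : r ^+ (2 * m).+1 <= expR 3 * m.+1%:R ^+ 7.
  apply: (@le_trans _ _ 1); first by rewrite exprn_ile1// ltW.
  by rewrite -[leLHS]mulr1; apply: ler_pM => //; exact: exprn_ege1.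
have t2 : ln (size X)%:R / p * r ^+ (2 * m).+1 <= 288 * expR 3 * m.+1%:R ^+ 7.
  apply: (@le_trans _ _ (16 * m.+1%:R ^+ 3 / r / p * r ^+ (2 * m).+1)).
    by rewrite ler_pM2r// ler_pM2r ?invr_gt0.
  have -> : 16 * m.+1%:R ^+ 3 / r / p * r ^+ (2 * m).+1 =
     16 * m.+1%:R ^+ 3 * (p^-1 * r ^+ (2 * m)).
    by rewrite [r ^+ _.+1]exprS; field; rewrite !gt_eqF.
  have -> : 288 * expR 3 * m.+1%:R ^+ 7 =
     16 * m.+1%:R ^+ 3 * (18 * expR 3 * m.+1%:R ^+ 4) :> R by ring.
  by rewrite ler_pM2l// mulr_gt0// exprn_gt0.
by lra.
Qed.

(* A ball of dimension [2 m - 1] is the projection of the sphere of dimension [2 m - 1]. *)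
Lemma ball_cover (R : realType) (m k : nat) (r : R) : (2 * m = k.+1)%N -> 0 < r <= 1 ->
  exists ys : seq (nat -> R),
    (size ys)%:R * r ^+ k.+2 <= 289 * expR 3 * m.+1%:R ^+ 7 /\
    forall x : nat -> R, \sum_(i < k) x i ^+ 2 <= 1 ->
      has (fun y : nat -> R => \sum_(i < k) (x i - y i) ^+ 2 <= r ^+ 2) ys.
Proof.
move=> mk r01; have m0 : (0 < m)%N by case: m mk.
have [ys [sys hys]] := sphere_cover m0 r01.
rewrite mk in sys hys; exists ys; split=> // x x1.
pose x' i := if i == k then Num.sqrt (1 - \sum_(i < k) x i ^+ 2) else x i.
have x'E (i : 'I_k) : x' i = x i by rewrite /x' ltn_eqF.
have := hys x'; rewrite big_ord_recr /=.
under eq_bigr do rewrite x'E.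
rewrite /x' eqxx sqr_sqrtr ?subr_ge0// subrKC => /(_ erefl)/hasP[y yys hy].
apply/hasP; exists y => //; apply: le_trans hy.
rewrite big_ord_recr /= eqxx; under [in leRHS]eq_bigr => i _ do rewrite (ltn_eqF (ltn_ord i)).
by rewrite lerDl sqr_ge0.
Qed.

(** * Covers of the image of the unit ball of a Hilbert space *)

Definition orthonormal_seq (R : realType) (V : normedModType R)
  (ip : V -> V -> R) (f : nat -> V) := forall i j, ip (f i) (f j) = (i == j)%:R.

Lemma ip_addl (R : realType) (V : normedModType R) (ip : V -> V -> R) :
  is_inner_product ip -> forall x y z, ip (x + y) z = ip x z + ip y z.
Proof. by move=> [_ h _] x y z; rewrite -[x in LHS]scale1r h mul1r. Qed.

Lemma ip_0l (R : realType) (V : normedModType R) (ip : V -> V -> R) :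
  is_inner_product ip -> forall z, ip 0 z = 0.
Proof.
by move=> hip z; have := ip_addl hip 0 0 z; rewrite addr0 => /eqP; rewrite -subr_eq0 opprD addrA subrr sub0r oppr_eq0 => /eqP.
Qed.

Lemma ip_scalel (R : realType) (V : normedModType R) (ip : V -> V -> R) :
  is_inner_product ip -> forall a x z, ip (a *: x) z = a * ip x z.
Proof.
by move=> hip a x z; case: (hip) => _ h _; rewrite -[a *: x]addr0 h ip_0l// addr0.
Qed.

Lemma ip_suml (R : realType) (V : normedModType R) (ip : V -> V -> R) :
  is_inner_product ip -> forall n (x : nat -> V) z,
  ip (\sum_(i < n) x i) z = \sum_(i < n) ip (x i) z.
Proof.
move=> hip n x z; elim: n => [|n IH]; first by rewrite !big_ord0 ip_0l.
by rewrite !big_ord_recr /= ip_addl// IH.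
Qed.

Lemma ip_sum_orthonormal (R : realType) (V : normedModType R) (ip : V -> V -> R) (f : nat -> V) :
  is_inner_product ip -> orthonormal_seq ip f -> forall n (a : nat -> R) (j : nat),
  ip (\sum_(i < n) a i *: f i) (f j) = if (j < n)%N then a j else 0.
Proof.
move=> hip hf n a j; rewrite (ip_suml hip n (fun i => a i *: f i)).
under eq_bigr do rewrite ip_scalel// hf.
case: ltnP => jn.
  rewrite (bigD1 (Ordinal jn))//= eqxx mulr1 big1 ?addr0// => i /eqP ij.
  by case: eqP => [ji|_]; [case: ij; exact: val_inj|rewrite mulr0].
rewrite big1// => i _; case: eqP => [ij|_]; last by rewrite mulr0.
by move: (ltn_ord i); rewrite ij ltnNge jn.
Qed.

Lemma normD_ip (R : realType) (V : normedModType R) (ip : V -> V -> R) :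
  is_inner_product ip -> forall x y, `|x + y| ^+ 2 = `|x| ^+ 2 + 2 * ip x y + `|y| ^+ 2.
Proof.
move=> hip x y; case: (hip) => hs _ hn.
rewrite -(hn (x + y)) -(hn x) -(hn y) (ip_addl hip) (hs x (x + y)) (hs y (x + y)).
rewrite !(ip_addl hip) (hs y x); ring.
Qed.

Lemma norm_sum_orthonormal (R : realType) (V : normedModType R) (ip : V -> V -> R) (f : nat -> V) :
  is_inner_product ip -> orthonormal_seq ip f -> forall n (a : nat -> R),
  `|\sum_(i < n) a i *: f i| ^+ 2 = \sum_(i < n) a i ^+ 2.
Proof.
move=> hip hf n a; elim: n => [|n IH]; first by rewrite !big_ord0 normr0 expr0n.
rewrite !big_ord_recr /= (normD_ip hip) IH; case: (hip) => hs _ hn.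
rewrite hs ip_scalel// hs ip_sum_orthonormal// ltnn !mulr0 addr0; congr (_ + _).
by rewrite -hn ip_scalel// hs ip_scalel// hf eqxx mulr1 expr2.
Qed.

Lemma bessel_eq (R : realType) (V : normedModType R) (ip : V -> V -> R) (f : nat -> V) :
  is_inner_product ip -> orthonormal_seq ip f -> forall n u,
  `|u| ^+ 2 = \sum_(i < n) ip u (f i) ^+ 2 + `|u - \sum_(i < n) ip u (f i) *: f i| ^+ 2.
Proof.
move=> hip hf n u; set s := \sum_(i < n) ip u (f i) *: f i.
rewrite -{1}(subrK s u) (normD_ip hip (u - s) s) -(norm_sum_orthonormal hip hf n (fun i => ip u (f i))) -/s.
have -> : ip (u - s) s = 0.
  case: (hip) => hs _ hn.
  rewrite hs (ip_suml hip n (fun i => ip u (f i) *: f i)).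
  rewrite big1// => i _; rewrite (ip_scalel hip) (hs (f i) (u - s)) (ip_addl hip) -scaleN1r (ip_scalel hip).
  by rewrite (ip_sum_orthonormal hip hf n (fun i => ip u (f i))) ltn_ord mulN1r subrr mulr0.
by rewrite mulr0 addr0 addrC.
Qed.

Lemma iter_linear (R : realType) (V : normedModType R) (T : {linear V -> V}) p a x y :
  iter p T (a *: x + y) = a *: iter p T x + iter p T y.
Proof. by elim: p => //= p ->; rewrite linearP. Qed.

(** If [y] is within [eps] of [T u], then [T u = y + eps b] with [b] in the unit ball, so
    [T^(p+1) u = T^p y + eps T^p b]; covering [T^p b] within [eps^p] leaves an error [eps^(p+1)]. *)
Lemma covers_iter (R : realType) (V : normedModType R) (T : {linear V -> V}) (eps : R) (s : seq V) :
  0 < eps -> covers eps (T @` unit_cball (V:=V)) s ->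
  forall p, exists2 sp : seq V, size sp = (size s ^ p)%N &
    covers (eps ^+ p) (iter p T @` unit_cball (V:=V)) sp.
Proof.
move=> e0 hs; elim=> [|p [sp szp hsp]].
  exists [:: 0] => // _ [u u1 <-]; exists 0; first by rewrite inE.
  by rewrite subr0 expr0.
exists [seq iter p T y + eps *: z | y <- s, z <- sp].
  by rewrite size_allpairs szp expnS.
move=> _ [u u1 <-]; have [y ys hy] : exists2 y, y \in s & `|T u - y| <= eps.
  by apply: hs; exists u.
pose b := eps^-1 *: (T u - y).
have [z zs hz] : exists2 z, z \in sp & `|iter p T b - z| <= eps ^+ p.
  apply: hsp; exists b => //; rewrite /unit_cball /= /b normrZ gtr0_norm ?invr_gt0//.
  by rewrite mulrC ler_pdivrMr// mul1r.
exists (iter p T y + eps *: z); first by apply/allpairsP; exists (y, z).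
rewrite iterSr.
have -> : T u = eps *: b + y by rewrite /b scalerA mulfV ?gt_eqF// scale1r subrK.
rewrite iter_linear [eps *: _ + _]addrC opprD addrACA subrr add0r -scalerBr.
by rewrite normrZ gtr0_norm// exprS ler_pM2l.
Qed.

Lemma ler_of_exp_bound (R : realType) (A N C : R) : 0 < A -> 0 < N ->
  (forall p, A ^+ p <= C * N ^+ p) -> A <= N.
Proof.
move=> A0 N0 h; rewrite leNgt; apply/negP => NA.
have t0 : 0 < A / N - 1 by rewrite subr_gt0 ltr_pdivlMr// mul1r.
pose p := (Num.truncn (C / (A / N - 1))).+1.
have := h p; rewrite -ler_pdivrMr ?exprn_gt0// -expr_div_n.
apply/negP; rewrite -ltNge.
have := @bernoulli_ineq R (A / N - 1) p; rewrite subrKC => hb.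
apply: lt_le_trans (hb _); last by apply: le_trans (ltW t0); rewrite lerN10.
apply: (@lt_trans _ _ (p%:R * (A / N - 1))); last by rewrite ltrDr.
by rewrite -ltr_pdivrMr// truncnS_gt.
Qed.

(* A grid of mesh [3 eps^p] in [T^p (ball)] meets every ball of radius [eps^p]
   at most once; letting [p] tend to infinity removes the dimensional constant. *)
Lemma covers_size_ge (R : realType) (V : normedModType R) (ip : V -> V -> R)
    (T : {linear V -> V}) (f : nat -> V) (l : nat -> R) (eps : R) (s : seq V) (d : nat) :
  is_inner_product ip -> orthonormal_seq ip f ->
  (forall i, T (f i) = l i *: f i) -> (forall i, 0 < l i) ->
  0 < eps -> covers eps (T @` unit_cball (V:=V)) s ->
  \prod_(i < d) (l i / eps) <= (size s)%:R.
Proof.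
move=> hip hf hT l0 e0 hs.
have s0 : 0 < (size s)%:R :> R.
  have [|y ys _] := hs (T 0); last by rewrite ltr0n; case: s ys {hs}.
  by exists 0 => //; rewrite /unit_cball /= normr0.
case: d => [|d']; first by rewrite big_ord0 ler1n -(ltr_nat R).
set d := d'.+1.
have d0 : 0 < d%:R :> R by rewrite ltr0n.
have P0 : 0 < \prod_(i < d) (l i / eps).
  by apply: prodr_gt0 => i _; rewrite divr_gt0.
(* The factor 3 is the mesh in units of [eps^p], the factor [d] the shrinking that fits the grid
   into the ball; neither depends on [p]. *)
apply: (@ler_of_exp_bound R _ _ ((3 * d%:R) ^+ d)) => // p.
have [sp szp hsp] := covers_iter e0 hs p.
have ep : 0 < eps ^+ p by rewrite exprn_gt0.
pose g := 3 * eps ^+ p.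
have g0 : 0 < g by rewrite mulr_gt0.
have lp i : 0 < l i ^+ p by rewrite exprn_gt0.
(* Up to [Z i] steps of the mesh keep a coordinate of the preimage in [[0, 1 / d]]; the squares of
   [d] such coordinates sum to at most 1. *)
pose Z (i : 'I_d) := Num.truncn (l i ^+ p / (d%:R * g)).
pose fam : finType := {dffun forall i : 'I_d, 'I_(Z i).+1}.
pose zc (z : fam) (i : nat) : R := if insub i is Some j then (z j : nat)%:R else 0.
have zcE (z : fam) (i : 'I_d) : zc z i = (z i : nat)%:R by rewrite /zc valK.
pose P (z : fam) : V := \sum_(i < d) (zc z i * g) *: f i.
have iterf i : iter p T (f i) = l i ^+ p *: f i.
  elim: p {sp szp hsp ep g g0 lp Z fam zc zcE P} => [|p IH]; first by rewrite scale1r.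
  by rewrite iterS IH linearZ /= hT scalerA exprSr.
have iter_sum n (a : nat -> R) :
    iter p T (\sum_(i < n) a i *: f i) = \sum_(i < n) (a i * l i ^+ p) *: f i.
  elim: n => [|n IH].
    rewrite !big_ord0; elim: p {sp szp hsp ep g g0 lp Z fam zc zcE P iterf} => //= p ->.
    by rewrite linear0.
  by rewrite !big_ord_recr /= addrC iter_linear IH iterf scalerA addrC.
have Pin (z : fam) : (iter p T @` unit_cball (V:=V)) (P z).
  exists (\sum_(i < d) (zc z i * g / l i ^+ p) *: f i).
    rewrite /unit_cball /= -(ler_pXn2r (ltn0Sn 1)) ?nnegrE// expr1n.
    rewrite (norm_sum_orthonormal hip hf d (fun i => zc z i * g / l i ^+ p)).
    apply: (@le_trans _ _ (\sum_(i < d) d%:R^-1)).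
      apply: ler_sum => i _.
      have h0 : 0 <= zc z i * g / l i ^+ p.
        by rewrite zcE divr_ge0 ?(ltW (lp i))// mulr_ge0// ltW.
      have h1 : zc z i * g / l i ^+ p <= d%:R^-1.
        rewrite ler_pdivrMr// zcE mulrC.
        apply: (@le_trans _ _ (g * (Z i)%:R)).
          by rewrite ler_pM2l// ler_nat -ltnS ltn_ord.
        rewrite mulrC -ler_pdivlMr//.
        have -> : d%:R^-1 * l i ^+ p / g = l i ^+ p / (d%:R * g).
          by rewrite [(_ * g)^-1]invfM mulrA [d%:R^-1 * _]mulrC.
        by rewrite truncn_le (divr_ge0 (ltW (lp i)) (mulr_ge0 (ltW d0) (ltW g0))).
      rewrite expr2; apply: (@le_trans _ _ (d%:R^-1 * 1)); last by rewrite mulr1.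
      by apply: ler_pM => //; apply: (le_trans h1); rewrite invf_le1// ler1n.
    by rewrite sumr_const card_ord -[_^-1 *+ _]mulr_natr mulVf// gt_eqF.
  rewrite (iter_sum d (fun i => zc z i * g / l i ^+ p)).
  by apply: eq_bigr => i _; rewrite divfK// gt_eqF.
have Psep (z z' : fam) : `|P z - P z'| <= 2 * eps ^+ p -> z = z'.
  move=> hP; apply/ffunP => i; apply/val_inj/eqP; apply: contraT => zz.
  have : g ^+ 2 <= `|P z - P z'| ^+ 2.
    have -> : P z - P z' = \sum_(i < d) ((zc z i - zc z' i) * g) *: f i.
      rewrite /P -sumrB; apply: eq_bigr => j _.
      by rewrite -scalerBl mulrBl.
    rewrite (norm_sum_orthonormal hip hf d (fun i => (zc z i - zc z' i) * g)).
    rewrite (bigD1 i)//= -[leLHS]addr0; apply: lerD; last first.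
      by apply: sumr_ge0 => j _; exact: sqr_ge0.
    rewrite [leRHS]exprMn ler_peMl ?sqr_ge0// !zcE.
    have [zz'|zz'] := ltnP (z i) (z' i).
      have : (z i).+1%:R <= (z' i)%:R :> R by rewrite ler_nat.
      rewrite -natr1 => h; set a : R := (z i)%:R in h *; set b : R := (z' i)%:R in h *; nra.
    have {}zz' : (z' i < z i)%N by rewrite ltn_neqAle eq_sym zz.
    have : (z' i).+1%:R <= (z i)%:R :> R by rewrite ler_nat.
    rewrite -natr1 => h; set a : R := (z i)%:R in h *; set b : R := (z' i)%:R in h *; nra.
  rewrite ler_pXn2r ?nnegrE ?(ltW g0)// => h.
  by have := le_trans h hP; rewrite /g; lra.
pose phi (z : fam) := find (fun y => `|P z - y| <= eps ^+ p) sp.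
have phis z : has (fun y => `|P z - y| <= eps ^+ p) sp.
  by have [y ys hy] := hsp _ (Pin z); apply/hasP; exists y.
have phi_inj : injective phi.
  move=> z z' E; apply: Psep.
  have h1 := nth_find 0 (phis z); have h2 := nth_find 0 (phis z').
  rewrite -/(phi z) in h1; rewrite -/(phi z') -E in h2.
  have -> : P z - P z' = (P z - nth 0 sp (phi z)) - (P z' - nth 0 sp (phi z)).
    by rewrite opprB addrA subrK.
  by apply: (le_trans (ler_normB _ _)); lra.
have card : (#|fam| <= size sp)%N.
  rewrite cardE -(size_map phi) -(size_iota 0 (size sp)); apply: uniq_leq_size.
    by rewrite map_inj_uniq ?enum_uniq.
  by move=> k /mapP[z _ ->]; rewrite mem_iota /= add0n -has_find.
have cardE' : #|fam| = (\prod_(i < d) (Z i).+1)%N.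
  rewrite /fam card_dep_ffun foldrE big_map -big_enum /=.
  by apply: eq_bigr => i _; rewrite card_ord.
have hprod : \prod_(i < d) (l i ^+ p / (d%:R * g)) <= (size sp)%:R.
  apply: (@le_trans _ _ (\prod_(i < d) (Z i).+1%:R)).
    apply: ler_prod => i _; rewrite (ltW (truncnS_gt _)) andbT.
    exact: divr_ge0 (ltW (lp i)) (mulr_ge0 (ltW d0) (ltW g0)).
  by rewrite -natr_prod ler_nat -cardE'.
rewrite szp natrX in hprod.
have -> : (\prod_(i < d) (l i / eps)) ^+ p = (3 * d%:R) ^+ d * \prod_(i < d) (l i ^+ p / (d%:R * g)).
  rewrite -prodrXl -[X in (3 * d%:R) ^+ X]card_ord -prodr_const -big_split /=.
  apply: eq_bigr => i _; rewrite /g expr_div_n; field.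
  by rewrite !gt_eqF.
by rewrite ler_pM2l// exprn_gt0// mulr_gt0.
Qed.

(** * Upper bound: tails, blocks of eigenvectors and the assembled cover *)

Lemma norm_ip_orthonormal_le (R : realType) (V : normedModType R) (ip : V -> V -> R) (f : nat -> V) :
  is_inner_product ip -> orthonormal_seq ip f -> forall x j, `|ip x (f j)| <= `|x|.
Proof.
move=> hip hf x j; have hf' : orthonormal_seq ip (fun i => f (j + i)%N).
  by move=> a b; rewrite hf eqn_add2l.
have := bessel_eq hip hf' 1 x; rewrite big_ord_recl big_ord0 /= addr0 addn0 => h.
rewrite -(ler_pXn2r (ltn0Sn 1)) ?nnegrE// h real_normK ?num_real// lerDl.
exact: sqr_ge0.
Qed.

(** Linearity of [T] carries no continuity; it is recovered here from compactness, for the passage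
    to the limit in [tail_norm_le]. *)
Lemma compact_op_bounded (R : realType) (V : normedModType R) (T : {linear V -> V}) :
  compact_op T -> exists2 M, 0 < M & forall u, `|T u| <= M * `|u|.
Proof.
move=> /compact_bounded[M [Mr hM]].
have M1 : M < `|M| + 1 by rewrite (le_lt_trans (ler_norm _))// ltrDl.
exists (`|M| + 1); first by rewrite ltr_wpDl.
move=> u; have [->|u0] := eqVneq u 0; first by rewrite linear0 !normr0 mulr0.
have up : 0 < `|u| by rewrite normr_gt0.
rewrite -ler_pdivrMr//.
have -> : `|T u| / `|u| = `|T (`|u|^-1 *: u)|.
  by rewrite linearZ /= normrZ gtr0_norm ?invr_gt0// mulrC.
apply: (hM _ M1); apply: subset_closure; exists (`|u|^-1 *: u) => //.
by rewrite /unit_cball /= normrZ gtr0_norm ?invr_gt0// mulVf ?gt_eqF.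
Qed.

Lemma norm_sum_orthonormal_nat (R : realType) (V : normedModType R) (ip : V -> V -> R) (f : nat -> V) :
  is_inner_product ip -> orthonormal_seq ip f -> forall m n (a : nat -> R),
  `|\sum_(m <= i < n) a i *: f i| ^+ 2 = \sum_(m <= i < n) a i ^+ 2.
Proof.
move=> hip hf m n a; rewrite -{1 2}[m]add0n !big_addn !big_mkord.
have hf' : orthonormal_seq ip (fun i => f (i + m)%N).
  by move=> i j; rewrite hf eqn_add2r.
exact: (norm_sum_orthonormal hip hf' (n - m) (fun i => a (i + m)%N)).
Qed.

(** The family [f] need not be a basis. By completeness the expansion of [w] converges to some [p];
    the difference [w - p] is orthogonal to every [f i], hence killed by [T]. So [T w = T p] is a
    limit of finite sums in which only eigenvalues of index at least [n] occur. *)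
Lemma tail_norm_le (R : realType) (V : completeNormedModType R) (ip : V -> V -> R)
    (T : {linear V -> V}) (f : nat -> V) (l : nat -> R) (n : nat) (w : V) :
  is_inner_product ip -> orthonormal_seq ip f -> compact_op T ->
  (forall i, T (f i) = l i *: f i) -> (forall i, 0 < l i) ->
  (forall i j, (i <= j)%N -> l j <= l i) ->
  (forall x, (forall i, ip x (f i) = 0) -> T x = 0) ->
  (forall i, (i < n)%N -> ip w (f i) = 0) ->
  `|T w| <= l n * `|w|.
Proof.
move=> hip hf /compact_op_bounded[M M0 hM] hT l0 lmono hker hw.
pose a i := ip w (f i).
pose S := series (fun i => a i *: f i).
pose A := series (fun i => a i ^+ 2).
have Ale N : A N <= `|w| ^+ 2.
  rewrite /A /series /= big_mkord (bessel_eq hip hf N w) lerDl.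
  exact: sqr_ge0.
have Acvg : cvgn A.
  apply: nondecreasing_is_cvgn.
    apply/nondecreasing_seqP => N.
    by rewrite /A /series /= big_nat_recr //= lerDl sqr_ge0.
  by exists (`|w| ^+ 2) => _ [N _ <-].
have Scvg : cvgn S.
  apply: cauchy_cvg; apply/cauchy_seriesP => e e0.
  have /cauchy_cvgP/cauchy_seriesP/(_ (e ^+ 2)) := Acvg.
  rewrite exprn_gt0// => /(_ isT); apply: filterS => -[N1 N2] /= h.
  rewrite -(ltr_pXn2r (ltn0Sn 1)) ?nnegrE ?(ltW e0)//.
  rewrite (norm_sum_orthonormal_nat hip hf).
  by apply: le_lt_trans h; exact: ler_norm.
set p := lim (S @ \oo) in Scvg.
have ipS N j : (j < N)%N -> ip (w - S N) (f j) = 0.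
  move=> jN; rewrite (ip_addl hip) -scaleN1r (ip_scalel hip) /S /series /= big_mkord.
  by rewrite (ip_sum_orthonormal hip hf) jN mulN1r subrr.
have near_p e : 0 < e -> \forall N \near \oo, `|p - S N| <= e.
  by move=> e0; have /cvgrPdist_le/(_ e e0) := Scvg.
have perp j : ip (w - p) (f j) = 0.
  apply/eqP; rewrite -normr_le0; apply/ler_addgt0Pl => e e0; rewrite addr0.
  have [N [jN hN]] : exists N, (j < N)%N /\ `|p - S N| <= e.
    have [N0 _ h] := near_p e e0; exists (maxn N0 j.+1); split.
      by rewrite leq_max ltnSn orbT.
    by apply: h; rewrite /= leq_max leqnn.
  have -> : w - p = (w - S N) - (p - S N) by rewrite opprB addrA subrK.
  rewrite (ip_addl hip) ipS// add0r.
  by apply: (le_trans (norm_ip_orthonormal_le hip hf _ _)); rewrite normrN.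
have Twp : T w = T p.
  by apply/eqP; rewrite -subr_eq0 -linearB hker.
apply/ler_addgt0Pl => e e0.
have [N0 _ h] := near_p (e / M) (divr_gt0 e0 M0).
have := h N0 (leqnn _) => {}h.
rewrite Twp -(subrK (T (S N0)) (T p)) -linearB.
apply: (le_trans (ler_normD _ _)); apply: lerD.
  by apply: (le_trans (hM _)); rewrite mulrC -ler_pdivlMr.
have -> : T (S N0) = \sum_(i < N0) (a i * l i) *: f i.
  rewrite /S /series /= big_mkord linear_sum; apply: eq_bigr => i _.
  by rewrite linearZ /= hT scalerA.
rewrite -(ler_pXn2r (ltn0Sn 1)) ?nnegrE ?mulr_ge0 ?(ltW (l0 _))//.
rewrite (norm_sum_orthonormal hip hf N0 (fun i => a i * l i)).
rewrite [leRHS]exprMn; apply: (@le_trans _ _ (l n ^+ 2 * A N0)); last first.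
  by apply: ler_wpM2l => //; exact: sqr_ge0.
rewrite /A /series /= big_mkord mulr_sumr; apply: ler_sum => i _.
have [ni|ni] := ltnP i n; first by rewrite /a hw// mul0r expr0n mulr0.
rewrite exprMn mulrC; apply: ler_wpM2r; first exact: sqr_ge0.
by rewrite ler_pXn2r ?nnegrE ?(ltW (l0 _))// lmono.
Qed.

(* [a / Q] is the share of the squared norm carried by the block, rounded up. *)
Lemma block_cover (R : realType) (k Q : nat) (rho mu r : R) (l v : nat -> R) (Y : seq (nat -> R)) :
  (0 < Q)%N -> 0 < mu -> mu * r <= rho -> 0 <= r ->
  (forall i, 0 <= l i <= mu) ->
  (forall x : nat -> R, \sum_(i < k) x i ^+ 2 <= 1 ->
      has (fun y : nat -> R => \sum_(i < k) (x i - y i) ^+ 2 <= r ^+ 2) Y) ->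
  \sum_(i < k) v i ^+ 2 <= 1 ->
  exists a c, [/\ (a < Q.+2)%N, c \in Y &
    \sum_(i < k) (l i * v i - mu * Num.sqrt (a%:R / Q%:R) * c i) ^+ 2 <=
      rho ^+ 2 * (\sum_(i < k) v i ^+ 2 + Q%:R^-1)].
Proof.
move=> Q0 mu0 mur r0 hl hY v1.
have Qp : 0 < Q%:R :> R by rewrite ltr0n.
set q := \sum_(i < k) v i ^+ 2 in v1 *.
have q0 : 0 <= q by apply: sumr_ge0 => i _; exact: sqr_ge0.
(* Rounding up makes [a] positive, so that dividing by [mu t] is legitimate even for a vanishing
   block. *)
pose a := (Num.truncn (Q%:R * q)).+1.
have ap : 0 < a%:R :> R by rewrite ltr0n.
have qa : Q%:R * q <= a%:R by rewrite ltW// truncnS_gt.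
have aq : a%:R <= Q%:R * q + 1.
  by rewrite /a -natr1 lerD2r truncn_le mulr_ge0// ltW.
pose t := Num.sqrt (a%:R / Q%:R : R).
have aQp : 0 < a%:R / Q%:R :> R by rewrite divr_gt0.
have t0 : 0 < t by rewrite sqrtr_gt0.
have t2 : t ^+ 2 = a%:R / Q%:R by rewrite sqr_sqrtr// ltW.
have mt0 : 0 < mu * t by rewrite mulr_gt0.
have [|y yY hy] := hasP (hY (fun i => l i * v i / (mu * t)) _).
  apply: (@le_trans _ _ (\sum_(i < k) v i ^+ 2 / (a%:R / Q%:R))).
    apply: ler_sum => i _.
    rewrite -t2 expr_div_n exprMn [(mu * t) ^+ 2]exprMn invfM mulrACA.
    apply: ler_piMl; first by rewrite divr_ge0 ?sqr_ge0.
    rewrite ler_pdivrMr ?exprn_gt0// mul1r.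
    by have /andP[? ?] := hl i; rewrite lerXn2r ?nnegrE// ltW.
  by rewrite -mulr_suml -/q ler_pdivrMr// mul1r ler_pdivlMr// mulrC.
exists a, y; split=> //.
  rewrite -(ltr_nat R); apply: (le_lt_trans aq).
  have : Q%:R * q <= Q%:R by rewrite ger_pMr.
  by rewrite -[Q.+2]addn2 natrD; lra.
rewrite -/t.
apply: (@le_trans _ _ ((mu * t) ^+ 2 * \sum_(i < k) (l i * v i / (mu * t) - y i) ^+ 2)).
  rewrite mulr_sumr le_eqVlt; apply/orP; left; apply/eqP; apply: eq_bigr => i _.
  by rewrite -exprMn; congr (_ ^+ 2); field; rewrite !gt_eqF.
apply: (@le_trans _ _ ((mu * t) ^+ 2 * r ^+ 2)).
  by apply: ler_wpM2l => //; exact: sqr_ge0.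
have -> : (mu * t) ^+ 2 * r ^+ 2 = (mu * r) ^+ 2 * t ^+ 2 by ring.
apply: ler_pM; rewrite ?sqr_ge0//.
  have mr0 : 0 <= mu * r by rewrite mulr_ge0// ltW.
  by rewrite lerXn2r ?nnegrE// (le_trans mr0).
by rewrite t2 ler_pdivrMr// mulrDl mulVf ?gt_eqF// mulrC.
Qed.

(** A block of mass [q] gets the squared error [rho^2 (q + 1 / Q)], proportional to its mass up to
    rounding, so the total is controlled however the mass is spread. The center of a block records a
    rounded mass, among [Q + 2] values, and a point of [Y j]. *)
Lemma blocks_cover (R : realType) (k Q : nat) (rho : R) (l : nat -> R) (r : nat -> R)
    (Y : nat -> seq (nat -> R)) :
  (0 < Q)%N -> (forall i, 0 < l i) -> (forall i j, (i <= j)%N -> l j <= l i) ->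
  (forall j, 0 <= r j) -> (forall j, l (j * k)%N * r j <= rho) ->
  (forall j (x : nat -> R), \sum_(i < k) x i ^+ 2 <= 1 ->
      has (fun y : nat -> R => \sum_(i < k) (x i - y i) ^+ 2 <= r j ^+ 2) (Y j)) ->
  forall L, exists s : seq (nat -> R),
    size s = (\prod_(j < L) (Q.+2 * size (Y j)))%N /\
    forall v : nat -> R, \sum_(n < L * k) v n ^+ 2 <= 1 ->
      exists2 y, y \in s & \sum_(n < L * k) (l n * v n - y n) ^+ 2 <=
        rho ^+ 2 * (\sum_(n < L * k) v n ^+ 2 + L%:R / Q%:R).
Proof.
move=> Q0 l0 lmono r0 hr hY; elim=> [|L [s [szs hs]]].
  exists [:: fun=> 0]; split; first by rewrite big_ord0.
  move=> v _; exists (fun=> 0); first by rewrite inE.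
  by rewrite !big_ord0 mul0r addr0 mulr0.
pose glue (y : nat -> R) (ac : nat * (nat -> R)) n := if (n < L * k)%N then y n else
  l (L * k)%N * Num.sqrt (ac.1%:R / Q%:R) * ac.2 (n - L * k)%N.
pose AC := [seq (a, c) | a <- iota 0 Q.+2, c <- Y L].
exists [seq glue y ac | y <- s, ac <- AC]; split.
  by rewrite size_allpairs szs big_ord_recr /= size_allpairs size_iota.
move=> v; rewrite mulSnr big_split_ord /= => v1.
have vL : \sum_(n < L * k) v n ^+ 2 <= 1.
  by apply: le_trans v1; rewrite lerDl sumr_ge0// => i _; exact: sqr_ge0.
have vk : \sum_(i < k) v (L * k + i)%N ^+ 2 <= 1.
  by apply: le_trans v1; rewrite lerDr sumr_ge0// => i _; exact: sqr_ge0.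
have [y ys hy] := hs v vL.
have [|a [c [aQ cY hac]]] := @block_cover R k Q rho (l (L * k)%N) (r L)
  (fun i => l (L * k + i)%N) (fun i => v (L * k + i)%N) (Y L) Q0 (l0 _) (hr L) (r0 L) _ (hY L) vk.
  by move=> i; rewrite (ltW (l0 _))/= lmono// leq_addr.
exists (glue y (a, c)).
  apply/allpairsP; exists (y, (a, c)); split => //=.
  by apply/allpairsP; exists (a, c); split; rewrite ?mem_iota.
rewrite !big_split_ord /=.
apply: (@le_trans _ _ (rho ^+ 2 * (\sum_(n < L * k) v n ^+ 2 + L%:R / Q%:R) +
   rho ^+ 2 * (\sum_(i < k) v (L * k + i)%N ^+ 2 + Q%:R^-1))).
  apply: lerD.
    apply: le_trans hy; rewrite le_eqVlt; apply/orP; left; apply/eqP.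
    by apply: eq_bigr => i _; rewrite /glue ltn_ord.
  apply: le_trans hac; rewrite le_eqVlt; apply/orP; left; apply/eqP.
  by apply: eq_bigr => i _; rewrite /glue ltnNge leq_addr /= addKn.
rewrite -natr1 -mulrDr le_eqVlt; apply/orP; left; apply/eqP; congr (_ * _).
by rewrite mulrDl mul1r; ring.
Qed.

Lemma covers_closure (R : realType) (V : normedModType R) (eps : R) (K : set V) (s : seq V) :
  covers eps K s -> covers eps (closure K) s.
Proof.
move=> hs x clx.
apply/not_exists2P => hn.
have : exists2 d, 0 < d & forall y, y \in s -> eps + d < `|x - y|.
  elim: s hn {hs} => [|z s IH] hn; first by exists 1.
  have [|d d0 hd] := IH.
    by move=> y; case: (hn y) => h; [left; move=> ys; apply: h; rewrite inE ys orbT|right].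
  have hz : eps < `|x - z|.
    by case: (hn z) => [|/negP]; [case; rewrite mem_head|rewrite -ltNge].
  exists (Num.min d ((`|x - z| - eps) / 2)).
    by rewrite lt_min d0 divr_gt0// subr_gt0.
  move=> y; rewrite inE => /predU1P[->|/hd].
    have : Num.min d ((`|x - z| - eps) / 2) <= (`|x - z| - eps) / 2 by rewrite ge_min lexx orbT.
    by lra.
  have : Num.min d ((`|x - z| - eps) / 2) <= d by rewrite ge_min lexx.
  by lra.
move=> [d d0 hd].
have [u [Ku]] := clx _ (nbhsx_ballx x d d0); rewrite -ball_normE /= => xu.
have [y ys hy] := hs u Ku.
have := hd y ys; apply/negP; rewrite -leNgt.
have -> : x - y = (u - y) + (x - u) by rewrite [RHS]addrC addrA subrK.
by apply: (le_trans (ler_normD _ _)); apply: lerD => //; exact: ltW.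
Qed.

(** Past index [L k] the center is 0 and the tail costs at most [rho^2 |w|^2]. Self-adjointness
    makes [T w] orthogonal to the head, so squared errors add, and [bessel_eq] turns the sum of the
    masses into [|u|^2 <= 1]. *)
Lemma operator_cover (R : realType) (V : completeNormedModType R) (ip : V -> V -> R)
    (T : {linear V -> V}) (f : nat -> V) (l : nat -> R) (k Q L : nat) (rho : R)
    (r : nat -> R) (Y : nat -> seq (nat -> R)) :
  is_inner_product ip -> orthonormal_seq ip f -> self_adjoint ip T -> compact_op T ->
  (forall i, T (f i) = l i *: f i) -> (forall i, 0 < l i) ->
  (forall i j, (i <= j)%N -> l j <= l i) ->
  (forall x, (forall i, ip x (f i) = 0) -> T x = 0) ->
  (0 < Q)%N -> 0 < rho -> (forall j, 0 <= r j) -> (forall j, l (j * k)%N * r j <= rho) ->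
  (forall j (x : nat -> R), \sum_(i < k) x i ^+ 2 <= 1 ->
      has (fun y : nat -> R => \sum_(i < k) (x i - y i) ^+ 2 <= r j ^+ 2) (Y j)) ->
  l (L * k)%N <= rho ->
  exists s : seq V, size s = (\prod_(j < L) (Q.+2 * size (Y j)))%N /\
    covers (rho * Num.sqrt (1 + L%:R / Q%:R)) (closure (T @` unit_cball (V:=V))) s.
Proof.
move=> hip hf hsa hc hT l0 lmono hker Q0 rho0 r0 hr hY hL.
have [s [szs hs]] := blocks_cover Q0 l0 lmono r0 hr hY L.
exists [seq \sum_(n < L * k) (y : nat -> R) n *: f n | y <- s]; split.
  by rewrite size_map.
apply: covers_closure => _ [u u1 <-].
set N := (L * k)%N in hs *.
set w := u - \sum_(n < N) ip u (f n) *: f n.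
have bes := bessel_eq hip hf N u; rewrite -/w in bes.
have u2 : `|u| ^+ 2 <= 1 by rewrite exprn_ile1.
have v1 : \sum_(n < N) ip u (f n) ^+ 2 <= 1.
  by apply: le_trans u2; rewrite bes lerDl sqr_ge0.
have [y ys hy] := hs (fun n => ip u (f n)) v1.
exists (\sum_(n < N) y n *: f n); first by apply/mapP; exists y.
have hw i : (i < N)%N -> ip w (f i) = 0.
  move=> iN; rewrite /w (ip_addl hip) -scaleN1r (ip_scalel hip).
  by rewrite (ip_sum_orthonormal hip hf N (fun n => ip u (f n))) iN mulN1r subrr.
have hTw := tail_norm_le hip hf hc hT l0 lmono hker hw.
have -> : T u - \sum_(n < N) y n *: f n =
    \sum_(n < N) (l n * ip u (f n) - y n) *: f n + T w.
  have -> : T u = T (\sum_(n < N) ip u (f n) *: f n) + T w by rewrite -linearD addrC /w subrK.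
  rewrite addrAC; congr (_ + _); rewrite linear_sum -sumrB; apply: eq_bigr => i _.
  by rewrite linearZ /= hT scalerA -scalerBl [l i * _]mulrC.
have QL : 0 <= 1 + L%:R / Q%:R :> R by rewrite addr_ge0// divr_ge0.
rewrite -(ler_pXn2r (ltn0Sn 1)) ?nnegrE ?mulr_ge0 ?sqrtr_ge0 ?(ltW rho0)//.
rewrite (normD_ip hip) (norm_sum_orthonormal hip hf N (fun n => l n * ip u (f n) - y n)).
have -> : ip (\sum_(n < N) (l n * ip u (f n) - y n) *: f n) (T w) = 0.
  rewrite (ip_suml hip N (fun n => (l n * ip u (f n) - y n) *: f n)) big1// => i _.
  rewrite (ip_scalel hip); case: (hip) => hsym _ _.
  by rewrite -hsa hT (ip_scalel hip) (hsym (f i) w) hw// !mulr0.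
rewrite mulr0 addr0 exprMn sqr_sqrtr//.
apply: (@le_trans _ _ (rho ^+ 2 * (\sum_(n < N) ip u (f n) ^+ 2 + L%:R / Q%:R) +
  rho ^+ 2 * `|w| ^+ 2)).
  apply: lerD => //; rewrite -exprMn lerXn2r ?nnegrE ?mulr_ge0 ?(ltW rho0)//.
  by apply: (le_trans hTw); apply: ler_wpM2r.
rewrite -mulrDr; apply: ler_wpM2l; first exact: sqr_ge0.
by rewrite addrAC -bes lerD2r.
Qed.

(** Blocks whose eigenvalues are at most the radius are covered without any logarithmic cost; hence
    the positive part. *)
Definition lnp (R : realType) (x : R) : R := Num.max 0 (ln x).

Lemma lnp_ge0 (R : realType) (x : R) : 0 <= lnp x.
Proof. by rewrite /lnp le_max lexx. Qed.

Lemma le_lnp (R : realType) (x y : R) : 0 < x -> x <= y -> lnp x <= lnp y.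
Proof.
move=> x0 xy; rewrite /lnp ge_max le_max lexx /= le_max ler_ln ?posrE ?xy ?orbT//.
exact: lt_le_trans xy.
Qed.

(** By monotonicity the leading value of a block is at most the average of [g] over the preceding
    block; only the first block has no predecessor. The claim [H] is shifted by one block so that
    the induction closes. *)
Lemma sum_blocks_le (R : realType) (k L : nat) (g : nat -> R) : (0 < k)%N ->
  (forall i j, (i <= j)%N -> g j <= g i) -> (forall i, 0 <= g i) ->
  k%:R * \sum_(j < L) g (j * k)%N <= k%:R * g 0%N + \sum_(i < L * k) g i.
Proof.
move=> k0 gm g0.
suff H : k%:R * \sum_(j < L.+1) g (j * k)%N <= k%:R * g 0%N + \sum_(i < L * k) g i.
  apply: le_trans H; apply: ler_wpM2l => //.
  by rewrite big_ord_recr /= lerDl.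
elim: L => [|L IH]; first by rewrite big_ord_recr /= !big_ord0 add0r addr0 mul0n.
have -> : \sum_(i < L.+1 * k) g i = \sum_(i < L * k) g i + \sum_(i < k) g (L * k + i)%N.
  by rewrite mulSnr big_split_ord.
rewrite big_ord_recr /= mulrDr addrA.
apply: lerD => //; rewrite mulr_natl -[X in _ *+ X]card_ord -sumr_const.
by apply: ler_sum => i _; apply: gm; rewrite mulSnr leq_add2l ltnW.
Qed.

(** The constant is uniform in all the parameters. [sum_blocks_le] passes from block leaders to all
    eigenvalues, and the exponent [k + 2] of [ball_cover], divided by [k], gives [1 + 2 / k]. *)
Lemma operator_cover_ln (R : realType) (V : completeNormedModType R) (ip : V -> V -> R)
    (T : {linear V -> V}) (f : nat -> V) (l : nat -> R) :
  is_inner_product ip -> orthonormal_seq ip f -> self_adjoint ip T -> compact_op T ->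
  (forall i, T (f i) = l i *: f i) -> (forall i, 0 < l i) ->
  (forall i j, (i <= j)%N -> l j <= l i) ->
  (forall x, (forall i, ip x (f i) = 0) -> T x = 0) ->
  exists2 C : R, 0 < C & forall (m k Q L : nat) (rho : R),
  (2 * m = k.+1)%N -> (0 < k)%N -> (0 < Q)%N -> 0 < rho -> l (L * k)%N <= rho ->
  exists s : seq V, [/\ (0 < size s)%N,
    covers (rho * Num.sqrt (1 + L%:R / Q%:R)) (closure (T @` unit_cball (V:=V))) s &
    ln (size s)%:R <= L%:R * (ln Q.+2%:R + ln (C * m.+1%:R ^+ 7)) +
      k.+2%:R * lnp (l 0%N / rho) + (1 + 2 / k%:R) * \sum_(i < L * k) lnp (l i / rho)].
Proof.
move=> hip hf hsa hc hT l0 lmono hker.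
exists (289 * expR 3); first by rewrite mulr_gt0 ?expR_gt0.
move=> m k Q L rho mk k0 Q0 rho0 hL.
have kp : 0 < k%:R :> R by rewrite ltr0n.
(* The cap at 1 is required by [ball_cover]; it is what turns [ln] into [lnp]. *)
pose r j := Num.min 1 (rho / l (j * k)%N).
have rp j : 0 < r j by rewrite /r lt_min ltr01 divr_gt0.
have r1 j : 0 < r j <= 1 by rewrite rp /r ge_min lexx.
have hr j : l (j * k)%N * r j <= rho.
  by rewrite mulrC -ler_pdivlMr// /r ge_min lexx orbT.
have lnr j : - ln (r j) = lnp (l (j * k)%N / rho).
  rewrite /r /lnp; have q0 : 0 < rho / l (j * k)%N by rewrite divr_gt0.
  have -> : l (j * k)%N / rho = (rho / l (j * k)%N)^-1 by rewrite invf_div.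
  rewrite lnV ?posrE//.
  case: (leP 1 (rho / l (j * k)%N)) => h.
    by rewrite ln1 oppr0 max_l// lerNl oppr0 ln_ge0.
  by rewrite max_r// lerNr oppr0 ln_le0// ltW.
have /choice[Y hY] : forall j, exists ys : seq (nat -> R),
    (size ys)%:R * r j ^+ k.+2 <= 289 * expR 3 * m.+1%:R ^+ 7 /\
    forall x : nat -> R, \sum_(i < k) x i ^+ 2 <= 1 ->
      has (fun y : nat -> R => \sum_(i < k) (x i - y i) ^+ 2 <= r j ^+ 2) ys.
  by move=> j; apply: ball_cover.
have Y0 j : (0 < size (Y j))%N.
  have z1 : \sum_(i < k) (fun=> 0 : R) i ^+ 2 <= 1.
    by rewrite big1// => i _; rewrite expr0n.
  by have /hasP[y + _] := (hY j).2 (fun=> 0) z1; case: (Y j).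
have [s [szs hs]] := @operator_cover R V ip T f l k Q L rho r Y hip hf hsa hc hT l0 lmono
  hker Q0 rho0 (fun j => ltW (rp j)) hr (fun j => (hY j).2) hL.
exists s; split => //.
  by rewrite szs; apply: prodn_gt0 => j; rewrite muln_gt0 Y0.
set C := 289 * expR 3 * m.+1%:R ^+ 7 in hY *.
have C0 : 0 < C by rewrite /C !mulr_gt0 ?expR_gt0 ?exprn_gt0.
have lnsY j : ln (size (Y j))%:R <= ln C + k.+2%:R * lnp (l (j * k)%N / rho).
  have sY0 : 0 < (size (Y j))%:R :> R by rewrite ltr0n.
  have rk : 0 < r j ^+ k.+2 by rewrite exprn_gt0.
  have : ln ((size (Y j))%:R * r j ^+ k.+2) <= ln C.
    by rewrite ler_ln ?posrE ?(mulr_gt0 sY0 rk) ?C0//; exact: (hY j).1.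
  rewrite lnM ?posrE// lnXn// -[ln _ *+ _]mulr_natl => h.
  by rewrite -lnr mulrN; lra.
have lns : ln (size s)%:R = \sum_(j < L) (ln Q.+2%:R + ln (size (Y j))%:R) :> R.
  rewrite szs; elim: L {hL s szs hs} => [|L IH]; first by rewrite !big_ord0 ln1.
  rewrite !big_ord_recr /= natrM lnM ?posrE ?ltr0n ?muln_gt0 ?Y0//; last first.
    by apply: prodn_gt0 => j; rewrite muln_gt0 Y0.
  by rewrite IH natrM lnM ?posrE ?ltr0n.
rewrite lns.
apply: (@le_trans _ _ (\sum_(j < L) ((ln Q.+2%:R + ln C) + k.+2%:R * lnp (l (j * k)%N / rho)))).
  by apply: ler_sum => j _; rewrite -addrA lerD2l.
rewrite big_split /= sumr_const card_ord -[_ *+ L]mulr_natl -addrA lerD2l -mulr_sumr.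
have hm i j : (i <= j)%N -> lnp (l j / rho) <= lnp (l i / rho).
  move=> ij; apply: le_lnp; first by rewrite divr_gt0.
  by rewrite ler_pM2r ?invr_gt0// lmono.
have h : \sum_(j < L) lnp (l (j * k)%N / rho) <=
    lnp (l 0%N / rho) + (\sum_(i < L * k) lnp (l i / rho)) / k%:R.
  rewrite -(ler_pM2l kp) mulrDr [k%:R * (_ / _)]mulrCA mulfV ?gt_eqF// mulr1.
  exact: (@sum_blocks_le R k L (fun i => lnp (l i / rho)) k0 hm (fun i => lnp_ge0 _)).
apply: (le_trans (ler_wpM2l (ler0n _ _) h)).
rewrite mulrDr lerD2l mulrA le_eqVlt; apply/orP; left; apply/eqP.
rewrite mulrAC; congr (_ * _); rewrite -addn2 natrD mulrDl mulfV ?gt_eqF//.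
Qed.

(** * From covers to the entropy *)

Lemma covering_number_ln_le (R : realType) (V : normedModType R) (eps : R) (K : set V) (s : seq V) :
  0 < covering_number eps K -> covers eps K s -> ln (covering_number eps K) <= ln (size s)%:R.
Proof.
move=> c0 hs; have h : covering_number eps K <= (size s)%:R.
  apply: ge_inf; last by exists s.
  by exists 0 => _ [t _ <-]; exact: ler0n.
by rewrite ler_ln ?posrE// (lt_le_trans c0).
Qed.

(** [inf] of the empty set is 0, so a cover [s] must be exhibited before the infimum can be bounded
    below; its size does not enter the bound. *)
Lemma covering_number_ge (R : realType) (V : normedModType R) (ip : V -> V -> R)
    (T : {linear V -> V}) (f : nat -> V) (l : nat -> R) (eps : R) (s : seq V) (d : nat) :
  is_inner_product ip -> orthonormal_seq ip f ->
  (forall i, T (f i) = l i *: f i) -> (forall i, 0 < l i) -> 0 < eps ->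
  covers eps (closure (T @` unit_cball (V:=V))) s ->
  \prod_(i < d) (l i / eps) <= covering_number eps (closure (T @` unit_cball (V:=V))).
Proof.
move=> hip hf hT l0 e0 hs; apply: lb_le_inf; first by exists (size s)%:R, s.
move=> _ [t ht <-]; apply: (covers_size_ge d hip hf hT l0 e0).
by move=> x Kx; apply: ht; exact: subset_closure.
Qed.

Lemma op_entropy_ge (R : realType) (V : normedModType R) (ip : V -> V -> R)
    (T : {linear V -> V}) (f : nat -> V) (l : nat -> R) (eps : R) (s : seq V) (d : nat) :
  is_inner_product ip -> orthonormal_seq ip f ->
  (forall i, T (f i) = l i *: f i) -> (forall i, 0 < l i) -> 0 < eps ->
  covers eps (closure (T @` unit_cball (V:=V))) s ->
  \sum_(i < d) ln (l i / eps) <= op_entropy T eps * ln 2.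
Proof.
move=> hip hf hT l0 e0 hs.
have ln2 : 0 < ln 2 :> R by rewrite ln_gt0// ltr1n.
rewrite /op_entropy /metric_entropy divfK ?gt_eqF//.
have P0 n : 0 < \prod_(i < n) (l i / eps) by apply: prodr_gt0 => i _; rewrite divr_gt0.
have h := covering_number_ge d hip hf hT l0 e0 hs.
have -> : \sum_(i < d) ln (l i / eps) = ln (\prod_(i < d) (l i / eps)).
  elim: d {h} => [|d IH]; first by rewrite !big_ord0 ln1.
  by rewrite !big_ord_recr /= IH [RHS]lnM ?posrE ?P0 ?divr_gt0.
by rewrite ler_ln ?posrE// (lt_le_trans (P0 d)).
Qed.

Lemma op_entropy_le (R : realType) (V : normedModType R) (ip : V -> V -> R)
    (T : {linear V -> V}) (f : nat -> V) (l : nat -> R) (eps : R) (s : seq V) :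
  is_inner_product ip -> orthonormal_seq ip f ->
  (forall i, T (f i) = l i *: f i) -> (forall i, 0 < l i) -> 0 < eps ->
  covers eps (closure (T @` unit_cball (V:=V))) s ->
  op_entropy T eps * ln 2 <= ln (size s)%:R.
Proof.
move=> hip hf hT l0 e0 hs.
have ln2 : 0 < ln 2 :> R by rewrite ln_gt0// ltr1n.
rewrite /op_entropy /metric_entropy divfK ?gt_eqF//.
apply: covering_number_ln_le => //.
(* The empty product shows that the covering number is at least 1, so [ln] is applied to a positive
   number. *)
have := covering_number_ge 0 hip hf hT l0 e0 hs; rewrite big_ord0.
exact: lt_le_trans.
Qed.

(** * Asymptotics *)

(** Young's inequality for [y^s] and 1 with exponents [1 / s] and [1 / (1 - s)]: a concave power
    lies below its tangent at 1. *)
Lemma powR_le_affine (R : realType) (y s : R) : 0 <= y -> 0 < s <= 1 ->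
  y `^ s <= 1 + s * (y - 1).
Proof.
move=> y0 /andP[s0]; rewrite le_eqVlt => /predU1P[->|s1].
  by rewrite powRr1//; lra.
have := @conjugate_powR R (y `^ s) 1 s^-1 (1 - s)^-1 (powR_ge0 _ _) ler01.
rewrite !invr_gt0 subr_gt0 s0 s1 !invrK subrKC => /(_ isT isT erefl).
rewrite mulr1 -powRrM mulfV ?gt_eqF// powRr1// powR1 mul1r; lra.
Qed.

Lemma ln_ge_1Bdiv (R : realType) (y : R) : 0 < y -> 1 - y^-1 <= ln y.
Proof.
move=> y0; have yi : 0 < y^-1 by rewrite invr_gt0.
have := @le_ln1Dx R (y^-1 - 1); rewrite subrKC lnV ?posrE// ltrDr => /(_ yi); lra.
Qed.

Lemma ln_le_sub1 (R : realType) (y : R) : 0 < y -> ln y <= y - 1.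
Proof.
by move=> y0; have := @le_ln1Dx R (y - 1); rewrite subrKC; apply; rewrite ltrBrDr addNr.
Qed.

Lemma powRB1E (R : realType) (y s : R) : 0 < y -> y `^ (s - 1) = y `^ s / y.
Proof.
move=> y0; rewrite powRB; first by rewrite powRr1// ltW.
by rewrite (lt0r_neq0 y0) implybT.
Qed.

Lemma powRD1_le (R : realType) (y s : R) : 0 < s <= 1 -> 0 < y ->
  (y + 1) `^ s <= y `^ s + s * y `^ (s - 1).
Proof.
move=> s01 y0; have -> : y + 1 = y * (1 + y^-1) by rewrite mulrDr mulr1 mulfV ?gt_eqF.
have yi : 0 < y^-1 by rewrite invr_gt0.
rewrite powRM ?(ltW y0) ?(ltW (addr_gt0 ltr01 yi))//.
have := @powR_le_affine R (1 + y^-1) s _ s01; rewrite addrAC subrr add0r.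
move=> /(_ (ltW (addr_gt0 ltr01 yi))) h.
apply: (le_trans (ler_wpM2l (powR_ge0 _ _) h)).
rewrite mulrDr mulr1 lerD2l mulrCA ler_pM2l; last by case/andP: s01.
by rewrite powRB1E.
Qed.

Lemma powRB1_le (R : realType) (y s : R) : 0 < s <= 1 -> 1 <= y ->
  (y - 1) `^ s + s * y `^ (s - 1) <= y `^ s.
Proof.
move=> s01 y1; have y0 : 0 < y by apply: lt_le_trans y1.
have yi : y^-1 <= 1 by rewrite invf_le1.
have -> : y - 1 = y * (1 - y^-1) by rewrite mulrBr mulr1 mulfV ?gt_eqF.
rewrite powRM ?(ltW y0) ?subr_ge0//.
have := @powR_le_affine R (1 - y^-1) s _ s01; rewrite addrAC subrr add0r subr_ge0 yi => /(_ isT) h.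
have h2 := ler_wpM2l (powR_ge0 y s) h.
have -> : y `^ (s - 1) = y `^ s * y^-1 by rewrite powRB1E.
move: h2; rewrite mulrDr mulr1; lra.
Qed.

(** The tangent bound [powRB1_le] compares [s i^(s-1)] with an increment of the power [s], and the
    increments telescope. *)
Lemma sum_powR_le (R : realType) (s : R) (d : nat) : 0 < s <= 1 ->
  \sum_(i < d) i.+1%:R `^ (s - 1) <= d%:R `^ s / s.
Proof.
move=> s01; have s0 : 0 < s by case/andP: s01.
elim: d => [|d IH]; first by rewrite big_ord0 divr_ge0 ?powR_ge0// ltW.
rewrite big_ord_recr /= ler_pdivlMr//.
have := @powRB1_le R d.+1%:R s s01; rewrite ler1n => /(_ isT).
rewrite -{1}natr1 addrK; move: IH; rewrite ler_pdivlMr//; lra.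
Qed.

Lemma sum_powR_ge (R : realType) (s : R) (d : nat) : 0 < s <= 1 ->
  (d%:R `^ s - 1) / s <= \sum_(i < d) i.+1%:R `^ (s - 1).
Proof.
move=> s01; have s0 : 0 < s by case/andP: s01.
rewrite ler_pdivrMr//.
apply: (@le_trans _ _ (d.+1%:R `^ s - 1)).
  rewrite lerD2r ge0_ler_powR ?nnegrE ?(ltW s0)// ler_nat//.
elim: d => [|d IH]; first by rewrite big_ord0 powR1 subrr mul0r.
rewrite big_ord_recr /= mulrDl.
have := @powRD1_le R d.+1%:R s s01; rewrite ltr0n => /(_ isT); rewrite natr1; lra.
Qed.

Lemma ln_fact_ge (R : realType) (d : nat) : d%:R * ln d%:R - d%:R <= ln d`!%:R :> R.
Proof.
case: d => [|d]; first by rewrite mul0r subr0 fact0 ln1.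
have f0 : 0 < d.+1`!%:R :> R by rewrite ltr0n fact_gt0.
have := fact_expR_ge R d.+1; rewrite -ler_ln ?posrE ?exprn_gt0 ?mulr_gt0 ?expR_gt0//.
by rewrite lnM ?posrE ?expR_gt0// expRK lnXn// -[ln _ *+ _]mulr_natl; lra.
Qed.

Lemma ln_fact_le (R : realType) (d : nat) : (0 < d)%N ->
  ln d`!%:R <= d%:R * ln d%:R - d%:R + 1 + ln d%:R :> R.
Proof.
move=> d0; have f0 : 0 < d`!%:R :> R by rewrite ltr0n fact_gt0.
have dp : 0 < d%:R :> R by rewrite ltr0n.
have := fact_expR_le R d0; rewrite -ler_ln ?posrE ?mulr_gt0 ?exprn_gt0 ?expR_gt0//.
rewrite lnM ?posrE ?expR_gt0// expRK.
rewrite lnM ?posrE ?mulr_gt0 ?exprn_gt0 ?expR_gt0//.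
rewrite lnM ?posrE ?expR_gt0// expRK lnXn// -[ln _ *+ _]mulr_natl; lra.
Qed.

Lemma sum_ln_fact (R : realType) (x : R) (d : nat) :
  \sum_(i < d) (ln x - ln i.+1%:R) = d%:R * ln x - ln d`!%:R.
Proof.
elim: d => [|d IH]; first by rewrite big_ord0 mul0r fact0 ln1 subrr.
rewrite big_ord_recr /= IH factS natrM lnM ?posrE ?ltr0n ?fact_gt0// -natr1; ring.
Qed.

(** The sum is at most [d ln (x / d) + d], which [ln u <= u - 1] bounds by [x]. Uniformity in [d] is
    what tolerates an inexact threshold index later on. *)
Lemma sum_ln_le (R : realType) (x : R) (d : nat) : 0 < x ->
  \sum_(i < d) (ln x - ln i.+1%:R) <= x.
Proof.
move=> x0; rewrite sum_ln_fact; case: d => [|d].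
  by rewrite mul0r fact0 ln1 subr0 ltW.
have := ln_fact_ge R d.+1; set D : R := d.+1%:R; have D0 : 0 < D by rewrite ltr0n.
have := @ln_le_sub1 R (x / D) (divr_gt0 x0 D0); rewrite ln_div ?posrE// => h.
have := ler_wpM2l (ltW D0) h; rewrite mulrBr mulrBr mulr1 mulrCA mulfV ?gt_eqF// mulr1; lra.
Qed.

Lemma sum_ln_ge (R : realType) (x : R) : 1 <= x ->
  x - 2 - ln x <= \sum_(i < Num.truncn x) (ln x - ln i.+1%:R).
Proof.
move=> x1; have x0 : 0 < x by apply: lt_le_trans x1.
set d := Num.truncn x; have d0 : (0 < d)%N by rewrite truncn_gt0.
have dp : 0 < d%:R :> R by rewrite ltr0n.
have dx : d%:R <= x by rewrite truncn_le ltW.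
have xd : x < d%:R + 1 by rewrite natr1 truncnS_gt.
have lndx : ln d%:R <= ln x by rewrite ler_ln.
rewrite sum_ln_fact; have := ln_fact_le R d0.
have : d%:R * ln d%:R <= d%:R * ln x by rewrite ler_pM2l.
by lra.
Qed.

Lemma near_le_powR (R : realType) (p A : R) : 0 < p -> \forall x \near +oo, A <= x `^ p.
Proof.
move=> p0; near=> x.
have Ax : (`|A| + 1) `^ p^-1 <= x by near: x; exact: nbhs_pinfty_ge.
apply: (le_trans (ler_norm A)); apply: (@le_trans _ _ (`|A| + 1)); first by rewrite lerDl.
have A1 : 0 <= `|A| + 1 by rewrite addr_ge0.
rewrite -[leLHS](powRr1 A1) -(mulVf (lt0r_neq0 p0)) powRrM.
by rewrite ge0_ler_powR ?nnegrE ?powR_ge0 ?(ltW p0)// (le_trans _ Ax) ?powR_ge0.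
Unshelve. all: by end_near. Qed.

Lemma near_le_mul_powR (R : realType) (p A eta : R) : 0 < p -> 0 < eta ->
  \forall x \near +oo, A <= eta * x `^ p.
Proof.
move=> p0 e0; have := near_le_powR (A / eta) p0; apply: filterS => x.
by rewrite ler_pdivrMr// mulrC.
Qed.

Lemma near_ln_le_powR (R : realType) (p A eta : R) : 0 < p -> 0 < eta ->
  \forall x \near +oo, A * ln x <= eta * x `^ p.
Proof.
move=> p0 e0; have p2 : 0 < p / 2 by rewrite divr_gt0.
near=> x.
have x1 : 1 <= x by near: x; exact: nbhs_pinfty_ge.
have x0 : 0 < x by apply: lt_le_trans x1.
have h1 : `|A| * (2 / p) / eta <= x `^ (p / 2).
  by near: x; exact: near_le_powR.
have h2 : ln x <= (2 / p) * x `^ (p / 2).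
  have := ln_sublinear (powR_gt0 (p / 2) x0); rewrite ln_powR => /ltW h.
  have -> : ln x = (2 / p) * (p / 2 * ln x) by field; rewrite gt_eqF.
  by rewrite ler_pM2l// divr_gt0.
apply: (@le_trans _ _ (`|A| * ln x)).
  by apply: ler_wpM2r; [exact: ln_ge0 | exact: ler_norm].
apply: (le_trans (ler_wpM2l (normr_ge0 A) h2)).
have -> : x `^ p = x `^ (p / 2) * x `^ (p / 2).
  by rewrite -powRD ?(lt0r_neq0 x0) ?implybT//; congr (_ `^ _); field.
rewrite !mulrA; apply: ler_wpM2r; first exact: powR_ge0.
by move: h1; rewrite ler_pdivrMr// [_ * eta]mulrC !mulrA.
Unshelve. all: by end_near. Qed.

(* Applied with [l i] the eigenvalue of index [i + 1], [c = c2 / c1] and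
   [s = a1 - a2 + 1]. *)
Definition log_asymptotics (R : realType) (l : nat -> R) (c1 a1 c s : R) : Prop :=
  forall eta, 0 < eta -> exists N : nat, forall i, (N <= i)%N ->
    `|ln (l i) - (ln c1 - a1 * ln i.+1%:R + c * i.+1%:R `^ (s - 1))|
      <= eta * i.+1%:R `^ (s - 1).

(** The hypothesis on the exponents in terms of [s = a1 - a2 + 1]: [a1 < a2 < a1 + 1/2] reads
    [1/2 < s < 1], and [a1 = a2] reads [s = 1]. In both cases [c x^(s-1)] tends to 0. *)
Definition subcritical (R : realType) (c s : R) : Prop := 2^-1 < s < 1 \/ (s = 1 /\ c = 0).

Lemma subcritical_le1 (R : realType) (c s : R) : subcritical c s -> 0 < s <= 1.
Proof.
case=> [/andP[h1 h2]|[-> _]]; last by rewrite ltr01 lexx.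
by rewrite (ltW h2) andbT (lt_trans _ h1)// invr_gt0.
Qed.

Lemma near_nat_seq (R : realType) (P : R -> Prop) :
  (\forall x \near +oo, P x) -> exists N : nat, forall i, (N <= i)%N -> P i.+1%:R.
Proof.
move=> [M [_ hM]]; exists (Num.truncn M) => i Mi; apply: hM.
by apply: (lt_le_trans (truncnS_gt M)); rewrite ler_nat.
Qed.

Lemma subcritical_small (R : realType) (c s eta : R) : subcritical c s -> 0 < eta ->
  \forall x \near +oo, `|c| * x `^ (s - 1) <= eta.
Proof.
move=> [/andP[s1 s2]|[_ ->]] e0; last first.
  by near=> x; rewrite normr0 mul0r ltW.
have p0 : 0 < 1 - s by rewrite subr_gt0.
near=> x.
have x0 : 0 < x by near: x; exact: nbhs_pinfty_gt.
have h : `|c| <= eta * x `^ (1 - s) by near: x; exact: near_le_mul_powR.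
have -> : s - 1 = - (1 - s) by ring.
by rewrite powRN ler_pdivrMr ?powR_gt0.
Unshelve. all: by end_near. Qed.

Lemma powRB1_itv (R : realType) (s : R) (i : nat) : 0 < s <= 1 ->
  0 < i.+1%:R `^ (s - 1) <= 1.
Proof.
move=> /andP[s0 s1]; rewrite powR_gt0//=.
by rewrite -[leRHS](powRr0 i.+1%:R) ler_powR ?ler1n// subr_le0.
Qed.

Lemma ln1D_approx (R : realType) (d : R) : `|d| <= 2^-1 -> `|ln (1 + d) - d| <= 2 * d ^+ 2.
Proof.
rewrite ler_norml => /andP[d1 d2].
have p : 0 < 1 + d by lra.
have h1 : ln (1 + d) <= d by apply: le_ln1Dx; lra.
have h2 := ln_ge_1Bdiv p.
have h3 : d - 2 * d ^+ 2 <= 1 - (1 + d)^-1.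
  rewrite -subr_ge0.
  have -> : 1 - (1 + d)^-1 - (d - 2 * d ^+ 2) = d ^+ 2 * (1 + 2 * d) / (1 + d).
    by field; rewrite gt_eqF.
  by rewrite divr_ge0 ?(ltW p)// mulr_ge0 ?sqr_ge0//; lra.
by have := sqr_ge0 d; rewrite ler_norml => ?; apply/andP; split; lra.
Qed.

(** Write [l i = c1 n^(-a1) (1 + d)]. The hypothesis says that [d] is [c n^(s-1)] up to
    [o(n^(s-1))]; since [d] tends to 0, the quadratic error of [ln (1 + d)] is negligible against
    [n^(s-1)]. *)
Lemma log_asymptotics_of (R : realType) (l : nat -> R) (c1 c2 a1 a2 : R) :
  0 < c1 -> (forall i, 0 < l i) -> subcritical (c2 / c1) (a1 - a2 + 1) ->
  (forall eta, 0 < eta -> exists N : nat, forall i, (N <= i)%N ->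
    `|l i - (c1 * i.+1%:R `^ (- a1) + c2 * i.+1%:R `^ (- a2))| <= eta * i.+1%:R `^ (- a2)) ->
  log_asymptotics l c1 a1 (c2 / c1) (a1 - a2 + 1).
Proof.
move=> c10 l0 hcs hl eta e0; set c := c2 / c1 in hcs *; set s := a1 - a2 + 1 in hcs *.
have s01 := subcritical_le1 hcs.
have K0 : 0 < 5 + 4 * `|c| by rewrite ltr_pwDl// mulr_ge0.
pose e := Num.min 4^-1 (eta / (5 + 4 * `|c|)).
have ep : 0 < e by rewrite lt_min invr_gt0 ltr0n/= divr_gt0.
have e4 : e <= 4^-1 by rewrite /e ge_min lexx.
have eK : e * (5 + 4 * `|c|) <= eta by rewrite -ler_pdivlMr// /e ge_min lexx orbT.
have [N1 hN1] := hl (e * c1) (mulr_gt0 ep c10).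
have [N2 hN2] := near_nat_seq (subcritical_small hcs ep).
exists (maxn N1 N2) => i; rewrite geq_max => /andP[/hN1 h1 /hN2 h2].
set n : R := i.+1%:R in h1 h2 *; have n0 : 0 < n by rewrite ltr0n.
have /andP[D0 D1] := powRB1_itv i s01; rewrite -/n in D0 D1.
set D := n `^ (s - 1) in h2 D0 D1 *.
have A0 : 0 < c1 * n `^ (- a1) by rewrite mulr_gt0// powR_gt0.
have nE : n `^ (- a2) = n `^ (- a1) * D.
  by rewrite /D -powRD ?(lt0r_neq0 n0) ?implybT//; congr (_ `^ _); rewrite /s; ring.
pose d := l i / (c1 * n `^ (- a1)) - 1.
have lE : l i = c1 * n `^ (- a1) * (1 + d) by rewrite /d subrKC mulrCA mulfV ?mulr1// gt_eqF.
have dD : `|d - c * D| <= e * D.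
  rewrite -(ler_pM2l A0) -[X in X * `|_|](gtr0_norm A0) -normrM.
  have -> : c1 * n `^ (- a1) * (d - c * D) = l i - (c1 * n `^ (- a1) + c2 * n `^ (- a2)).
    by rewrite lE nE /c; field; rewrite gt_eqF.
  apply: (le_trans h1); rewrite nE le_eqVlt; apply/orP; left; apply/eqP; ring.
have eD : e * D <= e by rewrite ger_pMr.
have dle : `|d| <= (`|c| + e) * D.
  have -> : d = c * D + (d - c * D) by ring.
  apply: (le_trans (ler_normD _ _)); rewrite mulrDl; apply: lerD => //.
  by rewrite normrM (gtr0_norm D0).
have d2e : `|d| <= 2 * e by move: dle; rewrite mulrDl; lra.
have -> : ln (l i) = ln c1 - a1 * ln n + ln (1 + d).
  have d1 : 0 < 1 + d by move: d2e; rewrite ler_norml => /andP[]; lra.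
  by rewrite lE !lnM ?posrE ?powR_gt0// ln_powR mulNr.
have -> : ln c1 - a1 * ln n + ln (1 + d) - (ln c1 - a1 * ln n + c * D) =
   (ln (1 + d) - d) + (d - c * D) by ring.
apply: (le_trans (ler_normD _ _)).
have h3 : `|ln (1 + d) - d| <= 2 * d ^+ 2 by apply: ln1D_approx; lra.
have h4 : d ^+ 2 <= (2 * e) * ((`|c| + e) * D).
  by rewrite -[d ^+ 2]real_normK ?num_real// expr2; apply: ler_pM.
have h5 : e * (5 + 4 * `|c|) * D <= eta * D by rewrite ler_pM2r.
have h6 : e * e * D <= e * 4^-1 * D by rewrite ler_pM2r// ler_pM2l.
have := mulr_ge0 (mulr_ge0 (ltW ep) (normr_ge0 c)) (ltW D0).
by nra.
Qed.

(** The errors before index [N] add up to a constant, the later ones to a small multiple of [d^s];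
    the sum of [i^(s-1)] is [d^s / s] up to a bounded amount. *)
Lemma log_asymptotics_sum (R : realType) (l : nat -> R) (c1 a1 c s : R) :
  0 < s <= 1 -> log_asymptotics l c1 a1 c s ->
  forall eta, 0 < eta -> exists C, forall d,
  `|\sum_(i < d) (ln (l i) - ln c1 + a1 * ln i.+1%:R) - c / s * d%:R `^ s| <= C + eta * d%:R `^ s.
Proof.
move=> s01 hl eta e0; have s0 : 0 < s by case/andP: s01.
have [N hN] := hl (eta * s) (mulr_gt0 e0 s0).
pose err i := ln (l i) - ln c1 + a1 * ln i.+1%:R - c * i.+1%:R `^ (s - 1).
have hN' i : (N <= i)%N -> `|err i| <= eta * s * i.+1%:R `^ (s - 1).
  move=> /hN; apply: le_trans; rewrite le_eqVlt; apply/orP; left; apply/eqP.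
  by congr Num.norm; rewrite /err; ring.
pose g i : R := if (i < N)%N then `|err i| else 0.
have g0 i : 0 <= g i by rewrite /g; case: ifP.
pose C := \sum_(i < N) g i.
have gC d : \sum_(i < d) g i <= C.
  apply: (@le_trans _ _ (\sum_(i < N + d) g i)).
    by rewrite addnC big_split_ord /= lerDl sumr_ge0.
  rewrite big_split_ord /= [X in _ + X]big1 ?addr0// => i _.
  by rewrite /g ltnNge leq_addr.
have errd d : `|\sum_(i < d) err i| <= C + eta * d%:R `^ s.
  apply: (le_trans (ler_norm_sum _ _ _)).
  apply: (@le_trans _ _ (\sum_(i < d) (g i + eta * s * i.+1%:R `^ (s - 1)))).
    apply: ler_sum => i _; rewrite /g; case: ltnP => iN.
      by rewrite lerDl !mulr_ge0 ?powR_ge0 ?(ltW e0) ?(ltW s0).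
    by rewrite add0r; exact: hN'.
  rewrite big_split /= -mulr_sumr; apply: lerD; first exact: gC.
  rewrite -mulrA ler_pM2l// mulrC -ler_pdivlMr//; exact: sum_powR_le.
exists (C + `|c| / s) => d.
have -> : \sum_(i < d) (ln (l i) - ln c1 + a1 * ln i.+1%:R) - c / s * d%:R `^ s =
   \sum_(i < d) err i + c * (\sum_(i < d) i.+1%:R `^ (s - 1) - d%:R `^ s / s).
  rewrite mulrBr mulr_sumr addrA -big_split /=; congr (_ - _); last by ring.
  by apply: eq_bigr => i _; rewrite /err subrK.
apply: (le_trans (ler_normD _ _)).
have := errd d; suff : `|c * (\sum_(i < d) i.+1%:R `^ (s - 1) - d%:R `^ s / s)| <= `|c| / s by lra.
rewrite normrM; apply: ler_wpM2l => //.
have := @sum_powR_le R s d s01; have := @sum_powR_ge R s d s01; rewrite mulrBl mul1r => h1 h2.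
by rewrite ler_norml; apply/andP; split; [lra | have := invr_gt0 s; rewrite s0; lra].
Qed.

Lemma ln_quot (R : realType) (l : nat -> R) (c1 a1 x : R) i : (forall i, 0 < l i) -> 0 < c1 -> 0 < x ->
  ln (l i / (c1 * x `^ (- a1))) =
  a1 * (ln x - ln i.+1%:R) + (ln (l i) - ln c1 + a1 * ln i.+1%:R).
Proof.
move=> l0 c10 x0; rewrite ln_div ?posrE ?mulr_gt0 ?powR_gt0//.
by rewrite lnM ?posrE ?powR_gt0// ln_powR; ring.
Qed.

Lemma powR_natD1_le (R : realType) (s : R) (d : nat) : 0 < s <= 1 ->
  d.+1%:R `^ s <= d%:R `^ s + 1.
Proof.
move=> s01; have s0 : 0 < s by case/andP: s01.
case: d => [|d]; first by rewrite powR1 lerDr powR_ge0.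
have := @powRD1_le R d.+1%:R s s01; rewrite ltr0n natr1 => /(_ isT) h.
apply: (le_trans h); rewrite lerD2l.
have /andP[p0 p1] := powRB1_itv d s01; have /andP[_ s1] := s01.
by rewrite -[leRHS]mul1r; apply: ler_pM => //; rewrite ltW.
Qed.

(** The lower bound on the entropy holds for any number of eigenvectors, so the explicit [truncn x]
    can stand for the number of eigenvalues above the radius. *)
Lemma sum_ln_quot_ge (R : realType) (l : nat -> R) (c1 a1 c s : R) :
  (forall i, 0 < l i) -> 0 < c1 -> 0 < a1 -> 0 < s <= 1 -> log_asymptotics l c1 a1 c s ->
  forall eta, 0 < eta -> \forall x \near +oo,
    a1 * x + c / s * x `^ s - eta * x `^ s <=
    \sum_(i < Num.truncn x) ln (l i / (c1 * x `^ (- a1))).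
Proof.
move=> l0 c10 a10 s01 hl eta e0; have s0 : 0 < s by case/andP: s01.
have e3 : 0 < eta / 3 by rewrite divr_gt0.
have [C hC] := log_asymptotics_sum s01 hl e3.
near=> x.
have x1 : 1 <= x by near: x; exact: nbhs_pinfty_ge.
have x0 : 0 < x by apply: lt_le_trans x1.
have nA : C + `|c / s| + a1 * 2 <= eta / 3 * x `^ s by near: x; exact: near_le_mul_powR.
have nB : a1 * ln x <= eta / 3 * x `^ s by near: x; exact: near_ln_le_powR.
under eq_bigr do rewrite (ln_quot _ _ l0 c10 x0).
rewrite big_split /= -mulr_sumr.
set d := Num.truncn x.
have h1 := sum_ln_ge x1; rewrite -/d in h1.
have h2 := hC d.
have d0 : (0 < d)%N by rewrite truncn_gt0.
have dx : d%:R <= x by rewrite truncn_le ltW.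
have xd : x < d.+1%:R by rewrite truncnS_gt.
have b1 : d%:R `^ s <= x `^ s by rewrite ge0_ler_powR ?nnegrE ?(ltW s0) ?(ltW x0).
have b2 : x `^ s <= d%:R `^ s + 1.
  apply: le_trans (powR_natD1_le d s01).
  by rewrite ge0_ler_powR ?nnegrE ?(ltW s0) ?(ltW x0) ?(ltW xd).
have b3 : `|c / s * d%:R `^ s - c / s * x `^ s| <= `|c / s|.
  rewrite -mulrBr normrM ler_piMr// ler_norml; apply/andP; split; lra.
have h3 := ler_wpM2l (ltW a10) h1.
have h4 : eta / 3 * d%:R `^ s <= eta / 3 * x `^ s by rewrite ler_pM2l.
move: h2 b3; rewrite !ler_norml => /andP[h2 _] /andP[b3 _].
move: h3; rewrite !mulrBr => h3; lra.
Unshelve. all: by end_near. Qed.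

Lemma log_asymptotics_first (R : realType) (l : nat -> R) (c1 a1 c s : R) :
  subcritical c s -> log_asymptotics l c1 a1 c s ->
  forall theta, 0 < theta -> exists N : nat, forall i, (N <= i)%N ->
    `|ln (l i) - (ln c1 - a1 * ln i.+1%:R)| <= theta.
Proof.
move=> hcs hl th th0; have s01 := subcritical_le1 hcs.
have t2 : 0 < th / 2 by rewrite divr_gt0.
have [N1 hN1] := hl _ t2; have [N2 hN2] := near_nat_seq (subcritical_small hcs t2).
exists (maxn N1 N2) => i; rewrite geq_max => /andP[/hN1 h1 /hN2 h2].
have /andP[p0 p1] := powRB1_itv i s01.
set D := i.+1%:R `^ (s - 1) in h1 h2 p0 p1.
have -> : ln (l i) - (ln c1 - a1 * ln i.+1%:R) =
  ln (l i) - (ln c1 - a1 * ln i.+1%:R + c * D) + c * D by ring.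
apply: (le_trans (ler_normD _ _)); rewrite [`|c * D|]normrM (gtr0_norm p0).
have : th / 2 * D <= th / 2 by rewrite ger_pMr.
by lra.
Qed.

Lemma exists_le_eigenvalue (R : realType) (l : nat -> R) (c1 a1 c s : R) :
  (forall i, 0 < l i) -> 0 < a1 -> subcritical c s -> log_asymptotics l c1 a1 c s ->
  forall eps, 0 < eps -> exists n, l n <= eps.
Proof.
move=> l0 a10 hcs hl eps e0.
have [N hN] := log_asymptotics_first hcs hl ltr01.
pose B := expR ((ln c1 + 1 - ln eps) / a1).
pose n := maxn N (Num.truncn B).
exists n; rewrite -ler_ln ?posrE//.
have := hN n (leq_maxl _ _); rewrite ler_norml => /andP[_ h].
have h2 : (ln c1 + 1 - ln eps) / a1 <= ln n.+1%:R.
  rewrite -[leLHS]expRK ler_ln ?posrE ?expR_gt0// -/B.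
  apply: (le_trans (ltW (truncnS_gt B))); rewrite ler_nat ltnS; exact: leq_maxr.
move: h2; rewrite ler_pdivrMr// [ln n.+1%:R * _]mulrC; lra.
Qed.

(** First-order asymptotics suffice: they place [d] between [x expR (- th) - 1] and [x expR th].
    With [expR th = 1 + eta / 2] and [s <= 1], raising to the power [s] does not widen this band. *)
Lemma threshold_index_approx (R : realType) (l : nat -> R) (c1 a1 c s : R) :
  (forall i, 0 < l i) -> (forall i j, (i <= j)%N -> l j <= l i) -> 0 < c1 -> 0 < a1 ->
  subcritical c s -> log_asymptotics l c1 a1 c s ->
  forall eta, 0 < eta -> \forall x \near +oo, forall d : nat,
    (forall i, (i < d)%N -> c1 * x `^ (- a1) < l i) -> l d <= c1 * x `^ (- a1) ->
    `|d%:R `^ s - x `^ s| <= eta * x `^ s.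
Proof.
move=> l0 lmono c10 a10 hcs hl eta e0.
have s01 := subcritical_le1 hcs; have /andP[s0 s1] := s01.
have e2 : 0 < eta / 2 by rewrite divr_gt0.
pose th := ln (1 + eta / 2).
have th0 : 0 < th by rewrite ln_gt0// ltrDl.
have [N hN] := log_asymptotics_first hcs hl (mulr_gt0 a10 th0).
near=> x => d hd1 hd2.
have x0 : 0 < x by near: x; exact: nbhs_pinfty_gt.
have xN : N%:R <= x by near: x; exact: nbhs_pinfty_ge.
have nA : 1 <= eta / 2 * x `^ s by near: x; exact: near_le_mul_powR.
have nB : c1 / l N + 1 <= x `^ a1 by near: x; exact: near_le_powR.
have xa : 0 < x `^ a1 by rewrite powR_gt0.
have epsN : c1 * x `^ (- a1) < l N.
  by rewrite powRN ltr_pdivrMr// mulrC -ltr_pdivrMr//; lra.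
have lnd i : ln (l i / (c1 * x `^ (- a1))) =
  a1 * (ln x - ln i.+1%:R) + (ln (l i) - ln c1 + a1 * ln i.+1%:R) by exact: ln_quot.
have ep : 0 < c1 * x `^ (- a1) by rewrite mulr_gt0// powR_gt0.
have expth : expR th = 1 + eta / 2 by rewrite lnK// posrE addr_gt0.
have sth : expR (th * s) <= 1 + eta / 2.
  by rewrite -expth ler_expR ger_pMr.
have xth (y : R) : (x * expR y) `^ s = x `^ s * expR (y * s).
  by rewrite powRM ?expR_ge0 ?(ltW x0)// expRM.
have upper : d%:R <= x * expR th.
  case: d hd1 {hd2} => [|d] hd1; first by rewrite mulr_ge0 ?expR_ge0// ltW.
  have [dN|Nd] := ltnP d N.
    apply: (@le_trans _ _ x); first by apply: le_trans xN; rewrite ler_nat.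
    by rewrite ler_peMr ?(ltW x0)// expth lerDl ltW.
  have := hN d Nd; rewrite ler_norml => /andP[_ h].
  have : 0 < ln (l d / (c1 * x `^ (- a1))).
    by rewrite ln_gt0// ltr_pdivlMr// mul1r; exact: hd1.
  rewrite lnd => h2.
  have : a1 * ln d.+1%:R <= a1 * (ln x + th) by rewrite mulrDr; lra.
  rewrite ler_pM2l// => h3.
  rewrite -ler_ln ?posrE ?mulr_gt0 ?expR_gt0//.
  by rewrite lnM ?posrE ?expR_gt0// expRK.
have lower : x * expR (- th) <= d.+1%:R.
  have Nd : (N <= d)%N.
    rewrite leqNgt; apply/negP => dN; have := lmono d N (ltnW dN).
    by apply/negP; rewrite -ltNge (le_lt_trans hd2).
  have := hN d Nd; rewrite ler_norml => /andP[h _].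
  have : ln (l d / (c1 * x `^ (- a1))) <= 0.
    by rewrite ln_le0// ler_pdivrMr// mul1r.
  rewrite lnd => h2.
  have : a1 * (ln x - th) <= a1 * ln d.+1%:R by rewrite mulrBr; lra.
  rewrite ler_pM2l// => h3.
  rewrite -ler_ln ?posrE ?mulr_gt0 ?expR_gt0//.
  by rewrite lnM ?posrE ?expR_gt0// expRK.
have u2 : d%:R `^ s <= x `^ s * (1 + eta / 2).
  apply: (@le_trans _ _ ((x * expR th) `^ s)).
    by rewrite ge0_ler_powR ?nnegrE ?(ltW s0)// (le_trans _ upper).
  by rewrite xth ler_pM2l// powR_gt0.
have l2 : x `^ s * (1 - eta / 2) <= d%:R `^ s + 1.
  apply: le_trans (powR_natD1_le d s01).
  apply: (@le_trans _ _ ((x * expR (- th)) `^ s)).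
    rewrite xth ler_pM2l ?powR_gt0// mulNr expRN.
    apply: (@le_trans _ _ (1 + eta / 2)^-1); last first.
      by rewrite lef_pV2 ?posrE ?expR_gt0// addr_gt0.
    rewrite -[leRHS]mul1r ler_pdivlMr ?addr_gt0//.
    have := sqr_ge0 (eta / 2); rewrite expr2; lra.
  by rewrite ge0_ler_powR ?nnegrE ?(ltW s0)// mulr_ge0 ?expR_ge0// ltW.
move: u2 l2; rewrite mulrBr mulrDr mulr1 => u2 l2.
by rewrite ler_norml; apply/andP; split; lra.
Unshelve. all: by end_near. Qed.

(** Terms beyond the true threshold index [d] vanish. The uncertainty on [d] does not affect [a1 x],
    because [sum_ln_le] holds for every [d]; it only perturbs [c / s d^s], where
    [threshold_index_approx] is precise enough. *)
Lemma sum_lnp_quot_le (R : realType) (l : nat -> R) (c1 a1 c s : R) :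
  (forall i, 0 < l i) -> (forall i j, (i <= j)%N -> l j <= l i) -> 0 < c1 -> 0 < a1 ->
  subcritical c s -> log_asymptotics l c1 a1 c s ->
  forall eta, 0 < eta -> \forall x \near +oo, forall D : nat,
    \sum_(i < D) lnp (l i / (c1 * x `^ (- a1))) <= a1 * x + c / s * x `^ s + eta * x `^ s.
Proof.
move=> l0 lmono c10 a10 hcs hl eta e0.
have s01 := subcritical_le1 hcs; have /andP[s0 s1] := s01.
have e4 : 0 < eta / 4 by rewrite divr_gt0.
have [C hC] := log_asymptotics_sum s01 hl e4.
pose e5 := Num.min 1 (eta / 4 / (`|c / s| + 1)).
have cs1 : 0 < `|c / s| + 1 by rewrite ltr_wpDl.
have e50 : 0 < e5 by rewrite lt_min ltr01/= divr_gt0.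
have e51 : e5 <= 1 by rewrite /e5 ge_min lexx.
have e5c : `|c / s| * e5 <= eta / 4.
  apply: (@le_trans _ _ ((`|c / s| + 1) * e5)).
    by apply: ler_wpM2r; rewrite ?(ltW e50)// lerDl.
  by rewrite mulrC -ler_pdivlMr// /e5 ge_min lexx orbT.
have near_th := threshold_index_approx l0 lmono c10 a10 hcs hl e50.
near=> x => D.
have x0 : 0 < x by near: x; exact: nbhs_pinfty_gt.
have nA : C <= eta / 4 * x `^ s by near: x; exact: near_le_mul_powR.
have hth : forall d : nat,
    (forall i, (i < d)%N -> c1 * x `^ (- a1) < l i) -> l d <= c1 * x `^ (- a1) ->
    `|d%:R `^ s - x `^ s| <= e5 * x `^ s.
  by near: x.
have ep : 0 < c1 * x `^ (- a1) by rewrite mulr_gt0// powR_gt0.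
have ex := exists_le_eigenvalue l0 a10 hcs hl ep.
have [d hd1 hd2] : exists2 d, l d <= c1 * x `^ (- a1) &
    forall i, (i < d)%N -> c1 * x `^ (- a1) < l i.
  case: (ex_minnP ex) => d h1 h2; exists d => // i id.
  by rewrite ltNge; apply/negP => /h2; rewrite leqNgt id.
have hd := hth d hd2 hd1.
have xs : 0 < x `^ s by rewrite powR_gt0.
have step : \sum_(i < D) lnp (l i / (c1 * x `^ (- a1))) <=
    \sum_(i < d) ln (l i / (c1 * x `^ (- a1))).
  have lnpd i : (d <= i)%N -> lnp (l i / (c1 * x `^ (- a1))) = 0.
    move=> di; rewrite /lnp max_l// ln_le0// ler_pdivrMr// mul1r.
    by apply: le_trans hd1; exact: lmono.
  have lnpd' i : (i < d)%N -> lnp (l i / (c1 * x `^ (- a1))) = ln (l i / (c1 * x `^ (- a1))).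
    move=> id; rewrite /lnp max_r// ln_ge0// ler_pdivlMr// mul1r.
    by rewrite ltW// hd2.
  apply: (@le_trans _ _ (\sum_(i < d + D) lnp (l i / (c1 * x `^ (- a1))))).
    by rewrite addnC big_split_ord /= lerDl sumr_ge0// => i _; rewrite /lnp le_max lexx.
  rewrite big_split_ord /= [X in _ + X]big1 ?addr0; last first.
    by move=> i _; rewrite lnpd// leq_addr.
  by apply: ler_sum => i _; rewrite lnpd'.
apply: (le_trans step).
under eq_bigr do rewrite (ln_quot _ _ l0 c10 x0).
rewrite big_split /= -mulr_sumr.
have h1 := ler_wpM2l (ltW a10) (sum_ln_le d x0).
have h2 := hC d.
have h3 : `|c / s * d%:R `^ s - c / s * x `^ s| <= eta / 4 * x `^ s.
  rewrite -mulrBr normrM; apply: (le_trans (ler_wpM2l (normr_ge0 _) hd)).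
  by rewrite mulrA ler_pM2r.
have h4 : d%:R `^ s <= 2 * x `^ s.
  move: hd; rewrite ler_norml => /andP[_ hd].
  have : e5 * x `^ s <= 1 * x `^ s by rewrite ler_pM2r.
  by lra.
have h5 : eta / 4 * d%:R `^ s <= eta / 4 * (2 * x `^ s) by rewrite ler_pM2l.
move: h2 h3; rewrite !ler_norml => /andP[_ h2] /andP[_ h3].
by lra.
Unshelve. all: by end_near. Qed.

(** * The two-sided entropy expansion *)

Record diagonalized (R : realType) (V : completeNormedModType R) (ip : V -> V -> R)
    (T : {linear V -> V}) (f : nat -> V) (l : nat -> R) : Prop := Diagonalized {
  diag_ip : is_inner_product ip;
  diag_orth : orthonormal_seq ip f;
  diag_sa : self_adjoint ip T;
  diag_compact : compact_op T;
  diag_eig : forall i, T (f i) = l i *: f i;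
  diag_pos : forall i, 0 < l i;
  diag_mono : forall i j, (i <= j)%N -> l j <= l i;
  diag_ker : forall x, (forall i, ip x (f i) = 0) -> T x = 0 }.

Lemma near_pinfty_D1 (R : realType) (P : R -> Prop) :
  (\forall x \near +oo, P x) -> \forall x \near +oo, P (x + 1).
Proof.
move=> [M [Mr hM]]; exists M; split => // x Mx; apply: hM.
by rewrite (lt_trans Mx)// ltrDl.
Qed.

Lemma covers_le (R : realType) (V : normedModType R) (eps eps' : R) (K : set V) (s : seq V) :
  eps <= eps' -> covers eps K s -> covers eps' K s.
Proof. by move=> h hs x /hs[y ys hy]; exists y => //; exact: le_trans h. Qed.

(** A cover built at [x + 1] has its radius inflated by [sqrt (1 + t) <= expR (t / 2) <= expR (a1 /
    (x + 1))]. As [1 / (x + 1) <= ln (1 + 1 / x)], returning to the radius at [x] absorbs the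
    inflation. *)
Lemma radius_shift (R : realType) (c1 a1 x t : R) : 0 < c1 -> 0 < a1 -> 0 < x ->
  0 <= t <= 2 * a1 / (x + 1) ->
  c1 * (x + 1) `^ (- a1) * Num.sqrt (1 + t) <= c1 * x `^ (- a1).
Proof.
move=> c10 a10 x0 /andP[t0 t1]; have x1 : 0 < x + 1 by rewrite addr_gt0.
have h1 : Num.sqrt (1 + t) <= expR (a1 / (x + 1)).
  rewrite -(ler_pXn2r (ltn0Sn 1)) ?nnegrE ?sqrtr_ge0 ?expR_ge0//.
  rewrite sqr_sqrtr ?addr_ge0// -expRM_natl.
  by apply: le_trans (expR_ge1Dx _); rewrite lerD2l (le_trans t1)// mulrA.
have h2 : (x + 1)^-1 <= ln (x + 1) - ln x.
  have := ln_ge_1Bdiv (divr_gt0 x1 x0); rewrite ln_div ?posrE// invf_div => h.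
  apply: le_trans h; rewrite le_eqVlt; apply/orP; left; apply/eqP.
  by field; rewrite gt_eqF.
rewrite -mulrA ler_pM2l//; apply: (le_trans (ler_wpM2l (powR_ge0 _ _) h1)).
rewrite -ler_ln ?posrE ?mulr_gt0 ?powR_gt0 ?expR_gt0//.
rewrite lnM ?posrE ?powR_gt0 ?expR_gt0// !ln_powR expRK.
have := ler_wpM2l (ltW a10) h2; rewrite mulrBr; lra.
Qed.

(** [k] is about [2 sqrt x], and odd because of [2 m = k + 1]. The product [L k] is large enough to
    reach eigenvalues below the radius, and [Q], of order [x^(3/2)], makes [L / Q] small enough for
    [radius_shift]. *)
Lemma cover_parameters (R : realType) (a1 x : R) : 0 < a1 -> 1 <= x ->
  exists m k L Q : nat,
  [/\ (2 * m = k.+1)%N, (0 < k)%N, (0 < Q)%N & m.+1%:R <= 3 * Num.sqrt x] /\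
  [/\ Num.sqrt x <= k%:R, k.+2%:R <= 5 * Num.sqrt x, L%:R <= 5 * Num.sqrt x &
      2 * (x + 1) <= (L * k)%:R] /\
  0 <= (L%:R / Q%:R : R) <= 2 * a1 / (x + 1) /\ Q.+2%:R <= (5 / a1 + 3) * x ^+ 2.
Proof.
move=> a10 x1.
have x0 : 0 < x by apply: lt_le_trans x1.
have x'0 : 0 < x + 1 by rewrite addr_gt0.
set r := Num.sqrt x.
have r1 : 1 <= r by rewrite -[leLHS]sqrtr1 ler_sqrt ?(ltW x0).
have r0 : 0 < r by apply: lt_le_trans r1.
have rr : r * r = x by rewrite -expr2 sqr_sqrtr// ltW.
have rx : r <= x by rewrite -rr ler_peMr// ltW.
pose t := Num.truncn r.
have tr : t%:R <= r by rewrite truncn_le ltW.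
have rt : r < t%:R + 1 by rewrite natr1 truncnS_gt.
pose k := (2 * t).+1; pose m := t.+1.
have mk : (2 * m = k.+1)%N by rewrite /m /k mulnS.
have kE : k%:R = 2 * t%:R + 1 :> R by rewrite /k -natr1 natrM.
have t0 : 0 <= t%:R :> R by [].
have kr : r <= k%:R by rewrite kE; lra.
have k2 : k.+2%:R <= 5 * r by rewrite -addn2 natrD kE; lra.
have m3 : m.+1%:R <= 3 * r by rewrite /m -addn2 natrD; lra.
have kp : 0 < k%:R :> R by rewrite ltr0n.
clearbody r; move: k m mk kE kr k2 m3 kp => k m mk kE kr k2 m3 kp {t tr rt kE t0}.
pose L := (Num.truncn (2 * (x + 1) / k%:R)).+1.
have Lk : 2 * (x + 1) <= (L * k)%:R.
  by rewrite natrM -ler_pdivrMr// ltW// truncnS_gt.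
have L5 : L%:R <= 5 * r.
  rewrite /L -natr1.
  have : (Num.truncn (2 * (x + 1) / k%:R))%:R <= 2 * (x + 1) / k%:R.
    by rewrite truncn_le divr_ge0// mulr_ge0// ltW.
  have : 2 * (x + 1) / k%:R <= 4 * r.
    rewrite ler_pdivrMr//; apply: (@le_trans _ _ (4 * r * r)).
      by rewrite -mulrA rr; lra.
    by rewrite ler_pM2l// mulr_gt0.
  by lra.
have a12 : 0 < 2 * a1 by rewrite mulr_gt0.
pose Q := (Num.truncn (L%:R * (x + 1) / (2 * a1))).+1.
have Qp : 0 < Q%:R :> R by rewrite ltr0n.
have LQ : 0 <= (L%:R / Q%:R : R) <= 2 * a1 / (x + 1).
  rewrite divr_ge0//= ler_pdivrMr// mulrAC ler_pdivlMr//.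
  by rewrite [leRHS]mulrC -ler_pdivrMr// ltW// truncnS_gt.
exists m, k, L, Q; split; first by split=> //; rewrite -(ltr_nat R).
split; first by [].
split; first by [].
have -> : Q.+2 = (Num.truncn (L%:R * (x + 1) / (2 * a1)) + 3)%N by rewrite /Q addn3.
rewrite natrD [leRHS]mulrDl; apply: lerD; last by rewrite ler_peMr// exprn_ege1.
apply: (@le_trans _ _ (L%:R * (x + 1) / (2 * a1))).
  by rewrite truncn_le divr_ge0 ?mulr_ge0 ?(ltW a10) ?(ltW x'0).
rewrite ler_pdivrMr//.
have -> : 5 / a1 * x ^+ 2 * (2 * a1) = (5 * x) * (2 * x) by field; rewrite gt_eqF.
apply: ler_pM => //; first exact: ltW.
  by apply: (le_trans L5); rewrite ler_pM2l.
by rewrite mulrDl mul1r lerD2l.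
Qed.

Lemma main_term_shift (R : realType) (a1 c x s : R) : 0 < s <= 1 -> 1 <= x ->
  (x + 1) `^ s <= x `^ s + 1 /\
  a1 * (x + 1) + c * (x + 1) `^ s <= a1 * x + c * x `^ s + (a1 + `|c|).
Proof.
move=> s01 x1; have /andP[s0 s1] := s01; have x0 : 0 < x by apply: lt_le_trans x1.
have xs1 : (x + 1) `^ s <= x `^ s + 1.
  apply: (le_trans (powRD1_le s01 x0)); rewrite lerD2l.
  rewrite -[leRHS]mulr1; apply: ler_pM; rewrite ?powR_ge0 ?(ltW s0)//.
  by rewrite -[leRHS](powRr0 x) ler_powR// subr_le0.
have xs2 : x `^ s <= (x + 1) `^ s.
  by rewrite ge0_ler_powR ?nnegrE ?(ltW s0) ?(ltW x0) ?addr_ge0 ?(ltW x0)// lerDl.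
split=> //; have : c * (x + 1) `^ s - c * x `^ s <= `|c|.
  apply: (le_trans (ler_norm _)); rewrite -mulrBr normrM ler_piMr// ler_norml.
  by apply/andP; split; lra.
by rewrite mulrDr mulr1; lra.
Qed.

Lemma ln_le_monomial (R : realType) (C x y : R) (n : nat) : 0 < C -> 0 < x -> 0 < y ->
  y <= C * x ^+ n -> ln y <= ln C + n%:R * ln x.
Proof.
move=> C0 x0 y0 h; have xn : 0 < x ^+ n by rewrite exprn_gt0.
have -> : n%:R * ln x = ln (x ^+ n) by rewrite lnXn// mulr_natl.
by rewrite -lnM ?posrE// ler_ln ?posrE// mulr_gt0.
Qed.

Lemma lnp_shift_le (R : realType) (c1 a1 x z : R) : 0 < c1 -> 0 < a1 -> 0 < z -> 1 <= x ->
  lnp (z / (c1 * (x + 1) `^ (- a1))) <= (`|ln (z / c1)| + a1 * ln 2) + a1 * ln x.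
Proof.
move=> c10 a10 z0 x1; have x0 : 0 < x by apply: lt_le_trans x1.
have ln2p : 0 <= ln 2 :> R by rewrite ln_ge0// ler1n.
rewrite /lnp ge_max; apply/andP; split.
  by rewrite !addr_ge0 ?mulr_ge0 ?(ltW a10) ?(ln_ge0 x1).
have -> : z / (c1 * (x + 1) `^ (- a1)) = (z / c1) * (x + 1) `^ a1.
  by rewrite powRN; field; rewrite !gt_eqF ?powR_gt0 ?addr_gt0.
rewrite lnM ?posrE ?divr_gt0 ?powR_gt0 ?addr_gt0// ln_powR -addrA -mulrDr; apply: lerD.
  exact: ler_norm.
rewrite ler_pM2l// -lnM ?posrE// ler_ln ?posrE ?mulr_gt0 ?addr_gt0//.
by rewrite mulrDl mul1r lerD2l.
Qed.

Lemma near_sqrt_ln_le (R : realType) (K K' eta s : R) : 2^-1 < s -> 0 < eta ->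
  \forall x \near +oo, Num.sqrt x * (K + K' * ln x) <= eta * x `^ s.
Proof.
move=> s2 e0; have p0 : 0 < s - 2^-1 by rewrite subr_gt0.
have e2 : 0 < eta / 2 by rewrite divr_gt0.
near=> x.
have x0 : 0 < x by near: x; exact: nbhs_pinfty_gt.
have nB : K <= eta / 2 * x `^ (s - 2^-1) by near: x; exact: near_le_mul_powR.
have nC : K' * ln x <= eta / 2 * x `^ (s - 2^-1) by near: x; exact: near_ln_le_powR.
have <- : Num.sqrt x * x `^ (s - 2^-1) = x `^ s.
  rewrite -powR12_sqrt ?(ltW x0)// -powRD ?(lt0r_neq0 x0) ?implybT//.
  by congr (_ `^ _); ring.
rewrite mulrCA ler_pM2l ?sqrtr_gt0//; lra.
Unshelve. all: by end_near. Qed.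

(** The bookkeeping of [op_entropy_upper] over opaque variables: [A1] is the overhead of the blocks,
    [A2] the cost of the first block, [A3] is [2 / k] times the main sum [G], and [B] pays for the
    shift from [x + 1] to [x]. *)
Lemma upper_combination (R : realType) (r lx X A1 A2 A3 G M0 K1 K2 K3 a1 eta B : R) :
  A1 <= 5 * r * (K1 + 9 * lx) -> A2 <= 5 * r * (K2 + a1 * lx) -> A3 <= 2 * K3 * r ->
  G <= M0 + eta / 8 * X + B -> B <= eta / 8 * X ->
  r * ((5 * K1 + 5 * K2 + 2 * K3) + (45 + 5 * a1) * lx) <= eta / 4 * X -> 0 <= eta * X ->
  A1 + A2 + (G + A3) <= M0 + eta * X.
Proof. by move=> *; lra. Qed.

(** The existence of a cover is part of the conclusion because the lower bound needs it too, to
    exclude an infimum over the empty set. *)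
Lemma op_entropy_upper (R : realType) (V : completeNormedModType R) (ip : V -> V -> R)
    (T : {linear V -> V}) (f : nat -> V) (l : nat -> R) (c1 a1 c s : R) :
  diagonalized ip T f l -> 0 < c1 -> 0 < a1 -> subcritical c s ->
  log_asymptotics l c1 a1 c s ->
  forall eta, 0 < eta -> \forall x \near +oo,
    (exists s, covers (c1 * x `^ (- a1)) (closure (T @` unit_cball (V:=V))) s) /\
    op_entropy T (c1 * x `^ (- a1)) * ln 2 <= a1 * x + c / s * x `^ s + eta * x `^ s.
Proof.
move=> [hip hf hsa hc hT l0 lmono hker] c10 a10 hcs hl eta e0.
have s01 := subcritical_le1 hcs; have /andP[s0 s1] := s01.
have s2 : 2^-1 < s by case: hcs => [/andP[]//|[-> _]]; rewrite invf_lt1// ltr1n.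
have e8 : 0 < eta / 8 by rewrite divr_gt0.
have e4 : 0 < eta / 4 by rewrite divr_gt0.
have near_sum := near_pinfty_D1 (sum_lnp_quot_le l0 lmono c10 a10 hcs hl e8).
have ln2p : 0 < ln 2 :> R by rewrite ln_gt0// ltr1n.
(* The tolerance [a1 ln 2] on the logarithm of an eigenvalue is compensated by the factor 2 in
   [2 (x + 1) <= L k]. *)
have [N hN] := log_asymptotics_first hcs hl (mulr_gt0 a10 ln2p).
have [C C0 hcov] := operator_cover_ln hip hf hsa hc hT l0 lmono hker.
have [K1 K1E] : exists K1, K1 = Num.max 0 (ln (5 / a1 + 3) + ln (C * 3 ^+ 7)) by eexists.
have K10 : 0 <= K1 by rewrite K1E le_max lexx.
have K1le : ln (5 / a1 + 3) + ln (C * 3 ^+ 7) <= K1 by rewrite K1E le_max lexx orbT.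
have [K2 K2E] : exists K2, K2 = `|ln (l 0%N / c1)| + a1 * ln 2 by eexists.
have [B BE] : exists B, B = a1 + `|c / s| + eta / 8 by eexists.
have acs : 0 < a1 + `|c / s| by rewrite ltr_wpDr.
have B0 : 0 < B by rewrite BE addr_gt0.
have [K3 K3E] : exists K3, K3 = 2 * (a1 + `|c / s| + eta) by eexists.
have K30 : 0 < K3 by rewrite K3E; apply: mulr_gt0 => //; exact: addr_gt0.
have near_err := near_sqrt_ln_le (5 * K1 + 5 * K2 + 2 * K3) (45 + 5 * a1) s2 e4.
near=> x.
have x1 : 1 <= x by near: x; exact: nbhs_pinfty_ge.
have x0 : 0 < x by apply: lt_le_trans x1.
have xN : N%:R <= x by near: x; exact: nbhs_pinfty_ge.
have nA : B <= eta / 8 * x `^ s by near: x; exact: near_le_mul_powR.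
have hr : Num.sqrt x * ((5 * K1 + 5 * K2 + 2 * K3) + (45 + 5 * a1) * ln x) <= eta / 4 * x `^ s.
  by near: x.
have hsum : forall D : nat, \sum_(i < D) lnp (l i / (c1 * (x + 1) `^ (- a1))) <=
    a1 * (x + 1) + c / s * (x + 1) `^ s + eta / 8 * (x + 1) `^ s by near: x.
have [m [k [L [Q [[mk k0 Q0 m3] [[kr k2 L5 Lk] [LQ Q2]]]]]]] := cover_parameters a10 x1.
have x'0 : 0 < x + 1 by rewrite addr_gt0.
pose rho := c1 * (x + 1) `^ (- a1).
have rho0 : 0 < rho by rewrite mulr_gt0// powR_gt0.
have xLk : x + 1 <= (L * k)%:R by apply: le_trans Lk; rewrite ler_peMl ?(ltW x'0)// ler1n.
have hL : l (L * k)%N <= rho.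
  have NLk : (N <= L * k)%N.
    rewrite -(ler_nat R); apply: (le_trans xN); apply: le_trans xLk.
    by rewrite lerDl.
  have := hN _ NLk; rewrite ler_norml => /andP[_ h].
  rewrite -ler_ln ?posrE// /rho lnM ?posrE ?powR_gt0// ln_powR.
  have : a1 * (ln 2 + ln (x + 1)) <= a1 * ln (L * k).+1%:R.
    rewrite ler_pM2l// -lnM ?posrE// ler_ln ?posrE ?mulr_gt0//.
    by apply: (le_trans Lk); rewrite ler_nat.
  move: h; clear; rewrite mulrDr; lra.
have [sq [sq0 sqc sqln]] := hcov m k Q L rho mk k0 Q0 rho0 hL.
have hcov' : covers (c1 * x `^ (- a1)) (closure (T @` unit_cball (V:=V))) sq.
  by apply: covers_le sqc; exact: radius_shift.
split; first by exists sq.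
have ep : 0 < c1 * x `^ (- a1) by rewrite mulr_gt0// powR_gt0.
apply: (le_trans (op_entropy_le hip hf hT l0 ep hcov')).
apply: (le_trans sqln).
have lnx0 : 0 <= ln x by exact: ln_ge0.
have r0 : 0 < Num.sqrt x by rewrite sqrtr_gt0.
have rx : Num.sqrt x <= x.
  rewrite -[leRHS](sqr_sqrtr (ltW x0)) expr2 ler_peMr ?(ltW r0)//.
  by rewrite -[leLHS]sqrtr1 ler_sqrt ?(ltW x0).
have lnQ : ln Q.+2%:R <= ln (5 / a1 + 3) + 2 * ln x.
  by apply: ln_le_monomial => //; rewrite addr_gt0// divr_gt0.
have lnm : ln (C * m.+1%:R ^+ 7) <= ln (C * 3 ^+ 7) + 7 * ln x.
  apply: ln_le_monomial => //; rewrite ?mulr_gt0 ?exprn_gt0//.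
  rewrite -[leRHS]mulrA ler_pM2l// -exprMn.
  by rewrite lerXn2r ?nnegrE ?mulr_ge0 ?(ltW x0)// (le_trans m3)// ler_pM2l.
(* The coefficient 9 adds the exponent 2 in the bound on [Q + 2] and the exponent 7 of [m + 1]. *)
have hL1 : L%:R * (ln Q.+2%:R + ln (C * m.+1%:R ^+ 7)) <=
    5 * Num.sqrt x * (K1 + 9 * ln x).
  apply: (@le_trans _ _ (L%:R * (K1 + 9 * ln x))).
    apply: ler_wpM2l => //; move: lnQ lnm K1le; clear; lra.
  by apply: ler_wpM2r => //; rewrite addr_ge0// mulr_ge0.
have hk1 : k.+2%:R * lnp (l 0%N / rho) <= 5 * Num.sqrt x * (K2 + a1 * ln x).
  apply: ler_pM => //; first exact: lnp_ge0.
  by rewrite K2E; exact: lnp_shift_le.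
have [xs1 Mshift] := main_term_shift a1 (c / s) s01 x1.
have hG : \sum_(i < L * k) lnp (l i / rho) <= a1 * x + c / s * x `^ s + eta / 8 * x `^ s + B.
  apply: (le_trans (hsum _)); rewrite BE.
  have := ler_wpM2l (ltW e8) xs1; move: Mshift; clear; lra.
set G := \sum_(i < L * k) lnp (l i / rho) in hG *.
(* In the term divided by [k], only the order of magnitude of the main sum matters. *)
have hG2 : G <= K3 * x.
  apply: (le_trans hG).
  have xsx : x `^ s <= x by exact: ler1_powR.
  have h1 : c / s * x `^ s <= `|c / s| * x.
    apply: (@le_trans _ _ (`|c / s| * x `^ s)); last by rewrite ler_wpM2l.
    by rewrite ler_wpM2r ?powR_ge0// ler_norm.
  have h2 : eta / 8 * x `^ s <= eta / 8 * x by rewrite ler_pM2l.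
  have h3 : B <= B * x by rewrite ler_peMr// ltW.
  have h4 := mulr_ge0 (ltW e0) (ltW x0).
  by move: h1 h2 h3 h4; rewrite K3E BE; clear; lra.
have kp : 0 < k%:R :> R by rewrite ltr0n.
have hGk : 2 / k%:R * G <= 2 * K3 * Num.sqrt x.
  apply: (@le_trans _ _ (2 / k%:R * (K3 * x))).
    by apply: ler_wpM2l => //; rewrite divr_ge0.
  rewrite mulrAC ler_pdivrMr//.
  have -> : 2 * (K3 * x) = 2 * K3 * Num.sqrt x * Num.sqrt x.
    by rewrite -mulrA -expr2 sqr_sqrtr ?(ltW x0)// mulrA.
  apply: ler_wpM2l => //; exact: mulr_ge0 (mulr_ge0 (ler0n _ 2) (ltW K30)) (ltW r0).
rewrite [(1 + _) * _]mulrDl mul1r.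
by apply: upper_combination hL1 hk1 hGk hG nA hr _; rewrite mulr_ge0 ?powR_ge0 ?(ltW e0).
Unshelve. all: by end_near. Qed.

Lemma op_entropy_lower (R : realType) (V : completeNormedModType R) (ip : V -> V -> R)
    (T : {linear V -> V}) (f : nat -> V) (l : nat -> R) (c1 a1 c s : R) :
  diagonalized ip T f l -> 0 < c1 -> 0 < a1 -> subcritical c s ->
  log_asymptotics l c1 a1 c s ->
  forall eta, 0 < eta -> \forall x \near +oo,
    a1 * x + c / s * x `^ s - eta * x `^ s <= op_entropy T (c1 * x `^ (- a1)) * ln 2.
Proof.
move=> hd c10 a10 hcs hl eta e0.
have near_up := op_entropy_upper hd c10 a10 hcs hl e0.
case: hd => hip hf hsa hc hT l0 lmono hker.
have near_sum := sum_ln_quot_ge l0 c10 a10 (subcritical_le1 hcs) hl e0.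
near=> x.
have x0 : 0 < x by near: x; exact: nbhs_pinfty_gt.
have [[sq hsq] _] : (exists s, covers (c1 * x `^ (- a1)) (closure (T @` unit_cball (V:=V))) s) /\
    op_entropy T (c1 * x `^ (- a1)) * ln 2 <= a1 * x + c / s * x `^ s + eta * x `^ s.
  by near: x.
have hs : a1 * x + c / s * x `^ s - eta * x `^ s <=
    \sum_(i < Num.truncn x) ln (l i / (c1 * x `^ (- a1))) by near: x.
apply: (le_trans hs); apply: (op_entropy_ge _ hip hf hT l0 _ hsq).
by rewrite mulr_gt0// powR_gt0.
Unshelve. all: by end_near. Qed.

Lemma op_entropy_approx (R : realType) (V : completeNormedModType R) (ip : V -> V -> R)
    (T : {linear V -> V}) (f : nat -> V) (l : nat -> R) (c1 a1 c s : R) :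
  diagonalized ip T f l -> 0 < c1 -> 0 < a1 -> subcritical c s ->
  log_asymptotics l c1 a1 c s ->
  forall eta, 0 < eta -> \forall x \near +oo,
    `|op_entropy T (c1 * x `^ (- a1)) * ln 2 - (a1 * x + c / s * x `^ s)| <= eta * x `^ s.
Proof.
move=> hd c10 a10 hcs hl eta e0.
have := op_entropy_upper hd c10 a10 hcs hl e0; have := op_entropy_lower hd c10 a10 hcs hl e0.
apply: filterS2 => x h1 [_ h2]; move: h1 h2; clear => h1 h2.
by rewrite ler_norml; apply/andP; split; lra.
Qed.

Lemma exists_covers (R : realType) (V : completeNormedModType R) (ip : V -> V -> R)
    (T : {linear V -> V}) (f : nat -> V) (l : nat -> R) (c1 a1 c s : R) :
  diagonalized ip T f l -> 0 < c1 -> 0 < a1 -> subcritical c s ->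
  log_asymptotics l c1 a1 c s ->
  forall eps, 0 < eps -> exists s, covers eps (closure (T @` unit_cball (V:=V))) s.
Proof.
move=> hd c10 a10 hcs hl eps e0.
have [M [_ hM]] := op_entropy_upper hd c10 a10 hcs hl ltr01.
pose B := (c1 / eps) `^ a1^-1.
pose x := `|M| + 1 + B.
have B0 : 0 < B by rewrite powR_gt0// divr_gt0.
have Mx : M < x.
  by apply: (@le_lt_trans _ _ `|M|); rewrite ?ler_norm// /x -addrA ltrDl addr_gt0.
have Bx : B <= x by rewrite /x lerDr addr_ge0.
have x0 : 0 < x by apply: lt_le_trans Bx.
have [[sq hsq] _] := hM x Mx; exists sq; apply: covers_le hsq.
rewrite powRN ler_pdivrMr ?powR_gt0// mulrC -ler_pdivrMr//.
have -> : c1 / eps = B `^ a1.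
  by rewrite /B -powRrM mulVf ?gt_eqF// powRr1// divr_ge0 ?(ltW c10) ?(ltW e0).
by rewrite ge0_ler_powR ?nnegrE ?(ltW a10) ?(ltW B0) ?(ltW x0).
Qed.

Lemma op_entropy_mono (R : realType) (V : completeNormedModType R) (ip : V -> V -> R)
    (T : {linear V -> V}) (f : nat -> V) (l : nat -> R) (eps eps' : R) :
  diagonalized ip T f l ->
  (exists s, covers eps (closure (T @` unit_cball (V:=V))) s) ->
  0 < eps -> eps <= eps' -> op_entropy T eps' <= op_entropy T eps.
Proof.
move=> [hip hf hsa hc hT l0 lmono hker] [sq hsq] e0 ee.
have ln2p : 0 < ln 2 :> R by rewrite ln_gt0// ltr1n.
rewrite /op_entropy /metric_entropy ler_pM2r ?invr_gt0//.
have e0' : 0 < eps' by apply: lt_le_trans ee.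
have pos e (t : seq V) : 0 < e -> covers e (closure (T @` unit_cball (V:=V))) t ->
    0 < covering_number e (closure (T @` unit_cball (V:=V))).
  move=> e_gt0 ht; have := covering_number_ge 0 hip hf hT l0 e_gt0 ht.
  by rewrite big_ord0; exact: lt_le_trans.
rewrite ler_ln ?posrE ?(pos _ _ e0 hsq) ?(pos _ _ e0' (covers_le ee hsq))//.
apply: lb_le_inf; first by exists (size sq)%:R, sq.
move=> _ [t ht <-]; apply: ge_inf; last by exists t => //; exact: covers_le ht.
by exists 0 => _ [u _ <-]; exact: ler0n.
Qed.

Lemma metric_entropy_asymptotics (R : realType) (V : completeNormedModType R) (ip : V -> V -> R)
    (T : {linear V -> V}) (f : nat -> V) (l : nat -> R) (c1 c2 a1 a2 : R) :
  diagonalized ip T f l -> 0 < c1 -> 0 < a1 -> subcritical (c2 / c1) (a1 - a2 + 1) ->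
  log_asymptotics l c1 a1 (c2 / c1) (a1 - a2 + 1) ->
  forall eta, 0 < eta -> exists2 delta : R, 0 < delta & forall eps : R,
     0 < eps -> eps < delta ->
     `|op_entropy T eps
        - (a1 * c1 `^ (a1^-1) / ln 2 * eps `^ (- a1^-1)
           + c2 * c1 `^ ((1 - a2) / a1) / (ln 2 * (a1 - a2 + 1))
             * eps `^ (- ((a1 - a2 + 1) / a1)))|
       <= eta * eps `^ (- ((a1 - a2 + 1) / a1)).
Proof.
move=> hd c10 a10 hcs hl eta e0.
have ln2p : 0 < ln 2 :> R by rewrite ln_gt0// ltr1n.
have ca : 0 < c1 `^ ((a1 - a2 + 1) / a1) by rewrite powR_gt0.
(* The rescaled tolerance undoes the factor [c1^(s / a1)] contained in [x^s] and the division by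
   [ln 2]. *)
have e0' : 0 < eta * ln 2 / c1 `^ ((a1 - a2 + 1) / a1) by rewrite divr_gt0// mulr_gt0.
have [M [_ hM]] := op_entropy_approx hd c10 a10 hcs hl e0'.
have M1 : 0 < `|M| + 1 by rewrite ltr_wpDl.
have s0 : 0 < a1 - a2 + 1 by case/andP: (subcritical_le1 hcs).
exists (c1 / (`|M| + 1) `^ a1); first by rewrite divr_gt0// powR_gt0.
move=> eps eps0; rewrite ltr_pdivlMr ?powR_gt0// mulrC -ltr_pdivlMr// => hlt.
set x := (c1 / eps) `^ a1^-1.
have q0 : 0 < c1 / eps by rewrite divr_gt0.
have x0 : 0 < x by rewrite powR_gt0.
have xa : x `^ a1 = c1 / eps by rewrite /x -powRrM mulVf ?gt_eqF// powRr1 ?ltW.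
have Mx : M < x.
  rewrite ltNge; apply/negP => xM; move: hlt; rewrite -xa; apply/negP; rewrite -leNgt.
  rewrite ge0_ler_powR ?nnegrE ?(ltW a10) ?(ltW x0) ?(ltW M1)//.
  by apply: (le_trans xM); apply: (le_trans (ler_norm _)); rewrite lerDl.
have epsE : c1 * x `^ (- a1) = eps by rewrite powRN xa invf_div mulrCA mulfV ?mulr1// gt_eqF.
have xp p : x `^ p = c1 `^ (p / a1) * eps `^ (- (p / a1)).
  have -> : p / a1 = a1^-1 * p by rewrite mulrC.
  by rewrite /x -powRrM powRM ?(ltW c10) ?invr_ge0 ?(ltW eps0)// -[eps^-1]powR_inv1 ?(ltW eps0)// -powRrM mulN1r.
have := hM x Mx; rewrite epsE.
have x1E : x = c1 `^ a1^-1 * eps `^ (- a1^-1) by rewrite -[LHS]powRr1 ?(ltW x0)// xp div1r.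
rewrite (xp (a1 - a2 + 1)) {1}x1E.
have caE : c1 `^ ((a1 - a2 + 1) / a1) = c1 * c1 `^ ((1 - a2) / a1).
  have -> : (a1 - a2 + 1) / a1 = 1 + (1 - a2) / a1 by field; rewrite gt_eqF.
  by rewrite powRD ?(lt0r_neq0 c10) ?implybT// powRr1 ?(ltW c10).
set E1 := eps `^ (- a1^-1); set E2 := eps `^ (- ((a1 - a2 + 1) / a1)).
set A := c1 `^ ((a1 - a2 + 1) / a1) in ca caE *; set A' := c1 `^ ((1 - a2) / a1) in caE *.
set A1 := c1 `^ a1^-1; set H := op_entropy T eps.
have A'0 : 0 < A' by rewrite powR_gt0.
have s0' := lt0r_neq0 s0.
move=> h; rewrite -(ler_pM2r ln2p) -[X in _ * X <= _](gtr0_norm ln2p) -normrM.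
have -> : (H - (a1 * A1 / ln 2 * E1 + c2 * A' / (ln 2 * (a1 - a2 + 1)) * E2)) * ln 2 =
   H * ln 2 - (a1 * (A1 * E1) + c2 / c1 / (a1 - a2 + 1) * (A * E2)).
  by rewrite caE; field; rewrite s0' !gt_eqF.
apply: (le_trans h); rewrite le_eqVlt; apply/orP; left; apply/eqP.
by field; rewrite gt_eqF.
Qed.

(** * From the entropy to the entropy numbers *)

Lemma powRN1B_ge (R : realType) (a t : R) : 0 < a -> t < 1 -> 1 + a * t <= (1 - t) `^ (- a).
Proof.
move=> a0 t1; have p : 0 < 1 - t by rewrite subr_gt0.
rewrite /powR gt_eqF//; apply: le_trans (expR_ge1Dx _); rewrite lerD2l mulNr lerNr -mulrN.
by rewrite ler_pM2l//; apply: le_ln1Dx; rewrite ltrN2.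
Qed.

(** Two second-order bounds are composed: [- ln (1 - t) <= t + 2 t^2] contributes [2 a], and
    [expR z <= 1 + z + 2 z^2] for [z <= 1/2] contributes [8 a^2]. *)
Lemma powRN1B_le (R : realType) (a t : R) : 0 < a -> `|t| <= 2^-1 -> 2 * a * `|t| <= 2^-1 ->
  (1 - t) `^ (- a) <= 1 + a * t + (2 * a + 8 * a ^+ 2) * t ^+ 2.
Proof.
move=> a0 t2 at2; have /andP[tl tu] : - 2^-1 <= t <= 2^-1 by rewrite -ler_norml.
have p : 0 < 1 - t by lra.
have h1 : - ln (1 - t) <= t + 2 * t ^+ 2.
  have := ln_ge_1Bdiv p.
  have : t + 2 * t ^+ 2 - ((1 - t)^-1 - 1) = t ^+ 2 * (1 - 2 * t) / (1 - t).
    by field; rewrite gt_eqF.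
  have : 0 <= t ^+ 2 * (1 - 2 * t) / (1 - t).
    by rewrite divr_ge0 ?(ltW p)// mulr_ge0 ?sqr_ge0//; lra.
  by move: (t ^+ 2 * (1 - 2 * t) / (1 - t)) => X; lra.
set z := a * (t + 2 * t ^+ 2).
have tt : t ^+ 2 <= `|t| / 2.
  by rewrite -[t ^+ 2]real_normK ?num_real// expr2; apply: ler_wpM2l.
have zt : `|z| <= 2 * a * `|t|.
  rewrite /z normrM (gtr0_norm a0) [2 * a]mulrC -mulrA; apply: ler_wpM2l; first exact: ltW.
  apply: (le_trans (ler_normD _ _)).
  rewrite [`|2 * _|]ger0_norm; first by lra.
  by apply: mulr_ge0 => //; exact: sqr_ge0.
have z2 : z <= 2^-1 by apply: (le_trans (ler_norm _)); exact: le_trans at2.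
have zz : z ^+ 2 <= 4 * a ^+ 2 * t ^+ 2.
  rewrite -[z ^+ 2]real_normK ?num_real// -[t ^+ 2]real_normK ?num_real//.
  have -> : 4 * a ^+ 2 * `|t| ^+ 2 = (2 * a * `|t|) ^+ 2 by ring.
  by rewrite lerXn2r ?nnegrE// mulr_ge0// mulr_ge0// ltW.
rewrite /powR gt_eqF// mulNr.
apply: (@le_trans _ _ (expR z)).
  by rewrite ler_expR -mulrN ler_pM2l.
apply: (@le_trans _ _ (1 + z + 2 * z ^+ 2)).
  have z1 : 0 < 1 - z by lra.
  rewrite -[z]opprK expRN opprK; apply: (@le_trans _ _ (1 - z)^-1).
    by rewrite lef_pV2 ?posrE ?expR_gt0//; exact: expR_ge1Dx.
  rewrite -div1r ler_pdivrMr//.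
  have -> : (1 + z + 2 * z ^+ 2) * (1 - z) = 1 + z ^+ 2 * (1 - 2 * z) by ring.
  by rewrite lerDl mulr_ge0 ?sqr_ge0//; lra.
have zE : z = a * t + 2 * a * t ^+ 2 by rewrite /z; ring.
have h : z + 2 * z ^+ 2 <= z + 2 * (4 * a ^+ 2 * t ^+ 2) by rewrite lerD2l ler_pM2l.
rewrite -addrA -[leRHS]addrA lerD2l; apply: (le_trans h).
by rewrite zE le_eqVlt; apply/orP; left; apply/eqP; ring.
Qed.

Lemma powR1B_close (R : realType) (t s : R) : 0 < s <= 1 -> `|t| <= 2^-1 ->
  `|(1 - t) `^ s - 1| <= `|t|.
Proof.
move=> s01; have /andP[s0 s1] := s01; rewrite ler_norml => /andP[tl tu].
have p : 0 < 1 - t by lra.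
have h := powR_le_affine (ltW p) s01.
case: (leP 0 t) => t0.
  rewrite (ger0_norm t0) ler_norml.
  have h2 : 1 - t <= (1 - t) `^ s by apply: ger1_powR => //; rewrite p; lra.
  have h3 : (1 - t) `^ s <= 1.
    rewrite -[leRHS](powRr0 (1 - t)); apply: ger_powR; last exact: ltW.
    by rewrite p; lra.
  by apply/andP; split; lra.
rewrite (ltr0_norm t0).
have h2 : 1 <= (1 - t) `^ s.
  rewrite -[leLHS](powRr0 (1 - t)); apply: ler_powR; [lra | exact: ltW].
have h3 : s * - t <= 1 * - t by apply: ler_wpM2r => //; lra.
by rewrite ler_norml; apply/andP; split; lra.
Qed.

Lemma subcritical_mul (R : realType) (c s k : R) : subcritical c s -> subcritical (c * k) s.
Proof. by case=> [h|[-> ->]]; [left | right; rewrite mul0r]. Qed.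

Lemma near_pinfty_half (R : realType) (P : R -> Prop) :
  (\forall x \near +oo, P x) -> \forall y \near +oo, forall x, y / 2 <= x -> P x.
Proof.
move=> [M [Mr hM]]; exists (2 * M); split; first by rewrite num_real.
by move=> y My x yx; apply: hM; apply: lt_le_trans yx; rewrite ltr_pdivlMr// mulrC.
Qed.

(* The substitution [x = y (1 - t)], [t = b y^(s-1)], inverts the expansion
   [y = x + c / (a1 s) x^s + o(x^s)]. *)
Lemma inversion_estimates (R : realType) (a1 c s b eta : R) :
  0 < a1 -> subcritical c s -> 0 < eta -> `|b - c / (a1 * s)| <= 4^-1 ->
  \forall y \near +oo, let t := b * y `^ (s - 1) in
    [/\ `|t| <= 2^-1, `|t| <= 2 * `|b - c / (a1 * s)| + eta,
        y / 2 <= y * (1 - t), y * (1 - t) = y - b * y `^ s &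
        `|c / s * ((y * (1 - t)) `^ s - y `^ s)| <= eta * y `^ s].
Proof.
move=> a10 hcs e0 hb; have s01 := subcritical_le1 hcs; have /andP[s0 s1] := s01.
have e4 : 0 < Num.min eta 4^-1 :> R by rewrite lt_min e0 invr_gt0 ltr0n.
have n1 := subcritical_small (subcritical_mul (a1 * s)^-1 hcs) e4.
have n2 := subcritical_small (subcritical_mul (s^-1 * b) hcs) e0.
near=> y; set t := b * y `^ (s - 1).
have y1 : 1 <= y by near: y; exact: nbhs_pinfty_ge.
have y0 : 0 < y by apply: lt_le_trans y1.
have h1 : `|c * (a1 * s)^-1| * y `^ (s - 1) <= Num.min eta 4^-1 by near: y.
have h2 : `|c * (s^-1 * b)| * y `^ (s - 1) <= eta by near: y.
have D0 : 0 < y `^ (s - 1) by rewrite powR_gt0.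
have D1 : y `^ (s - 1) <= 1 by rewrite -[leRHS](powRr0 y) ler_powR// subr_le0.
have tb : `|t| <= `|b - c / (a1 * s)| + Num.min eta 4^-1.
  have -> : t = (b - c / (a1 * s)) * y `^ (s - 1) + c / (a1 * s) * y `^ (s - 1).
    by rewrite /t mulrBl subrK.
  apply: (le_trans (ler_normD _ _)); rewrite !normrM (gtr0_norm D0); apply: lerD.
    by rewrite ler_piMr.
  by rewrite -normrM.
have m1 : Num.min eta 4^-1 <= eta by rewrite ge_min lexx.
have m2 : Num.min eta 4^-1 <= 4^-1 by rewrite ge_min lexx orbT.
have t2 : `|t| <= 2^-1.
  have q : 4^-1 + 4^-1 = 2^-1 :> R by field.
  by rewrite -q (le_trans tb)// lerD.
have /andP[tl tu] : - 2^-1 <= t <= 2^-1 by rewrite -ler_norml.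
have yE : y `^ s = y * y `^ (s - 1) by rewrite powRB1E// mulrCA mulfV ?mulr1// gt_eqF.
have p : 0 < 1 - t by move: tu; clear; lra.
split=> //.
- by have := normr_ge0 (b - c / (a1 * s)); move: tb m1; clear; lra.
- by rewrite ler_pM2l//; move: tu; clear; lra.
- by rewrite yE /t; ring.
rewrite powRM ?(ltW y0) ?(ltW p)// -[X in _ - X]mulr1 -mulrBr mulrCA normrM.
rewrite (gtr0_norm (powR_gt0 _ y0)) mulrC ler_pM2r ?powR_gt0// normrM.
apply: (le_trans (ler_wpM2l (normr_ge0 _) (powR1B_close s01 t2))).
have -> : `|t| = `|b| * y `^ (s - 1) by rewrite /t normrM (gtr0_norm D0).
rewrite mulrA -normrM.
by have -> : c / s * b = c * (s^-1 * b) by rewrite mulrA.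
Unshelve. all: by end_near. Qed.

(** Detuning [b] by [theta] from the exact value [c / (a1 s)] moves the entropy, times [ln 2], by
    [a1 theta y^s], while the error is at most two thirds of that; so the side of [a1 y] on which it
    falls is known. *)
Lemma entropy_at_shifted_radius (R : realType) (V : completeNormedModType R) (ip : V -> V -> R)
    (T : {linear V -> V}) (f : nat -> V) (l : nat -> R) (c1 a1 c s b theta : R) :
  diagonalized ip T f l -> 0 < c1 -> 0 < a1 -> subcritical c s ->
  log_asymptotics l c1 a1 c s ->
  0 < theta -> theta <= 4^-1 -> `|b - c / (a1 * s)| = theta ->
  \forall y \near +oo, let t := b * y `^ (s - 1) in
    [/\ `|t| <= 2^-1, `|t| <= 3 * theta &
      `|op_entropy T (c1 * (y `^ (- a1) * (1 - t) `^ (- a1))) * ln 2 -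
         (a1 * y - a1 * (b - c / (a1 * s)) * y `^ s)| <= 2 / 3 * (a1 * theta * y `^ s)].
Proof.
move=> hd c10 a10 hcs hl th0 th4 hb.
have s01 := subcritical_le1 hcs; have /andP[s0 s1] := s01.
have at0 : 0 < a1 * theta by rewrite mulr_gt0.
(* The error is shared as [1/3 + 2/6 = 2/3]: [e] pays for replacing [x^s] by [y^s], and the entropy
   estimate costs a sixth of [x^s <= 2 y^s]. *)
pose e := Num.min theta (a1 * theta / 3).
have e0 : 0 < e by rewrite lt_min th0 divr_gt0.
have e1 : e <= theta by rewrite /e ge_min lexx.
have e3 : e <= a1 * theta / 3 by rewrite /e ge_min lexx orbT.
have hb' : `|b - c / (a1 * s)| <= 4^-1 by rewrite hb.
have n1 := inversion_estimates a10 hcs e0 hb'.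
have e6 : 0 < a1 * theta / 6 by rewrite divr_gt0.
have n2 := near_pinfty_half (op_entropy_approx hd c10 a10 hcs hl e6).
near=> y; set t := b * y `^ (s - 1).
have y0 : 0 < y by near: y; exact: nbhs_pinfty_gt.
have [t2 t3 yx xE xs] : [/\ `|t| <= 2^-1, `|t| <= 2 * `|b - c / (a1 * s)| + e,
        y / 2 <= y * (1 - t), y * (1 - t) = y - b * y `^ s &
        `|c / s * ((y * (1 - t)) `^ s - y `^ s)| <= e * y `^ s] by rewrite /t; near: y; exact: n1.
have h : forall x, y / 2 <= x ->
  `|op_entropy T (c1 * x `^ (- a1)) * ln 2 - (a1 * x + c / s * x `^ s)| <=
  a1 * theta / 6 * x `^ s by near: y; exact: n2.
have {}h := h _ yx.
have /andP[tl tu] : - 2^-1 <= t <= 2^-1 by rewrite -ler_norml.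
have p : 0 < 1 - t by move: tu; clear; lra.
have ys : 0 < y `^ s by rewrite powR_gt0.
split=> //.
  by apply: (le_trans t3); rewrite hb; move: e1; clear; lra.
have -> : y `^ (- a1) * (1 - t) `^ (- a1) = (y * (1 - t)) `^ (- a1).
  by rewrite powRM ?(ltW y0) ?(ltW p).
move: h; set H := op_entropy T _ * ln 2.
have xs2 : (y * (1 - t)) `^ s <= 2 * y `^ s.
  rewrite powRM ?(ltW y0) ?(ltW p)// mulrC ler_pM2r//.
  have := powR1B_close s01 t2; rewrite ler_norml => /andP[_].
  by move: t2; clear; lra.
have xE' : a1 * (y * (1 - t)) = a1 * y - a1 * b * y `^ s by rewrite xE; ring.
have bE : a1 * (b - c / (a1 * s)) * y `^ s = a1 * b * y `^ s - c / s * y `^ s.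
  by field; rewrite !gt_eqF.
rewrite bE xE'.
move: xs; rewrite mulrBr !ler_norml => /andP[xs3 xs4] /andP[h1 h2].
have e3' : e * y `^ s <= a1 * theta / 3 * y `^ s by rewrite ler_pM2r.
have e6' := ler_wpM2l (ltW e6) xs2.
move: xs3 xs4 h1 h2 e3' e6'; clear.
move: (c / s * (y * (1 - t)) `^ s) (c / s * y `^ s) (a1 * b * y `^ s) => A1 A2 A3.
move: (y * (1 - t)) => x; move: (x `^ s) (y `^ s) (a1 * theta) => X Y P.
by move=> *; apply/andP; split; lra.
Unshelve. all: by end_near. Qed.

Lemma entropy_number_between (R : realType) (V : completeNormedModType R) (ip : V -> V -> R)
    (T : {linear V -> V}) (f : nat -> V) (l : nat -> R) (c1 a1 c s e1 e2 : R) (m : nat) :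
  diagonalized ip T f l -> 0 < c1 -> 0 < a1 -> subcritical c s ->
  log_asymptotics l c1 a1 c s -> 0 < e2 ->
  m%:R < op_entropy T e1 -> op_entropy T e2 <= m%:R ->
  e1 <= entropy_number T m <= e2.
Proof.
move=> hd c10 a10 hcs hl e20 h1 h2; apply/andP; split.
  apply: lb_le_inf; first by exists e2.
  move=> e [e0 he]; rewrite leNgt; apply/negP => ee.
  have := op_entropy_mono hd (exists_covers hd c10 a10 hcs hl e0) e0 (ltW ee).
  by move=> h; have := lt_le_trans h1 (le_trans h he); rewrite ltxx.
apply: ge_inf; last by split.
by exists 0 => e [/ltW].
Qed.

(** The radii with [b = c0 + th] and [b = c0 - th] have entropy below and above [m], so they enclose
    the entropy number; expanding [(1 - t)^(-a1)] brings both within the tolerance of the same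
    value. *)
Lemma entropy_number_approx (R : realType) (V : completeNormedModType R) (ip : V -> V -> R)
    (T : {linear V -> V}) (f : nat -> V) (l : nat -> R) (c1 a1 c s : R) :
  diagonalized ip T f l -> 0 < c1 -> 0 < a1 -> subcritical c s ->
  log_asymptotics l c1 a1 c s ->
  forall eta, 0 < eta -> \forall y \near +oo, forall m : nat, m%:R * ln 2 = a1 * y ->
    `|entropy_number T m - y `^ (- a1) * (c1 + c * c1 / s * y `^ (s - 1))| <=
      eta * (y `^ (- a1) * y `^ (s - 1)).
Proof.
move=> hd c10 a10 hcs hl eta eta0.
have s01 := subcritical_le1 hcs; have /andP[s0 s1] := s01.
have ln2p : 0 < ln 2 :> R by rewrite ln_gt0// ltr1n.
pose c0 := c / (a1 * s).
pose K := 2 * a1 + 8 * a1 ^+ 2.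
have K0 : 0 < K by rewrite addr_gt0 ?mulr_gt0 ?exprn_gt0.
pose B := `|c0| + 1; have B0 : 0 < B by rewrite ltr_wpDl.
have P0 : 0 < a1 + K * 3 * B by rewrite addr_gt0// !mulr_gt0.
(* The three bounds serve in turn for [entropy_at_shifted_radius], for [2 a1 |t| <= 1/2] when
   [|t| <= 3 th], and for the total error [c1 (a1 + 3 K B) th], where [K] controls the quadratic
   term and [B] bounds [|b|]. *)
pose th := Num.min 4^-1 (Num.min (12 * a1)^-1 (eta / (c1 * (a1 + K * 3 * B)))).
have th0 : 0 < th.
  by rewrite !lt_min !invr_gt0 ltr0n (mulr_gt0 _ a10)//= divr_gt0// mulr_gt0.
have th4 : th <= 4^-1 by rewrite /th ge_min lexx.
have tha : th <= (12 * a1)^-1 by rewrite /th !ge_min lexx !orbT.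
have the : c1 * (a1 + K * 3 * B) * th <= eta.
  by rewrite mulrC -ler_pdivlMr ?mulr_gt0// /th !ge_min lexx !orbT.
clearbody th.
have hb1 : `|c0 + th - c / (a1 * s)| = th.
  by rewrite -/c0 (_ : c0 + th - c0 = th) ?gtr0_norm//; ring.
have hb2 : `|c0 - th - c / (a1 * s)| = th.
  by rewrite -/c0 (_ : c0 - th - c0 = - th) ?normrN ?gtr0_norm//; ring.
have n1 := entropy_at_shifted_radius hd c10 a10 hcs hl th0 th4 hb1.
have n2 := entropy_at_shifted_radius hd c10 a10 hcs hl th0 th4 hb2.
near=> y => m hm.
have y0 : 0 < y by near: y; exact: nbhs_pinfty_gt.
have ys : 0 < y `^ s by rewrite powR_gt0.
have ya : 0 < y `^ (- a1) by rewrite powR_gt0.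
have D0 : 0 < y `^ (s - 1) by rewrite powR_gt0.
have aty : 0 < a1 * th * y `^ s by rewrite !mulr_gt0.
pose t1 := (c0 + th) * y `^ (s - 1); pose t2 := (c0 - th) * y `^ (s - 1).
have [t1a t1b H1] : [/\ `|t1| <= 2^-1, `|t1| <= 3 * th &
      `|op_entropy T (c1 * (y `^ (- a1) * (1 - t1) `^ (- a1))) * ln 2 -
         (a1 * y - a1 * (c0 + th - c / (a1 * s)) * y `^ s)| <= 2 / 3 * (a1 * th * y `^ s)].
  by rewrite /t1; near: y; exact: n1.
have [t2a t2b H2] : [/\ `|t2| <= 2^-1, `|t2| <= 3 * th &
      `|op_entropy T (c1 * (y `^ (- a1) * (1 - t2) `^ (- a1))) * ln 2 -
         (a1 * y - a1 * (c0 - th - c / (a1 * s)) * y `^ s)| <= 2 / 3 * (a1 * th * y `^ s)].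
  by rewrite /t2; near: y; exact: n2.
have /andP[t1l t1u] : - 2^-1 <= t1 <= 2^-1 by rewrite -ler_norml.
have /andP[t2l t2u] : - 2^-1 <= t2 <= 2^-1 by rewrite -ler_norml.
have p1 : 0 < 1 - t1 by move: t1u; clear; lra.
have p2 : t2 < 1 by move: t2u; clear; lra.
set e2 := c1 * (y `^ (- a1) * (1 - t1) `^ (- a1)) in H1.
set e1 := c1 * (y `^ (- a1) * (1 - t2) `^ (- a1)) in H2.
have e20 : 0 < e2 by rewrite !mulr_gt0// powR_gt0.
have h1 : op_entropy T e2 <= m%:R.
  rewrite -(ler_pM2r ln2p) hm; move: H1; rewrite -/c0.
  have -> : c0 + th - c0 = th by ring.
  by rewrite ler_norml => /andP[_]; move: aty; clear; move: (a1 * th * y `^ s) => X; lra.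
have h2 : m%:R < op_entropy T e1.
  rewrite -(ltr_pM2r ln2p) hm; move: H2; rewrite -/c0.
  have -> : c0 - th - c0 = - th by ring.
  rewrite mulrN mulNr opprK ler_norml => /andP[+ _]; move: aty; clear.
  by move: (a1 * th * y `^ s) => X; lra.
have /andP[g1 g2] := entropy_number_between hd c10 a10 hcs hl e20 h2 h1.
have a1c0 : c1 * a1 * c0 = c * c1 / s by rewrite /c0; field; rewrite !gt_eqF.
have the1 : c1 * a1 * th <= eta.
  apply: le_trans the; rewrite ler_pM2r// ler_pM2l// lerDl.
  by rewrite ltW// !mulr_gt0.
have l1 : y `^ (- a1) * (c1 + c * c1 / s * y `^ (s - 1)) -
    eta * (y `^ (- a1) * y `^ (s - 1)) <= e1.
  have -> : y `^ (- a1) * (c1 + c * c1 / s * y `^ (s - 1)) -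
    eta * (y `^ (- a1) * y `^ (s - 1)) =
    y `^ (- a1) * (c1 + (c * c1 / s - eta) * y `^ (s - 1)) by ring.
  rewrite /e1 mulrCA ler_pM2l//.
  apply: (@le_trans _ _ (c1 * (1 + a1 * t2))); last first.
    by rewrite ler_pM2l//; exact: powRN1B_ge.
  have -> : c1 * (1 + a1 * t2) = c1 + (c1 * a1 * c0 - c1 * a1 * th) * y `^ (s - 1).
    by rewrite /t2; ring.
  by rewrite lerD2l ler_pM2r// a1c0 lerD2l lerN2.
have l2 : e2 <= y `^ (- a1) * (c1 + c * c1 / s * y `^ (s - 1)) +
    eta * (y `^ (- a1) * y `^ (s - 1)).
  have -> : y `^ (- a1) * (c1 + c * c1 / s * y `^ (s - 1)) +
    eta * (y `^ (- a1) * y `^ (s - 1)) =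
    y `^ (- a1) * (c1 + (c * c1 / s + eta) * y `^ (s - 1)) by ring.
  rewrite /e2 mulrCA ler_pM2l//.
  have at1 : 2 * a1 * `|t1| <= 2^-1.
    apply: (@le_trans _ _ (2 * a1 * (3 * (12 * a1)^-1))).
      rewrite ler_pM2l ?mulr_gt0//; apply: (le_trans t1b); rewrite ler_pM2l//.
    by rewrite le_eqVlt; apply/orP; left; apply/eqP; field; rewrite gt_eqF.
  apply: (@le_trans _ _ (c1 * (1 + a1 * t1 + K * t1 ^+ 2))).
    by rewrite ler_pM2l//; exact: powRN1B_le.
  have tt : t1 ^+ 2 <= 3 * th * (B * y `^ (s - 1)).
    rewrite -[t1 ^+ 2]real_normK ?num_real// expr2; apply: ler_pM => //.
    rewrite /t1 normrM (gtr0_norm D0) ler_pM2r// /B (le_trans (ler_normD _ _))// lerD2l.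
    rewrite gtr0_norm//; apply: (le_trans th4); rewrite invf_le1// ler1n//.
  apply: (@le_trans _ _ (c1 * (1 + a1 * t1 + K * (3 * th * (B * y `^ (s - 1)))))).
    by rewrite ler_pM2l// lerD2l ler_pM2l.
  have -> : c1 * (1 + a1 * t1 + K * (3 * th * (B * y `^ (s - 1)))) =
    c1 + (c1 * a1 * c0 + c1 * (a1 + K * 3 * B) * th) * y `^ (s - 1).
    by rewrite /t1; ring.
  by rewrite lerD2l ler_pM2r// a1c0 lerD2l.
rewrite ler_norml; apply/andP; split.
  by rewrite lerBrDr addrC; exact: le_trans g1.
by rewrite lerBlDr addrC; exact: le_trans l2.
Unshelve. all: by end_near. Qed.

Lemma entropy_number_asymptotics (R : realType) (V : completeNormedModType R) (ip : V -> V -> R)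
    (T : {linear V -> V}) (f : nat -> V) (l : nat -> R) (c1 c2 a1 a2 : R) :
  diagonalized ip T f l -> 0 < c1 -> 0 < a1 -> subcritical (c2 / c1) (a1 - a2 + 1) ->
  log_asymptotics l c1 a1 (c2 / c1) (a1 - a2 + 1) ->
  forall eta, 0 < eta -> exists N : nat, forall m : nat, (N <= m)%N -> (0 < m)%N ->
     `|entropy_number T m
        - (c1 * (a1 / ln 2) `^ a1 * m%:R `^ (- a1)
           + c2 / (a1 - a2 + 1) * (a1 / ln 2) `^ a2 * m%:R `^ (- a2))|
       <= eta * m%:R `^ (- a2).
Proof.
move=> hd c10 a10 hcs hl eta e0.
have ln2p : 0 < ln 2 :> R by rewrite ln_gt0// ltr1n.
have q0 : 0 < a1 / ln 2 by rewrite divr_gt0.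
have qa : 0 < (a1 / ln 2) `^ a2 by rewrite powR_gt0.
have e0' : 0 < eta / (a1 / ln 2) `^ a2 by rewrite divr_gt0.
have s0 : 0 < a1 - a2 + 1 by case/andP: (subcritical_le1 hcs).
have [M [_ hM]] := entropy_number_approx hd c10 a10 hcs hl e0'.
exists (Num.truncn (M * (a1 / ln 2))).+1 => m Nm m0.
have mp : 0 < m%:R :> R by rewrite ltr0n.
pose y := m%:R / (a1 / ln 2).
have y0 : 0 < y by rewrite divr_gt0.
have My : M < y.
  rewrite ltr_pdivlMr//; apply: (lt_le_trans (truncnS_gt _)).
  by rewrite ler_nat.
have hm : m%:R * ln 2 = a1 * y by rewrite /y; field; rewrite !gt_eqF.
have := hM y My m hm.
have yp p : y `^ (- p) = (a1 / ln 2) `^ p * m%:R `^ (- p).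
  rewrite /y [LHS]powRM ?(ltW mp) ?invr_ge0 ?(ltW q0)// mulrC; congr (_ * _).
  by rewrite -[(a1 / ln 2)^-1]powR_inv1 ?(ltW q0)// -powRrM mulN1r opprK.
have y2 : y `^ (- a1) * y `^ (a1 - a2 + 1 - 1) = y `^ (- a2).
  by rewrite -powRD ?(lt0r_neq0 y0) ?implybT//; congr (_ `^ _); ring.
rewrite mulrDr mulrCA y2 !yp.
have -> : c2 / c1 * c1 / (a1 - a2 + 1) = c2 / (a1 - a2 + 1) by rewrite divfK// gt_eqF.
have -> : eta / (a1 / ln 2) `^ a2 * ((a1 / ln 2) `^ a2 * m%:R `^ (- a2)) = eta * m%:R `^ (- a2).
  by rewrite mulrA divfK// gt_eqF.
by rewrite [_ * c1]mulrC !mulrA.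
Qed.

Unset Implicit Arguments.

Theorem theorem1 (R : realType) (V : completeNormedModType R)
  (ip : V -> V -> R) (T : {linear V -> V}) (lam : nat -> R)
  (c1 c2 a1 a2 : R) :
  is_inner_product ip ->
  separable_space V ->
  self_adjoint ip T -> positive_op ip T -> compact_op T ->
  eigenvalue_enum ip T lam ->
  (forall n, (0 < n)%N -> 0 < lam n) ->
  0 < c1 -> 0 < a1 -> 0 < a2 ->
  (a1 < a2 < a1 + 2^-1 \/ (a1 = a2 /\ c2 = 0)) ->
  (forall eta, 0 < eta -> exists N : nat, forall n : nat, (N <= n)%N -> (0 < n)%N ->
     `|lam n - (c1 * n%:R `^ (- a1) + c2 * n%:R `^ (- a2))|
       <= eta * n%:R `^ (- a2)) ->
  (forall eta, 0 < eta -> exists2 delta : R, 0 < delta & forall eps : R,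
     0 < eps -> eps < delta ->
     `|op_entropy T eps
        - (a1 * c1 `^ (a1^-1) / ln 2 * eps `^ (- a1^-1)
           + c2 * c1 `^ ((1 - a2) / a1) / (ln 2 * (a1 - a2 + 1))
             * eps `^ (- ((a1 - a2 + 1) / a1)))|
       <= eta * eps `^ (- ((a1 - a2 + 1) / a1)))
  /\
  (forall eta, 0 < eta -> exists N : nat, forall m : nat, (N <= m)%N -> (0 < m)%N ->
     `|entropy_number T m
        - (c1 * (a1 / ln 2) `^ a1 * m%:R `^ (- a1)
           + c2 / (a1 - a2 + 1) * (a1 / ln 2) `^ a2 * m%:R `^ (- a2))|
       <= eta * m%:R `^ (- a2)).
Proof.
move=> hip _ hsa _ hc [lmono [e [eorth eeig eker]]] lpos c10 a10 a20 ha hlam.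
(* Eigenvalues are numbered from 1, sums over ordinals from 0. *)
pose f i := e i.+1; pose l i := lam i.+1.
have hd : diagonalized ip T f l.
  split=> //.
  - by move=> i j; rewrite /f eorth.
  - by move=> i; rewrite /f /l eeig.
  - by move=> i; rewrite /l lpos.
  - by move=> i j ij; rewrite /l lmono.
  - by move=> x hx; apply: eker => -[//|n] _; exact: hx.
have hcs : subcritical (c2 / c1) (a1 - a2 + 1).
  case: ha => [/andP[h1 h2]|[-> ->]]; last by right; rewrite mul0r subrr add0r.
  by left; apply/andP; split; lra.
have hl : log_asymptotics l c1 a1 (c2 / c1) (a1 - a2 + 1).
  apply: log_asymptotics_of => //; first by move=> i; rewrite /l lpos.
  move=> eta eta0; have [N hN] := hlam eta eta0; exists N => i Ni.
  by apply: hN => //; exact: leqW.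
split; first exact: metric_entropy_asymptotics hd c10 a10 hcs hl.
exact: entropy_number_asymptotics hd c10 a10 hcs hl.
Qed.
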